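(* Let $p\ge 2$, $\alpha,\theta>-1$, $0<R\le\infty$ and let $m\ge 1$ be an integer such that $\theta\ge \alpha-mp$ and $\alpha-mp+1>0$. Put $$p^{*}=\frac{(\theta+1)p}{\alpha-mp+1}.$$ Then there exists a constant $C>0$ (independent of $u$) such that $$\left(\int_0^R |u(r)|^{p^*}r^\theta\,dr\right)^{1/p^*}\le C\left(\int_0^R|\nabla_\alpha^m u(r)|^p r^\alpha\,dr\right)^{1/p}\quad\text{for all } u\in\mathcal D^{m,p}_R(\alpha).$$ In particular, there is a continuous embedding $\mathcal D^{m,p}_R(\alpha)\hookrightarrow L^{p^*}_\theta(0,R)$.
   Context: Let $0<R\le\infty$. $AC_{loc}(0,R)$ is the set of locally absolutely continuous functions on $(0,R)$; for an integer $\ell\ge0$, $AC^{\ell}_{loc}(0,R)$ is the set of $u:(0,R)\to\mathbb R$ with $u^{(\ell)}\in AC_{loc}(0,R)$, where $u^{(\ell)}=d^\ell u/dr^\ell$. For an integer $m\ge1$, $AC^{m-1}_{\mathrm R}(0,R)=\{u\in AC^{m-1}_{loc}(0,R):\lim_{r\to R}u^{(j)}(r)=0,\ j=0,\dots,m-1\}$. For $p\ge1$, $\theta\in\mathbb R$, $L^p_\theta=L^p_\theta(0,R)$ is the space of measurable $u:(0,R)\to\mathbb R$ with $\|u\|_{L^p_\theta}=(\int_0^R|u|^pr^\theta dr)^{1/p}<\infty$. For $\alpha>-1$, $D_{0,R}(\alpha)=D_{0,R}(\alpha,m,p)=\{u\in AC^{m-1}_{\mathrm R}(0,R): u^{(m)}\in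 L^p_\alpha\}$, and $\mathcal D^{m,p}_R(\alpha)$ is the completion of $D_{0,R}(\alpha)$ under the norm $\|u^{(m)}\|_{L^p_\alpha}$. The $\alpha$-generalized Laplacian is $\Delta_\alpha u=r^{-\alpha}(r^\alpha u')'$, and the $\alpha$-generalized $m$-th order gradient is $\nabla^m_\alpha u=\Delta_\alpha^{m/2}u$ if $m$ is even and $\nabla^m_\alpha u=(\Delta_\alpha^{(m-1)/2}u)'$ if $m$ is odd. When $\alpha-mp+1>0$, elements of the completion are regarded as functions on $(0,R)$, with derivatives and $\nabla^m_\alpha$ extended by continuity from $D_{0,R}(\alpha)$. *)

(* Defs.v *)
From HB Require Import structures.
From mathcomp Require Import all_boot all_order all_algebra.
From mathcomp Require Import all_classical all_reals all_analysis.

Set Implicit Arguments.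
Unset Strict Implicit.
Unset Printing Implicit Defensive.

Import Order.TTheory GRing.Theory Num.Theory.
Import numFieldNormedType.Exports.

Local Open Scope classical_set_scope.
Local Open Scope ring_scope.

(* A function on (0, R) is represented by a total function K -> K whose values
   outside (0, R) never matter: every notion below only looks at u on the open
   set (0, R), and derivatives are local. *)

Section Spaces.
Context {K : realType}.
Implicit Types (R : \bar K) (p q theta alpha : K) (m l : nat) (u : K -> K).

Definition zeroto R : set K := [set r | 0 < r /\ (r%:E < R)%E].

(* The filter "r -> R" from inside (0, R). *)
Definition toward R : set_system K :=
  match R with
  | b%:E => b^'-
  | +oo%E => +oo
  | -oo%E => -oo
  end.

Definition abs_cont (a b : K) u :=
  forall e : K, 0 < e -> exists2 d : K, 0 < d &
    forall (n : nat) (s t : 'I_n -> K),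
      (forall i, a <= s i /\ s i <= t i /\ t i <= b) ->
      trivIset [set: 'I_n] (fun i => [set` `]s i, t i[ ]) ->
      \sum_(i < n) (t i - s i) < d ->
      \sum_(i < n) `|u (t i) - u (s i)| < e.

Definition ACloc R : set (K -> K) :=
  [set u | forall a b, zeroto R a -> zeroto R b -> abs_cont a b u].

(* derive1 is total, so the existence of the derivatives u^(1), ..., u^(l)
   on (0, R) has to be required explicitly. *)
Definition ACl_loc R l : set (K -> K) :=
  [set u | (forall j r, (j < l)%N -> zeroto R r -> derivable (derive1n j u) r 1)
           /\ ACloc R (derive1n l u)].

Definition AC_right R m : set (K -> K) :=
  [set u | ACl_loc R m.-1 u /\
           forall j, (j < m)%N -> derive1n j u r @[r --> toward R] --> (0 : K)].

Definition wnorm R p theta u : \bar K :=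
  ((\int[lebesgue_measure]_(r in zeroto R) (`|u r| `^ p * r `^ theta)%:E)
     `^ p^-1)%E.

Definition wLp R p theta : set (K -> K) :=
  [set u | measurable_fun (zeroto R) u /\ (wnorm R p theta u < +oo)%E].

Definition D0 R alpha m p : set (K -> K) :=
  [set u | AC_right R m u /\ wLp R p alpha (derive1n m u)].

Definition Lap alpha u : K -> K :=
  fun r => r `^ (- alpha) * derive1 (fun s => s `^ alpha * derive1 u s) r.

Definition nabla alpha m u : K -> K :=
  if odd m then derive1 (iter m./2 (Lap alpha) u)
  else iter m./2 (Lap alpha) u.

Section Completion.
Context {X : completeNormedModType K}.
Implicit Types (iota : (K -> K) -> X) (fn grad : X -> K -> K).

(* X, together with the canonical map iota, is a completion of D0 under the
   norm |u^(m)|_{L^p_alpha}: a Banach space in which D0 sits linearly,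
   isometrically and densely. Values of iota outside D0 are irrelevant. *)
Definition is_completion R alpha m p iota :=
  [/\ forall a u v, D0 R alpha m p u -> D0 R alpha m p v ->
        iota (fun r => a * u r + v r) = a *: iota u + iota v,
      forall u, D0 R alpha m p u -> `|iota u|%:E = wnorm R p alpha (derive1n m u)
    & dense (iota @` D0 R alpha m p)].

(* fn x is the function on (0, R) as which x is regarded: u |-> u r is extended
   by continuity from D0 for each r. Constant sequences give
   fn (iota u) = u on (0, R), and density of D0 makes fn unique there. *)
Definition realization R alpha m p iota fn :=
  forall (x : X) (U : nat -> K -> K),
    (forall n, D0 R alpha m p (U n)) -> iota (U n) @[n --> \oo] --> x ->
    forall r, zeroto R r -> U n r @[n --> \oo] --> fn x r.

(* grad is the extension by continuity of nabla, from D0 to X, as a map into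
   L^p_alpha; it is unique up to equality almost everywhere. *)
Definition grad_extension R alpha m p iota grad :=
  (forall x, wLp R p alpha (grad x)) /\
  forall (x : X) (U : nat -> K -> K),
    (forall n, D0 R alpha m p (U n)) -> iota (U n) @[n --> \oo] --> x ->
    wnorm R p alpha (fun r => nabla alpha m (U n) r - grad x r)
      @[n --> \oo] --> 0%E.

(* x |-> fn x is a linear, bounded and injective map into L^q_theta, the
   elements of which are functions up to equality almost everywhere. *)
Definition continuous_embedding R q theta fn :=
  [/\ forall a x y r, zeroto R r -> fn (a *: x + y) r = a * fn x r + fn y r,
      forall x, wLp R q theta (fn x),
      exists2 C : K, 0 < C & forall x, (wnorm R q theta (fn x) <= (C * `|x|)%:E)%E
    & forall x, {ae lebesgue_measure, forall r, zeroto R r -> fn x r = 0} ->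
        x = 0].

End Completion.
End Spaces.

(* Main.v *)
Require Import Defs.
From HB Require Import structures.
From mathcomp Require Import all_boot all_order all_algebra.
From mathcomp Require Import all_classical all_reals all_analysis.
From mathcomp Require Import measurable_realfun ring lra.

Set Implicit Arguments.
Unset Strict Implicit.
Unset Printing Implicit Defensive.

Import Order.TTheory GRing.Theory Num.Theory.
Import numFieldNormedType.Exports.

Local Open Scope classical_set_scope.
Local Open Scope ring_scope.

(* D0 is already complete. Given g in L^p_alpha, integrate m times from r to R:
   since alpha - m p + 1 > 0, Hoelder's inequality makes every tail integral
   converge and Hardy's inequality keeps every primitive in a weighted L^p, so
   g = u^(m) almost everywhere for some u in D0. With Riesz-Fischer this makes
   iota onto, and each x in X is identified with some u in D0.

   On D0, write v_k = nabla^k u. Then v_(k+1) = r^(-e) (r^e v_k)' with e = 0 or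
   e = alpha according to the parity of k, and Hardy's inequality, applied m
   times, bounds the L^p norm of u with weight r^(alpha - m p) by that of v_m
   with weight r^alpha. Moreover |u(r)|^p <= C r^(-(alpha - m p + 1)) |v_m|^p,
   and |u|^pstar r^theta is the product of |u|^p r^(alpha - m p) and a power of
   |u|^p r^(alpha - m p + 1), which gives the inequality.

   The calculus of absolutely continuous functions rests on their density: such
   a function is a difference of nondecreasing absolutely continuous ones, whose
   Stieltjes measures have Radon-Nikodym derivatives. *)

(** The space [X] is abstract, so a function must be attached to each of its elements. An
    approximation argument would leave two questions open: whether the limit function determines the
    element, and how its gradient is related to the limit. An actual preimage in [D0] settles both:
    the inequality is needed on [D0] only, and an element whose function vanishes almost everywhere
    is 0 because functions in [D0] are continuous. The obstacle in the chain of Hardy inequalities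
    is the end 0, where [D0] imposes nothing. For odd orders the weight forces integration from 0,
    so r^alpha v_k must be small somewhere near 0. This is read off from an expansion of v_k into
    terms r^(j-k) u^(j), j <= k, together with pointwise bounds on the u^(j). The same expansion
    shows that v_m lies in L^p_alpha, that it is linear in u up to null sets, and that v_k vanishes
    at R for k < m. Since [derive1] is total, with value 0 where the limit fails to exist,
    identities for u^(m) and v_m hold only almost everywhere, and the measurability of v_m has to be
    proved. *)

Section NonOverlapping.
Context {K : realType}.
Implicit Types (a b x y e d : K) (f g : K -> K) (q : K * K) (L : seq (K * K)).

(** * Absolute continuity along finite lists of intervals, and bounded variation *)

Definition nonoverlap (q1 q2 : K * K) := (q1.2 <= q2.1) || (q2.2 <= q1.1).

Definition subitv a b q := [&& a <= q.1, q.1 <= q.2 & q.2 <= b].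

Definition tot_length L : K := \sum_(q <- L) (q.2 - q.1).

Definition tot_incr f L : K := \sum_(q <- L) `|f q.2 - f q.1|.

(** Lists, unlike families indexed by ['I_n], are easily cut, refined and concatenated; the
    arguments on variation below do all three. *)
Definition seq_abs_cont a b f := forall e, 0 < e -> exists2 d, 0 < d &
  forall L, all (subitv a b) L -> pairwise nonoverlap L ->
    tot_length L < d -> tot_incr f L < e.

Lemma abs_cont_seq a b f : abs_cont a b f -> seq_abs_cont a b f.
Proof.
move=> acf e e0; have [d d0 H] := acf e e0; exists d => // L Lab Lno Ld.
pose x0 : K * K := (0, 0).
have := H (size L) (fun i => (nth x0 L i).1) (fun i => (nth x0 L i).2).
rewrite /tot_length /tot_incr in Ld *.
rewrite !(big_nth x0) !big_mkord in Ld *.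
apply => //.
- move=> i; have /(all_nthP x0) /(_ i (ltn_ord i)) := Lab.
  by move=> /and3P[].
- apply/trivIsetP => i j _ _ ij; apply/seteqP; split => // x /=.
  rewrite !in_itv/= => -[/andP[ix xi] /andP[jx xj]].
  wlog : i j ij ix xi jx xj / (i < j)%N.
    move=> W; have : (i < j)%N || (j < i)%N.
      by rewrite -neq_ltn.
    by case/orP => h; [exact: (W i j)|apply: (W j i) => //; rewrite eq_sym].
  move=> ltij; have /(pairwiseP x0) /(_ i j) := Lno.
  rewrite !inE !ltn_ord => /(_ isT isT ltij) /orP[] h.
    by have := lt_trans xi (le_lt_trans h jx); rewrite ltxx.
  by have := lt_trans xj (le_lt_trans h ix); rewrite ltxx.
Qed.

Fixpoint pairs a (s : seq K) : seq (K * K) :=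
  if s is x :: s' then (a, x) :: pairs x s' else [::].

Lemma variation_pairs a b f s : variation a b f s = tot_incr f (pairs a s).
Proof.
rewrite /tot_incr; elim: s a => [|x s IH] a.
  by rewrite /variation /= big_geq// big_nil.
rewrite /= big_cons -IH /variation /= big_nat_recl//=.
Qed.

Lemma path_last_le a s : path <%R a s -> a <= last a s.
Proof.
by elim: s a => [//|x s IH] a /= /andP[/ltW ax /IH]; exact: le_trans.
Qed.

Lemma subitv_pairs a s : path <%R a s -> all (subitv a (last a s)) (pairs a s).
Proof.
elim: s a => [//|x s IH] a /= /andP[ax xs].
have xl := path_last_le xs.
rewrite /subitv /= lexx (ltW ax) xl /=.
apply: sub_all (IH _ xs) => q /and3P[h1 h2 h3]; apply/and3P; split => //.
exact: le_trans (ltW ax) h1.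
Qed.

Lemma nonoverlap_pairs a s : path <%R a s -> pairwise nonoverlap (pairs a s).
Proof.
elim: s a => [//|x s IH] a /= /andP[ax xs].
rewrite IH // andbT; apply: sub_all (subitv_pairs xs) => q /and3P[h1 _ _].
by rewrite /nonoverlap /= h1.
Qed.

Lemma tot_length_pairs a s : tot_length (pairs a s) = last a s - a.
Proof.
rewrite /tot_length; elim: s a => [|x s IH] a /=; first by rewrite big_nil subrr.
by rewrite big_cons IH /=; ring.
Qed.

Lemma tot_length_cat L1 L2 :
  tot_length (L1 ++ L2) = tot_length L1 + tot_length L2.
Proof. by rewrite /tot_length big_cat. Qed.

Lemma tot_incr_cat f L1 L2 :
  tot_incr f (L1 ++ L2) = tot_incr f L1 + tot_incr f L2.
Proof. by rewrite /tot_incr big_cat. Qed.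

(** Any subdivision of an interval shorter than [d] has variation below 1, and finitely many such
    intervals make up [a, b]. *)
Lemma seq_abs_cont_BV a b f : a <= b -> seq_abs_cont a b f ->
  bounded_variation a b f.
Proof.
move=> ab acf; have [d d0 H] := acf 1 ltr01.
have short x y : a <= x -> x <= y -> y <= b -> y - x < d ->
    bounded_variation x y f.
  move=> ax xy yb yxd; exists 1 => _ [s [sp /eqP sl] <-].
  rewrite variation_pairs ltW// H//.
  - apply: sub_all (subitv_pairs sp) => q /and3P[h1 h2 h3].
    apply/and3P; split => //; first exact: le_trans h1.
    by rewrite (le_trans h3)// sl.
  - exact: nonoverlap_pairs.
  - by rewrite tot_length_pairs sl.
(* Pieces of length [d / 2] are peeled off at the left end; halving keeps them strictly shorter than
   [d]. *)
have step n x : a <= x -> x <= b -> b - x < d / 2 *+ n.+1 ->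
    bounded_variation x b f.
  elim: n x => [|n IH] x ax xb.
    by rewrite mulr1n => h; apply: short => //; lra.
  move=> h; have [bxd|dbx] := ltP (b - x) d; first exact: short.
  have xy : x <= x + d / 2 by lra.
  have yb : x + d / 2 <= b by lra.
  apply/bounded_variationP => //.
  rewrite (total_variationD f xy yb) fin_numD; apply/andP; split.
    by apply/bounded_variationP => //; apply: short => //; lra.
  apply/bounded_variationP => //; apply: IH => //; first by lra.
  by move: h; rewrite [X in _ < X]mulrS; lra.
have [n hn] : exists n, b - a < d / 2 *+ n.+1.
  exists (Num.bound ((b - a) / (d / 2))).
  have := archi_boundP (_ : 0 <= (b - a) / (d / 2)).
  rewrite divr_ge0 ?subr_ge0 ?(ltW (divr_gt0 d0 _))// => /(_ isT).
  rewrite ltr_pdivrMr ?divr_gt0// => h; apply: (lt_le_trans h).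
  by rewrite -[leRHS]mulr_natl ler_pM2r ?divr_gt0// ler_nat.
exact: step hn.
Qed.

(** The modulus [d] of [f] serves its variation too: subdividing each interval of [L] keeps the list
    nonoverlapping and its total length unchanged. *)
Lemma seq_abs_cont_TV a b f e d : a <= b -> bounded_variation a b f ->
  (forall L, all (subitv a b) L -> pairwise nonoverlap L ->
    tot_length L < d -> tot_incr f L < e) ->
  forall L, all (subitv a b) L -> pairwise nonoverlap L -> tot_length L < d ->
    (\sum_(q <- L) total_variation q.1 q.2 f <= e%:E)%E.
Proof.
move=> ab bvf H.
have TVfin q : subitv a b q -> total_variation q.1 q.2 f \is a fin_num.
  move=> /and3P[h1 h2 h3]; apply/bounded_variationP => //.
  apply: (@bounded_variationl _ _ _ b) => //.
  by apply: (@bounded_variationr _ a) => //; exact: le_trans h3.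
(* [L1] collects the intervals already subdivided, [L2] those still measured by their variation; one
   supremum is removed at a time. *)
suff main L2 : forall L1, all (subitv a b) (L1 ++ L2) ->
    pairwise nonoverlap (L1 ++ L2) -> tot_length (L1 ++ L2) < d ->
    ((tot_incr f L1)%:E + \sum_(q <- L2) total_variation q.1 q.2 f <= e%:E)%E.
  move=> L h1 h2 h3; have := main L [::] h1 h2 h3.
  by rewrite /tot_incr big_nil add0e.
elim: L2 => [|[s t] L2 IH] L1.
  rewrite cats0 big_nil adde0 => h1 h2 h3; rewrite lee_fin ltW//; exact: H.
rewrite all_cat /= => /and3P[L1ab /[dup] stab /and3P[/= as_ st tb] L2ab].
rewrite pairwise_cat /= => /and3P[L1L2 pL1 /andP[stL2 pL2]] len.
have Bfin : (\sum_(q <- L2) total_variation q.1 q.2 f)%E \is a fin_num.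
  rewrite sum_fin_num; apply/allP => x /mapP[q]; rewrite mem_filter /= => qL2 ->.
  by apply: TVfin; move/allP : L2ab => /(_ q qL2).
rewrite big_cons /= addeCA -leeBrDr ?fin_numD ?Bfin//.
rewrite {1}/total_variation; apply: ge_ereal_sup => _ [_ [l [pl /eqP ll] <-] <-].
rewrite leeBrDr ?fin_numD ?Bfin// addeA -EFinD variation_pairs -tot_incr_cat.
have inl q : q \in pairs s l -> subitv s t q.
  by move=> ql; have /allP/(_ q ql) := subitv_pairs pl; rewrite ll.
have noR q : nonoverlap (s, t) q -> forall r, r \in pairs s l -> nonoverlap r q.
  move=> + r rl; have /and3P[h1 h2 h3] := inl r rl.
  rewrite /nonoverlap /= => /orP[h|h]; apply/orP.
    by left; exact: le_trans h.
  by right; exact: le_trans h1.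
have noC q r : nonoverlap q r = nonoverlap r q by rewrite /nonoverlap orbC.
apply: IH.
- rewrite !all_cat L1ab L2ab !andbT; apply/allP => q /inl /and3P[h1 h2 h3].
  by apply/and3P; split => //; [exact: le_trans h1|exact: le_trans h3 _].
- move: L1L2; rewrite allrel_consr => /andP[L1st L1L2].
  rewrite !pairwise_cat pL1 pL2 nonoverlap_pairs// !andbT allrel_catl.
  rewrite L1L2 andbT; apply/andP; split; apply/allrelP => q r qm rm.
    by apply: (noR r) => //; move/allP : stL2 => /(_ r rm).
  by apply: (noR r) => //; rewrite noC; move/allP : L1st => /(_ r rm).
- move: len; rewrite !tot_length_cat tot_length_pairs ll.
  by rewrite /tot_length big_cons /=; lra.
Qed.

End NonOverlapping.

(** * Stieltjes measures of absolutely continuous functions and their densities *)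

Section StieltjesRadonNikodym.
Context {K : realType}.
Implicit Types (a b c x y e d : K) (f g F : K -> K) (q : K * K) (L : seq (K * K)).
Local Notation mu := (@lebesgue_measure K).

Definition ocs q : set K := `]q.1, q.2]%classic.

Definition ocunion L : set K := \big[setU/set0]_(q <- L) ocs q.

Definition proper_itvs L := all (fun q => q.1 <= q.2) L.

Lemma ocunion_nil : ocunion [::] = set0.
Proof. by rewrite /ocunion big_nil. Qed.

Lemma ocunion_cons q L : ocunion (q :: L) = ocs q `|` ocunion L.
Proof. by rewrite /ocunion big_cons. Qed.

Lemma ocunion_cat L1 L2 : ocunion (L1 ++ L2) = ocunion L1 `|` ocunion L2.
Proof. by rewrite /ocunion big_cat. Qed.

Lemma measurable_ocunion L : measurable (ocunion L : set K).
Proof.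
elim: L => [|q L IH]; first by rewrite ocunion_nil.
by rewrite ocunion_cons; apply: measurableU => //; exact: measurable_itv.
Qed.

(* The gaps that the intervals of L leave in ]a, b], some of which may be empty. *)
Fixpoint cutout L a b : seq (K * K) :=
  if L is (c, d) :: L' then
    cutout L' a (Num.max a (Num.min b c)) ++ cutout L' (Num.min b (Num.max a d)) b
  else [:: (a, b)].

(** An empty gap may sit in the interior of an interval of [L]; hence the exception [q.1 == q.2] in
    the third clause. [disjointify] drops the empty gaps. *)
Lemma cutoutP L a b : proper_itvs L -> a <= b ->
  [/\ all (subitv a b) (cutout L a b), pairwise nonoverlap (cutout L a b),
      (forall q r, q \in cutout L a b -> r \in L -> nonoverlap q r || (q.1 == q.2)) &
      ocunion (cutout L a b) = ocs (a, b) `\` ocunion L].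
Proof.
elim: L a b => [|[c d] L IH] a b /=.
  move=> _ ab; split => //=; first by rewrite /subitv /= ab !lexx.
  by rewrite ocunion_cons !ocunion_nil setU0 setD0.
move=> /andP[cd pL] ab.
set m := Num.max a _; set M := Num.min b _.
have am : a <= m by rewrite /m le_max lexx.
have mb : m <= b by rewrite /m ge_max ab ge_min lexx.
have aM : a <= M by rewrite /M le_min ab le_max lexx.
have Mb : M <= b by rewrite /M ge_min lexx.
have mM : m <= M.
  rewrite /m /M le_min !ge_max ab ge_min lexx/= le_max lexx/=.
  by rewrite ge_min !le_max cd !orbT.
have [h1 h2 h3 h4] := IH a m pL am.
have [k1 k2 k3 k4] := IH M b pL Mb.
split.
- rewrite all_cat; apply/andP; split.
    apply: sub_all h1 => q /and3P[l1 l2 l3]; apply/and3P; split => //.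
    exact: le_trans mb.
  apply: sub_all k1 => q /and3P[l1 l2 l3]; apply/and3P; split => //.
  exact: le_trans l1.
- rewrite pairwise_cat h2 k2 !andbT; apply/allrelP => q r qm rm.
  move/allP : h1 => /(_ q qm) /and3P[_ _ l3].
  move/allP : k1 => /(_ r rm) /and3P[l1 _ _].
  by rewrite /nonoverlap (le_trans l3 (le_trans mM l1)).
- move=> q r; rewrite mem_cat inE => /orP[qm|qm] /predU1P[->|rL].
  + move/allP : h1 => /(_ q qm) /and3P[l1 l2 l3].
    rewrite /nonoverlap /=; have [qc|cq] := leP q.2 c => //=.
    have qa : q.2 <= a.
      move: l3; rewrite /m le_max => /orP[//|]; rewrite le_min => /andP[_].
      by rewrite leNgt cq.
    by apply/orP; right; rewrite eq_le l2 (le_trans qa l1).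
  + exact: h3.
  + move/allP : k1 => /(_ q qm) /and3P[l1 l2 l3].
    rewrite /nonoverlap /=; have [dq|qd] := leP d q.1; first by rewrite orbT.
    have bq : b <= q.1.
      move: l1; rewrite /M ge_min => /orP[//|]; rewrite ge_max => /andP[_].
      by rewrite leNgt qd.
    by apply/orP; right; rewrite eq_le l2 (le_trans l3 bq).
  + exact: k3.
- rewrite ocunion_cat h4 k4 ocunion_cons -setDUl -setDDl.
  congr (_ `\` _).
  apply/seteqP; split => x /=; rewrite /ocs /= !in_itv /=.
    rewrite /m /M; case=> /andP[h l].
      have xc : x <= c.
        move: l; rewrite le_max => /orP[|]; first by rewrite leNgt h.
        by rewrite le_min => /andP[].
      have xb : x <= b.
        move: l; rewrite le_max => /orP[|]; first by rewrite leNgt h.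
        by rewrite le_min => /andP[].
      rewrite h xb; split => //; apply/negP; rewrite negb_and -leNgt.
      by rewrite xc.
    have : b < x \/ Num.max a d < x.
      by move: h; rewrite gt_min => /orP; case; [left|right].
    case; first by rewrite ltNge l.
    rewrite gt_max l => /andP[-> dx]; split => //.
    by apply/negP; rewrite negb_and -!ltNge dx orbT.
  move=> [/andP[ax xb]] /negP; rewrite negb_and -leNgt -ltNge => /orP[xc|dx].
    by left; rewrite ax /m le_max le_min xb xc orbT.
  by right; rewrite xb andbT /M gt_min gt_max ax dx orbT.
Qed.

(** Absolute continuity controls nonoverlapping lists only, whereas a cover of a null set may
    overlap. Each new interval is replaced by those of its parts that the list built so far leaves
    uncovered. *)
Lemma disjointify L : proper_itvs L ->
  exists L', [/\ proper_itvs L', pairwise nonoverlap L' & ocunion L' = ocunion L].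
Proof.
elim: L => [|[a b] L IH] /=; first by exists [::].
move=> /andP[ab /IH [L' [pL' nL' UL']]].
have [h1 h2 h3 h4] := cutoutP pL' ab.
pose C := [seq q <- cutout L' a b | q.1 != q.2].
exists (C ++ L'); split.
- rewrite /proper_itvs all_cat; apply/andP; split => //.
  apply/allP => q; rewrite mem_filter => /andP[_ qc].
  by move/allP : h1 => /(_ q qc) /and3P[].
- rewrite pairwise_cat nL' andbT; apply/andP; split.
    apply/allrelP => q r; rewrite mem_filter => /andP[q0 qc] rL.
    by have := h3 q r qc rL; rewrite (negbTE q0) orbF.
  exact: pairwise_filter.
- have CE : ocunion C = ocunion (cutout L' a b).
    rewrite /C; elim: (cutout _ _ _) => [//|q s IHs] /=.
    case: ifPn => [_|/negPn/eqP qq]; first by rewrite !ocunion_cons IHs.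
    by rewrite ocunion_cons IHs /ocs qq set_itvoc0 set0U.
  rewrite ocunion_cat CE h4 UL' ocunion_cons; apply/seteqP; split => x /=.
    by case=> [[]|]; [left|right].
  have [|nx] := pselect (ocunion L x); first by right.
  by case; left.
Qed.

Lemma measure_ocunion (nu : {measure set (measurableTypeR K) -> \bar K}) L :
  proper_itvs L -> pairwise nonoverlap L ->
  nu (ocunion L) = (\sum_(q <- L) nu (ocs q))%E.
Proof.
elim: L => [|q L IH]; first by rewrite ocunion_nil measure0 big_nil.
move=> /= /andP[qp pL] /andP[qL nL].
rewrite ocunion_cons big_cons -IH// measureU//.
- exact: measurable_itv.
- exact: measurable_ocunion.
- apply/seteqP; split => // x [] xq; elim: L qL {IH pL nL} => [|r L IH] /=.
    by rewrite ocunion_nil.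
  move=> /andP[qr qL]; rewrite ocunion_cons => -[xr|]; last exact: IH.
  move: xq xr qr; rewrite /ocs /= !in_itv /= => /andP[l1 l2] /andP[k1 k2].
  case/orP => h.
    by have := le_lt_trans (le_trans l2 h) k1; rewrite ltxx.
  by have := le_lt_trans (le_trans k2 h) l1; rewrite ltxx.
Qed.

Lemma stieltjes_ocs (F : cumulative K K) q : q.1 <= q.2 ->
  lebesgue_stieltjes_measure F (ocs q) = (F q.2 - F q.1)%:E.
Proof.
move=> h; rewrite /lebesgue_stieltjes_measure /measure_extension/=.
rewrite measurable_mu_extE//=; last exact: is_ocitv.
by rewrite /ocs wlength_itv_bnd.
Qed.

(** A null set is covered by countably many intervals [G k] of total length below [d]. The union
    [B n] of the first [n] of them, rewritten as a nonoverlapping list, has length below [d], hence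
    Stieltjes measure at most [e]; continuity from below passes to the whole cover. *)
Lemma stieltjes_dominated (F : cumulative K K) :
  (forall e, 0 < e -> exists2 d, 0 < d & forall L, proper_itvs L ->
    pairwise nonoverlap L -> tot_length L < d -> tot_incr F L < e) ->
  lebesgue_stieltjes_measure F `<< mu.
Proof.
move=> HF N N0 A mA AN.
have A0 : mu A = 0 by exact: N0.
apply/eqP; rewrite eq_le measure_ge0 andbT; apply/lee_addgt0Pr => e e0.
rewrite add0e; have [d d0 H] := HF e e0.
have : (mu A < d%:E)%E by rewrite A0 lte_fin.
rewrite /lebesgue_measure /lebesgue_stieltjes_measure /measure_extension.
move=> /ereal_inf_lt[_ [/= G [mG AG] <-] Gd].
have /choice[q qP] : forall k, exists q : K * K, q.1 <= q.2 /\ G k = ocs q.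
  move=> k; have /ocitvP[->|[x x12 ->]] := mG k.
    by exists (0, 0); split => //; rewrite /ocs set_itvoc0.
  by exists x; split => //; exact: ltW.
pose B n := ocunion [seq q k | k <- iota 0 n].
have BE n : B n = \big[setU/set0]_(k < n) G k.
  rewrite /B /ocunion big_map -(big_mkord xpredT G) /index_iota subn0.
  by apply: eq_bigr => k _; rewrite (qP k).2.
have Bp n : proper_itvs [seq q k | k <- iota 0 n].
  by apply/allP => _ /mapP[k _ ->]; exact: (qP k).1.
have mB n : measurable (B n : set (measurableTypeR K)) by exact: measurable_ocunion.
have muB n : (mu (B n) < d%:E)%E.
  apply: le_lt_trans Gd; rewrite BE.
  apply: (@le_trans _ _ (\sum_(k < n) mu (G k))%E).
    rewrite -(big_mkord xpredT G) -(big_mkord xpredT (fun k => mu (G k))).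
    elim: n => [|n IH]; first by rewrite !big_geq// measure0.
    rewrite !big_nat_recr//=; apply: le_trans (leeD2r _ IH).
    apply: measureU2 => //.
      apply: bigsetU_measurable => i _; rewrite (qP i).2; exact: measurable_itv.
    by rewrite (qP n).2; exact: measurable_itv.
  rewrite -(big_mkord xpredT (fun k => mu (G k))).
  apply: (@le_trans _ _ (\sum_(0 <= k < n) wlength idfun (G k))%E).
    apply: lee_sum => k _; rewrite (qP k).2 -/(lebesgue_stieltjes_measure _ _).
    rewrite /lebesgue_measure stieltjes_ocs ?(qP k).1//.
    by rewrite /ocs wlength_itv_bnd ?(qP k).1.
  by apply: nneseries_lim_ge => k _ _; exact: wlength_ge0.
have nuB n : (lebesgue_stieltjes_measure F (B n) <= e%:E)%E.
  have [L [pL nL UL]] := disjointify (Bp n).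
  rewrite /B -UL measure_ocunion//.
  have -> : (\sum_(r <- L) lebesgue_stieltjes_measure F (ocs r) =
             (tot_incr F L)%:E)%E.
    rewrite /tot_incr -sumEFin; apply: eq_big_seq => r rL.
    have r12 : r.1 <= r.2 by move/allP : pL => /(_ r rL).
    rewrite stieltjes_ocs// ger0_norm// subr_ge0.
    exact: cumulative_is_nondecreasing.
  rewrite lee_fin ltW// H// -lte_fin.
  suff <- : (\sum_(r <- L) mu (ocs r))%E = (tot_length L)%:E.
    by have := muB n; rewrite /B -UL measure_ocunion.
  rewrite /tot_length -sumEFin; apply: eq_big_seq => r rL.
  have r12 : r.1 <= r.2 by move/allP : pL => /(_ r rL).
  by rewrite /lebesgue_measure stieltjes_ocs.
have mUB : measurable (\bigcup_n B n : set (measurableTypeR K)).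
  exact: bigcupT_measurable.
have ndB : {homo B : n m / (n <= m)%N >-> (n <= m)%O}.
  by move=> n m nm; rewrite !BE; apply/subsetPset; exact: subset_bigsetU.
apply: (@le_trans _ _ (lebesgue_stieltjes_measure F (\bigcup_n B n))).
  apply: le_measure; rewrite ?inE// => x /AG[k _ Gk].
  by exists k.+1 => //; rewrite BE big_ord_recr /=; right.
have cB : (lebesgue_stieltjes_measure F (B n) @[n --> \oo] -->
    lebesgue_stieltjes_measure F (\bigcup_n B n))%E.
  exact: nondecreasing_cvg_mu.
rewrite -(cvg_lim _ cB)//.
apply: lime_le; first by apply/cvg_ex; eexists; exact: cB.
by apply: nearW => n; exact: nuB.
Qed.

(** Projection of the line onto [a, b]: composing with it extends a function on [a, b] by constants,
    as a Stieltjes measure on the line requires. *)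
Definition clamp a b x := Num.max a (Num.min b x).

Lemma clamp_ge a b x : a <= clamp a b x.
Proof. by rewrite /clamp le_max lexx. Qed.

Lemma clamp_le a b x : a <= b -> clamp a b x <= b.
Proof. by move=> ab; rewrite /clamp ge_max ab ge_min lexx. Qed.

Lemma clamp_id a b x : a <= x -> x <= b -> clamp a b x = x.
Proof. by move=> ax xb; rewrite /clamp (min_idPr xb) (max_idPr ax). Qed.

Lemma clamp_homo a b x y : x <= y -> clamp a b x <= clamp a b y.
Proof.
move=> xy; rewrite /clamp ge_max le_max lexx/= le_max; apply/orP; right.
by rewrite le_min !ge_min lexx xy orbT.
Qed.

Lemma clamp_lip a b x y : x <= y -> clamp a b y - clamp a b x <= y - x.
Proof.
rewrite /clamp => xy.
by case: (leP b x) => ?; case: (leP b y) => ?; case: (leP a b) => ?;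
  case: (leP a x) => ?; case: (leP a y) => ?; lra.
Qed.

(** [clamp] is nondecreasing and 1-Lipschitz, so it maps nonoverlapping lists to nonoverlapping
    lists that are no longer in total. *)
Lemma seq_abs_cont_clamp a b F : a <= b -> (forall x, F x = F (clamp a b x)) ->
  seq_abs_cont a b F ->
  forall e, 0 < e -> exists2 d, 0 < d & forall L, proper_itvs L ->
    pairwise nonoverlap L -> tot_length L < d -> tot_incr F L < e.
Proof.
move=> ab Fc acF e e0; have [d d0 H] := acF e e0; exists d => // L pL nL Ld.
pose cl q := (clamp a b q.1, clamp a b q.2).
have -> : tot_incr F L = tot_incr F [seq cl q | q <- L].
  by rewrite /tot_incr big_map; apply: eq_bigr => q _; rewrite /cl /= -!Fc.
apply: H.
- apply/allP => _ /mapP[q qL ->]; rewrite /subitv /= clamp_ge clamp_le//= andbT.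
  by apply: clamp_homo; move/allP : pL => /(_ q qL).
- rewrite pairwise_map; apply: sub_pairwise nL => q r /orP[] h.
    by rewrite /nonoverlap /= clamp_homo.
  by apply/orP; right; exact: clamp_homo.
- apply: le_lt_trans Ld; rewrite /tot_length big_map.
  rewrite big_seq [leRHS]big_seq; apply: ler_sum => q qL.
  by apply: clamp_lip; move/allP : pL => /(_ q qL).
Qed.

(** Absolute continuity is used twice: on a single short interval it makes [F] right continuous,
    hence a cumulative function, and on lists it makes the Stieltjes measure absolutely continuous,
    so that it has a density. *)
Lemma monotone_density a b F : a < b -> {homo F : x y / x <= y} ->
  (forall x, F x = F (clamp a b x)) -> seq_abs_cont a b F ->
  exists g, mu.-integrable setT (EFin \o g) /\
    forall x, a <= x -> x <= b -> F x - F a = \int[mu]_(t in `]a, x]) g t.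
Proof.
move=> ab ndF Fc acF; have acF' := seq_abs_cont_clamp (ltW ab) Fc acF.
have rcF : right_continuous F.
  move=> x; apply/cvgrPdist_lt => e e0; have [d d0 H] := acF' e e0.
  near=> y; have xy : x < y by near: y; exact: nbhs_right_gt.
  have yd : y < x + d by near: y; apply: nbhs_right_lt; rewrite ltrDl.
  have := H [:: (x, y)]; rewrite /tot_incr /tot_length !big_seq1 /= (ltW xy).
  by rewrite distrC; apply => //; lra.
pose Fi := isCumulative.Build K _ K F ndF rcF.
pose FC : cumulative K K := HB.pack F Fi.
pose D : set (measurableTypeR K) := `]a, b]%classic.
have mD : measurable D by exact: measurable_itv.
have nuE x : a <= x -> lebesgue_stieltjes_measure FC `]a, x]%classic = (F x - F a)%:E.
  by move=> ax; exact: (@stieltjes_ocs FC (a, x)).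
have nuD : (lebesgue_stieltjes_measure FC D < +oo)%E.
  by rewrite nuE ?ltW// ltry.
(* The restriction to []a, b]] is a finite measure, to which Radon-Nikodym applies. *)
pose nu := mfrestr mD nuD.
have numu : nu `<< mu.
  move=> N N0 A mA AN; apply: (@stieltjes_dominated FC acF' N N0).
    exact: measurableI.
  by move=> x [/AN].
have fint := Radon_Nikodym_SigmaFinite.f_integrable numu.
have ffin := Radon_Nikodym_SigmaFinite.f_fin_num numu.
have fE := Radon_Nikodym_SigmaFinite.f_integral numu.
set f0 := Radon_Nikodym_SigmaFinite.f _ _ in fint ffin fE.
have fineE : EFin \o (fine \o f0) = f0.
  by apply/funext => x /=; rewrite fineK.
exists (fine \o f0); split; first by rewrite fineE.
move=> x ax xb; have mx : measurable (`]a, x]%classic : set (measurableTypeR K)).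
  exact: measurable_itv.
have : (lebesgue_stieltjes_measure FC (`]a, x]%classic `&` D) =
    \int[mu]_(t in `]a, x]%classic) f0 t)%E by exact: fE.
rewrite (_ : _ `&` _ = `]a, x]%classic); last first.
  apply/seteqP; split => y; first by case.
  move=> h; split => //; move: h; rewrite /D /= !in_itv /= => /andP[-> yx].
  exact: le_trans xb.
rewrite nuE// /Rintegral => h.
under eq_integral do rewrite /= fineK//.
by rewrite -h.
Unshelve. all: by end_near. Qed.

(* f = V - (V - f), where V is the variation of f from a; both terms are
   nondecreasing and absolutely continuous. *)
Lemma abs_cont_density a b f : a < b -> abs_cont a b f ->
  exists g, mu.-integrable setT (EFin \o g) /\
    forall x, a <= x -> x <= b -> f x - f a = \int[mu]_(t in `]a, x]) g t.
Proof.
move=> ab /abs_cont_seq acf; have ab' := ltW ab.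
have bvf := seq_abs_cont_BV ab' acf.
pose c := clamp a b.
have TVfin x y : a <= x -> x <= y -> y <= b -> total_variation x y f \is a fin_num.
  move=> ax xy yb; apply/bounded_variationP => //.
  apply: (@bounded_variationl _ _ _ b) => //.
  by apply: (@bounded_variationr _ a) => //; exact: le_trans yb.
pose v x := fine (total_variation a (c x) f).
pose w x := v x - f (c x).
have vB x y : x <= y -> v y - v x = fine (total_variation (c x) (c y) f).
  move=> xy; rewrite /v (@total_variationD _ a (c y) (c x)) ?clamp_ge ?clamp_homo//.
  by rewrite fineD ?TVfin ?clamp_ge ?clamp_le ?clamp_homo// addrAC subrr add0r.
have vBf x y : x <= y -> `|f (c y) - f (c x)| <= v y - v x.
  move=> xy; rewrite vB// -lee_fin fineK ?TVfin ?clamp_ge ?clamp_le ?clamp_homo//.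
  by apply: total_variation_ge; exact: clamp_homo.
have cc x : c (c x) = c x by rewrite /c clamp_id ?clamp_ge ?clamp_le.
have ndv : {homo v : x y / x <= y}.
  by move=> x y xy; rewrite -subr_ge0; apply: le_trans (vBf _ _ xy).
have ndw : {homo w : x y / x <= y}.
  move=> x y xy; rewrite /w -subr_ge0.
  have := vBf _ _ xy; rewrite ler_norml => /andP[_]; lra.
have vc x : v x = v (c x) by rewrite /v cc.
have wc x : w x = w (c x) by rewrite /w -vc cc.
have acv : seq_abs_cont a b v.
  (* Passing to suprema turns the strict bound into a weak one; [e / 2] leaves the room to restore
     it. *)
  move=> e e0; have [d d0 H] := acf (e / 2) (divr_gt0 e0 (ltr0Sn _ 1)).
  exists d => // L Lab nL Ld.
  have := seq_abs_cont_TV ab' bvf H Lab nL Ld.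
  have -> : (\sum_(q <- L) total_variation q.1 q.2 f = (tot_incr v L)%:E)%E.
    rewrite /tot_incr -sumEFin; apply: eq_big_seq => q qL.
    move/allP : Lab => /(_ q qL) /and3P[h1 h2 h3].
    rewrite ger0_norm ?subr_ge0 ?ndv// vB// /c.
    rewrite !clamp_id ?fineK ?TVfin//; first exact: le_trans h2.
    exact: le_trans h3.
  by rewrite lee_fin => /le_lt_trans; apply; lra.
have acw : seq_abs_cont a b w.
  move=> e e0; have [d d0 H] := acv (e / 2) (divr_gt0 e0 (ltr0Sn _ 1)).
  exists d => // L Lab nL Ld; have := H L Lab nL Ld.
  (* An increment of [w] is one of [v] minus one of [f], and the latter is bounded by the former. *)
  suff : tot_incr w L <= 2 * tot_incr v L by lra.
  rewrite /tot_incr mulr_sumr big_seq [leRHS]big_seq; apply: ler_sum => q qL.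
  move/allP : Lab => /(_ q qL) /and3P[h1 h2 h3].
  rewrite !ger0_norm ?subr_ge0 ?ndv ?ndw// /w.
  have := vBf _ _ h2; rewrite ler_norml => /andP[]; lra.
have [g1 [ig1 E1]] := monotone_density ab ndv vc acv.
have [g2 [ig2 E2]] := monotone_density ab ndw wc acw.
exists (g1 \- g2); split; first exact: (integrableB _ ig1 ig2).
move=> x ax xb; rewrite RintegralB//; last 2 first.
- exact: integrableS ig1.
- exact: integrableS ig2.
by rewrite -E1// -E2// /w /c !clamp_id//; lra.
Qed.

End StieltjesRadonNikodym.

(** * Measurability of [derive1] and differentiation of integrals *)

Section MeasurableDerivative.
Context {K : realType}.
Implicit Types (a b x y e d h : K) (f g : K -> K) (D : set K).
Local Notation mu := (@lebesgue_measure K).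

Lemma derive1_near_eq f g x : {near x, f =1 g} -> derive1 f x = derive1 g x.
Proof. by move=> fg; rewrite !derive1E; apply: near_eq_derive => //; exact: oner_neq0. Qed.

(** A divergent limit takes the default value, which is 0 here. *)
Lemma derive1_dvg f x : ~ derivable f x 1 -> derive1 f x = 0.
Proof.
move=> ndf; rewrite derive1E /derive dvgP//.
Qed.

Lemma near_ratr x (P : set K) : nbhs x P -> exists q : rat, P (ratr q).
Proof.
move=> /nbhs_ballP[e /= e0 eP]; have [|q] := @rat_in_itvoo _ x (x + e).
  by rewrite ltrDl.
rewrite in_itv/= => /andP[xq qe]; exists q; apply: eP.
by rewrite /ball /= ltr_distlC; apply/andP; split; [lra|].
Qed.

Let diffq f h x := h^-1 * (f (x + h) - f x).

Lemma continuous_diffq f x h : h != 0 -> {for x + h, continuous f} ->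
  {for h, continuous (fun h => diffq f h x)}.
Proof.
move=> h0 cf; rewrite /prop_for /continuous_at /diffq.
apply: cvgM; first exact: cvgV.
apply: cvgB; last exact: cvg_cst.
apply: (@cvg_comp _ _ _ (fun h => x + h) f _ (nbhs (x + h))) => //.
by apply: cvgD; [exact: cvg_cst|exact: cvg_id].
Qed.

Lemma derivable_diffqP f x :
  derivable f x 1 <-> cvg (diffq f h x @[h --> 0^']).
Proof.
rewrite /derivable.
suff -> : (fun h => h^-1 *: (f (h *: 1 + x) - f x)) = (fun h => diffq f h x) by [].
apply/funext => h; rewrite /diffq (addrC x).
by have -> : h *: (1 : K^o) = h by exact: mulr1.
Qed.

(* Continuity of f reduces the Cauchy criterion to rational increments, which
   makes the set of points of derivability Borel. *)
Lemma cvg_diffqP f D x : open D -> D x -> (forall y, D y -> {for y, continuous f}) ->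
  cvg (diffq f h x @[h --> 0^']) <->
  forall k : nat, exists N : nat, forall r s : rat,
    0 < `|ratr r : K| < N.+1%:R^-1 -> 0 < `|ratr s : K| < N.+1%:R^-1 ->
    `|diffq f (ratr r) x - diffq f (ratr s) x| <= k.+1%:R^-1.
Proof.
move=> oD Dx cf; split.
- move=> /cvg_ex[l0 /=]; set l : K := l0 => fl k.
  have k0 : (0 : K) < k.+1%:R^-1 / 2 by rewrite divr_gt0// invr_gt0.
  move/cvgrPdist_lt : fl => /(_ _ k0) [d /= d0 H].
  exists (Num.bound (d^-1)) => r s /andP[r0 rN] /andP[s0 sN].
  have Nd : (Num.bound (d^-1)).+1%:R^-1 < d.
    rewrite -[ltRHS]invrK ltf_pV2 ?posrE ?invr_gt0//.
    apply: (lt_trans (archi_boundP _)); rewrite ?invr_ge0 ?ltW// ?ltr_nat//.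
  have Hr t : 0 < `|ratr t : K| -> `|ratr t : K| < d ->
      `|l - diffq f (ratr t) x| < k.+1%:R^-1 / 2.
    move=> t0 td; apply: H; last by rewrite -normr_gt0.
    by rewrite /= sub0r normrN.
  apply: (le_trans (ler_distD l _ _)); rewrite [leRHS]splitr.
  apply: lerD; apply: ltW; last exact: Hr (lt_trans sN Nd).
  by rewrite distrC; exact: Hr (lt_trans rN Nd).
- move=> H; apply: cauchy_cvg; apply/cauchy_ballP => e e0.
  pose k := Num.bound (e^-1).
  have ke : k.+1%:R^-1 < e.
    rewrite -[ltRHS]invrK ltf_pV2 ?posrE ?invr_gt0//.
    apply: (lt_trans (archi_boundP _)); rewrite ?invr_ge0 ?ltW// ?ltr_nat//.
  have [N HN] := H k.
  have /nbhs_ballP[d /= d0 dD] : nbhs x D by exact: open_nbhs_nbhs.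
  pose m := Num.min d N.+1%:R^-1.
  have m0 : 0 < m by rewrite lt_min d0 invr_gt0 ltr0n.
  pose A := [set h : K | h != 0 /\ `|h| < m].
  have Aop h : A h -> \forall y \near h, A y.
    move=> [h0 hm]; near=> y; split.
      by near: y; apply: (cvgr_neq0 (FF := nbhs_filter h) h).
    by near: y; apply: (cvgr_norm_lt (FF := nbhs_filter h) h).
  have key h h' : A h -> A h' -> `|diffq f h x - diffq f h' x| <= k.+1%:R^-1.
    have [c cE] : exists c : K, c = k.+1%:R^-1 by eexists.
    rewrite -cE in HN *.
    move=> Ah Ah'; rewrite leNgt; apply/negP => lt.
    (* Half of the excess over [c]: rational increments whose quotients are within [eta] of those at
       [h] and [h'] still differ by more than [c], against [HN]. *)
    pose eta := (`|diffq f h x - diffq f h' x| - c) / 2.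
    have eta0 : 0 < eta by rewrite /eta; lra.
    have app t : A t -> exists2 q : rat, A (ratr q) & `|diffq f t x - diffq f (ratr q) x| < eta.
      move=> At; have [t0 tm] := At.
      have ct : {for x + t, continuous f}.
        apply: cf; apply: dD; rewrite /ball /= opprD addNKr normrN.
        by move: tm; rewrite lt_min => /andP[].
      have := continuous_diffq t0 ct; move/cvgrPdist_lt => /(_ _ eta0) H1.
      have [q [q1 q2]] := near_ratr (filterI (Aop t At) H1).
      by exists q.
    have [r [r0 rm] hr] := app h Ah; have [s [s0 sm] hs] := app h' Ah'.
    have := HN r s; rewrite !normr_gt0 r0 s0 /=.
    move: rm sm; rewrite !lt_min => /andP[_ ->] /andP[_ ->] => /(_ isT isT).
    have := ler_distD (diffq f (ratr r) x) (diffq f h x) (diffq f h' x).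
    have := ler_distD (diffq f (ratr s) x) (diffq f (ratr r) x) (diffq f h' x).
    rewrite (distrC (diffq f (ratr s) x) (diffq f h' x)); rewrite /eta in hr hs; lra.
  have nA : \forall h \near (0 : K)^', A h.
    exists m => //= h /=; rewrite sub0r normrN => hm h0; split => //.
  exists (diffq f ^~ x @` A, diffq f ^~ x @` A) => /=.
    by split; apply: filterS nA => h Ah /=; exists h.
  move=> [_ _] /= [[h Ah <-] [h' Ah' <-]].
  by rewrite /ball /=; exact: le_lt_trans (key h h' Ah Ah') ke.
Unshelve. all: by end_near. Qed.

(** The points of derivability form a Borel set [E]. On [E] the derivative is the limit of the
    quotients with increment 1/(n+1), and off [E] it is 0, so these quotients times the indicator of
    [E] converge everywhere on [D]. Extending [f] by 0 outside [D] makes the quotients measurable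
    even where x + h leaves [D]. *)
Lemma measurable_derive1 f D : open D -> (forall y, D y -> {for y, continuous f}) ->
  measurable_fun D (derive1 f).
Proof.
move=> oD cf; have mD : measurable D by exact: open_measurable.
have mf : measurable_fun D f.
  by apply: open_continuous_measurable_fun => //; move=> y /set_mem; exact: cf.
pose g := f \_ D.
have mg : measurable_fun [set: K] g.
  by apply/(measurable_restrict _ _ _).1 => //; rewrite setTI.
have mq h : measurable_fun D (diffq g h).
  apply: measurable_funTS; apply: measurable_funM => //.
  apply: measurable_funB => //; apply: (measurableT_comp mg).
  exact: measurable_funD.
have fgD x : D x -> {near x, g =1 f}.
  move=> Dx; have : nbhs x D by exact: open_nbhs_nbhs.
  by apply: filterS => y Dy; rewrite /g patchE mem_set.
have cg y : D y -> {for y, continuous g}.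
  move=> Dy; rewrite /prop_for /continuous_at (_ : g y = f y); last first.
    by rewrite /g patchE mem_set.
  apply: cvg_trans (cf y Dy); apply: near_eq_cvg; exact: filterS (fgD y Dy).
have mG k N (r s : rat) : measurable (D `&` [set x |
    0 < `|ratr r : K| < N.+1%:R^-1 -> 0 < `|ratr s : K| < N.+1%:R^-1 ->
    `|diffq g (ratr r) x - diffq g (ratr s) x| <= k.+1%:R^-1]).
  have [r0|nr0] := boolP (0 < `|ratr r : K| < N.+1%:R^-1); last first.
    rewrite [X in _ `&` X](_ : _ = setT); first by rewrite setIT.
    by apply/seteqP; split => // x _ _.
  have [s0|ns0] := boolP (0 < `|ratr s : K| < N.+1%:R^-1); last first.
    rewrite [X in _ `&` X](_ : _ = setT); first by rewrite setIT.
    by apply/seteqP; split => // x _ _.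
  have mab : measurable_fun D (fun x => `|diffq g (ratr r) x - diffq g (ratr s) x|).
    apply: measurableT_comp => //; exact: measurable_funB.
  have := mab mD `]-oo, k.+1%:R^-1]%classic (measurable_itv _).
  congr measurable; apply/seteqP; split => x [Dx] /= h; split => //=.
  by rewrite in_itv/=; apply: h.
pose E := D `&` [set x | derivable f x 1].
have Ex x : D x -> derivable f x 1 <-> cvg (diffq g h x @[h --> 0^']).
  move=> Dx; rewrite -derivable_diffqP; split; apply: near_eq_derivable.
    by apply: filterS (fgD x Dx) => y ->.
  exact: fgD.
pose G (k N : nat) (r s : rat) := D `&` [set x |
    0 < `|ratr r : K| < N.+1%:R^-1 -> 0 < `|ratr s : K| < N.+1%:R^-1 ->
    `|diffq g (ratr r) x - diffq g (ratr s) x| <= k.+1%:R^-1].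
have EE : E = \bigcap_k \bigcup_N (D `&` ~` \bigcup_r \bigcup_s (D `\` G k N r s)).
  apply/seteqP; split => [x [Dx /=] /(Ex x Dx)/(cvg_diffqP oD Dx cg) H k _|x H].
    have [N HN] := H k; exists N => //; split => // -[r _ [s _ [_ []]]].
    by split => //; exact: HN.
  have Dx : D x by have [N _ []] := H 0%N I.
  split => //; apply/(Ex x Dx)/(cvg_diffqP oD Dx cg) => k.
  have [N _ [_ HN]] := H k I; exists N => r s r0 s0.
  apply: contrapT => nle; apply: HN; exists r => //; exists s => //; split => //.
  by move=> [_] /(_ r0 s0).
have mE : measurable E.
  rewrite EE; apply: bigcapT_measurable => k; apply: bigcupT_measurable => N.
  apply: measurableI => //; apply: measurableC; apply: bigcupT_measurable_rat => r.
  apply: bigcupT_measurable_rat => s; apply: measurableD => //; exact: mG.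
apply: (@measurable_fun_cvg _ _ _ _ (fun n x => diffq g n.+1%:R^-1 x * \1_E x)).
  by move=> n; apply: measurable_funM => //; exact: measurable_indic.
move=> x Dx; have [dx|ndx] := pselect (derivable f x 1).
  have -> : \1_E x = 1 :> K by rewrite indicE mem_set.
  under eq_cvg do rewrite mulr1.
  have cE : diffq g h x @[h --> 0^'] --> derive1 f x.
    rewrite -(derive1_near_eq (fgD x Dx)); have /(Ex x Dx) := dx.
    rewrite /derive1 (_ : (fun h => h^-1 *: (g (h + x) - g x)) = diffq g ^~ x) => [//|].
    by apply/funext => h; rewrite /diffq (addrC x).
  apply: (cvg_comp _ _ _ cE) => A [d /= d0 HA].
  have /cvgrPdist_lt /(_ _ d0) := (@cvg_harmonic K).
  rewrite /harmonic; apply: filterS => n /= nd; apply: HA; first exact: nd.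
  by rewrite invr_eq0 pnatr_eq0.
have -> : \1_E x = 0 :> K by rewrite indicE memNset// => -[].
under eq_cvg do rewrite mulr0.
by rewrite derive1_dvg//; exact: cvg_cst.
Qed.

(** Lebesgue's differentiation theorem for the indefinite integral of [g]; on []a, b[] it differs
    from [f] by the constant [f a]. *)
Lemma abs_cont_integral_derive a b f g : a < b -> mu.-integrable setT (EFin \o g) ->
  (forall x, a <= x -> x <= b -> f x - f a = \int[mu]_(t in `]a, x]) g t) ->
  {ae mu, forall x, a < x -> x < b -> derivable f x 1 /\ derive1 f x = g x}.
Proof.
move=> ab ig fE.
have := @FTC1 K g (BRight a) _ (open_integrable_locally openT ig).
have iag y : mu.-integrable [set` Interval (BRight a) (BRight y)] (EFin \o g).
  by apply: integrableS ig.
move=> /(_ iag); apply: (@filterS _ _ (ae_filter_ringOfSetsType mu)) => x H ax xb; have [] := H ax.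
have nE : {near x, (fun x => \int[mu]_(t in `]a, x]) g t) =1 (fun x => f x - f a)}.
  near=> y; rewrite fE//; apply: ltW; near: y; [exact: lt_nbhsr|exact: lt_nbhsl].
move=> /(near_eq_derivable nE) dB; rewrite (derive1_near_eq nE) => eB.
set F := (fun x => f x - f a) in dB eB *.
have fB : f = F + cst (f a) by apply/funext => y /=; rewrite fctE /F subrK.
have dc : derivable (cst (f a) : K -> K) x 1 by exact: derivable_cst.
rewrite fB; split; first exact: derivableD.
by rewrite derive1E deriveD// derive_cst addr0 -derive1E.
Unshelve. all: by end_near. Qed.

End MeasurableDerivative.

(** * Calculus of absolutely continuous functions on [a, b] and on (0, R) *)

Section AbsolutelyContinuous.
Context {K : realType}.
Implicit Types (a b c x y e d : K) (f g : K -> K) (R : \bar K).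
Local Notation mu := (@lebesgue_measure K).

Lemma abs_cont_modulus a b f e : abs_cont a b f -> 0 < e -> exists2 d, 0 < d &
  forall x y, a <= x -> x <= b -> a <= y -> y <= b -> `|y - x| < d -> `|f y - f x| < e.
Proof.
move=> /abs_cont_seq acf e0; have [d d0 H] := acf e e0; exists d => //.
have main x y : a <= x -> x <= y -> y <= b -> `|y - x| < d -> `|f y - f x| < e.
  move=> ax xy yb xyd; have := H [:: (x, y)].
  rewrite /tot_length /tot_incr !big_seq1 /= /subitv /= ax xy yb; apply => //.
  by rewrite -(ger0_norm (_ : 0 <= y - x)) ?subr_ge0.
move=> x y ax xb ay yb; have [xy|/ltW yx] := leP x y; first exact: main.
by rewrite distrC (distrC (f y)); exact: main.
Qed.

Lemma abs_cont_continuous a b f x : abs_cont a b f -> a < x -> x < b ->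
  {for x, continuous f}.
Proof.
move=> acf ax xb; apply/cvgrPdist_lt => e e0.
have [d d0 H] := abs_cont_modulus acf e0.
near=> y.
have ay : a < y by near: y; exact: lt_nbhsr.
have yb : y < b by near: y; exact: lt_nbhsl.
apply: H (ltW ay) (ltW yb) (ltW ax) (ltW xb) _; near: y.
exact: (@cvgr_dist_lt _ _ _ _ _ id x cvg_id d d0).
Unshelve. all: by end_near. Qed.

Lemma abs_cont_bounded a b f : a <= b -> abs_cont a b f ->
  exists2 M, 0 <= M & forall x, a <= x -> x <= b -> `|f x| <= M.
Proof.
move=> ab /abs_cont_seq acf; have bvf := seq_abs_cont_BV ab acf.
have TVfin : total_variation a b f \is a fin_num by exact/bounded_variationP.
exists (`|f a| + fine (total_variation a b f)).
  by rewrite addr_ge0// fine_ge0// total_variation_ge0.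
move=> x ax xb; rewrite -lerBlDl.
apply: (@le_trans _ _ `|f x - f a|); first exact: lerB_dist.
rewrite -lee_fin fineK//; apply: (le_trans (total_variation_ge f ax)).
by rewrite (total_variationD f ax xb) leeDl// total_variation_ge0.
Qed.

Lemma abs_cont_eq a b f g : (forall x, a <= x -> x <= b -> f x = g x) ->
  abs_cont a b f -> abs_cont a b g.
Proof.
move=> fg acf e e0; have [d d0 H] := acf e e0; exists d => // n s t st tr le.
have := H n s t st tr le; congr (_ < _); apply: eq_bigr => i _.
have [h1 [h2 h3]] := st i.
rewrite (fg _ h1 (le_trans h2 h3)).
by rewrite (fg _ (le_trans h1 h2) h3).
Qed.

Lemma abs_cont_lipschitz a b f M : (forall x y, a <= x -> x <= y -> y <= b ->
  `|f y - f x| <= M * (y - x)) -> abs_cont a b f.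
Proof.
move=> H e e0; pose M' := `|M| + 1; have M'0 : 0 < M' by rewrite ltr_wpDl.
exists (e / M'); first by rewrite divr_gt0.
move=> n s t st _; rewrite ltr_pdivlMr// => lt; apply: le_lt_trans lt.
rewrite mulr_suml; apply: ler_sum => i _; have [h1 [h2 h3]] := st i.
apply: (le_trans (H _ _ h1 h2 h3)); rewrite mulrC ler_wpM2l ?subr_ge0//.
by rewrite (le_trans (ler_norm _))// lerDl.
Qed.

Lemma abs_contD a b f g : abs_cont a b f -> abs_cont a b g ->
  abs_cont a b (fun x => f x + g x).
Proof.
move=> acf acg e e0; have e20 : 0 < e / 2 by rewrite divr_gt0.
have [d1 d10 H1] := acf _ e20; have [d2 d20 H2] := acg _ e20.
exists (Num.min d1 d2); first by rewrite lt_min d10.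
move=> n s t st tr; rewrite lt_min => /andP[l1 l2].
rewrite (splitr e); apply: (@le_lt_trans _ _ (\sum_(i < n) `|f (t i) - f (s i)| +
  \sum_(i < n) `|g (t i) - g (s i)|)); last by rewrite ltrD// ?H1// H2.
rewrite -big_split/=; apply: ler_sum => i _.
by rewrite opprD addrACA ler_normD.
Qed.

Lemma abs_contM a b f g : a <= b -> abs_cont a b f -> abs_cont a b g ->
  abs_cont a b (fun x => f x * g x).
Proof.
move=> ab acf acg e e0; have e20 : 0 < e / 2 by rewrite divr_gt0.
have [M M0 HM] := abs_cont_bounded ab acf.
have [N N0 HN] := abs_cont_bounded ab acg.
have M1 : 0 < M + 1 by lra.
have N1 : 0 < N + 1 by lra.
have [d1 d10 H1] := acf _ (divr_gt0 e20 N1).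
have [d2 d20 H2] := acg _ (divr_gt0 e20 M1).
exists (Num.min d1 d2); first by rewrite lt_min d10.
move=> n s t st tr; rewrite lt_min => /andP[l1 l2].
apply: (@le_lt_trans _ _ ((N + 1) * \sum_(i < n) `|f (t i) - f (s i)| +
  (M + 1) * \sum_(i < n) `|g (t i) - g (s i)|)); last first.
  have := H1 n s t st tr l1; have := H2 n s t st tr l2.
  rewrite !ltr_pdivlMr// ![_ * (_ + 1)]mulrC; lra.
rewrite !mulr_sumr -big_split/=; apply: ler_sum => i _.
have [h1 [h2 h3]] := st i.
have -> : f (t i) * g (t i) - f (s i) * g (s i) =
  g (t i) * (f (t i) - f (s i)) + f (s i) * (g (t i) - g (s i)) by ring.
apply: (le_trans (ler_normD _ _)); rewrite !normrM; apply: lerD.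
  rewrite ler_wpM2r// (@le_trans _ _ N) ?lerDl//.
  by apply: HN => //; exact: le_trans h2.
rewrite ler_wpM2r// (@le_trans _ _ M) ?lerDl//.
by apply: HM => //; exact: le_trans h3.
Qed.

Lemma abs_cont_C1 a b f : (forall x, a <= x -> x <= b -> derivable f x 1) ->
  (forall x, a <= x -> x <= b -> {for x, continuous (derive1 f)}) ->
  abs_cont a b f.
Proof.
move=> df cdf; have [ab|ba] := leP a b; last first.
  move=> e e0; exists 1 => // n s t st _ _; case: n s t st => [|n] s t st.
    by rewrite big_ord0.
  have [h1 [h2 h3]] := st ord0.
  by have := lt_le_trans ba (le_trans h1 (le_trans h2 h3)); rewrite ltxx.
have cwf : {within `[a, b], continuous (fun x => `|derive1 f x|)}.
  apply: continuous_in_subspaceT => x; rewrite inE/= in_itv/= => /andP[ax xb].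
  by apply: (continuous_comp (cdf x ax xb)); exact: norm_continuous.
have [c _ Hc] := EVT_max ab cwf.
apply: (@abs_cont_lipschitz _ _ _ `|derive1 f c|) => x y ax xy yb.
have [||z] := @MVT_segment _ f (derive1 f) x y xy.
- by move=> z; rewrite in_itv/= => /andP[xz zy]; split;
    [apply: df; lra|rewrite derive1E].
- apply: continuous_in_subspaceT => z; rewrite inE/= in_itv/= => /andP[xz zy].
  apply: differentiable_continuous; apply/derivable1_diffP; apply: df; lra.
rewrite in_itv/= => /andP[xz zy] ->.
rewrite normrM (ger0_norm (_ : 0 <= y - x)) ?subr_ge0// ler_wpM2r ?subr_ge0//.
by apply: Hc; rewrite in_itv/=; apply/andP; split; lra.
Qed.

Lemma abs_cont_derivable a b f : abs_cont a b f ->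
  {ae mu, forall x, a < x -> x < b -> derivable f x 1}.
Proof.
move=> acf; have [ab|ba] := ltP a b; last first.
  by apply: aeW => x ax xb; have := lt_trans ax xb; rewrite ltNge ba.
have [g [ig gE]] := abs_cont_density ab acf.
apply: (@filterS _ _ (ae_filter_ringOfSetsType mu)) (abs_cont_integral_derive ab ig gE).
by move=> x H ax xb; have [] := H ax xb.
Qed.

(** The form in which Hardy's inequality consumes the fundamental theorem. The density [g] is traded
    for [derive1 f], which is measurable because [f] is continuous and equals [g] almost
    everywhere. *)
Lemma abs_cont_incr_le a b f : a < b -> abs_cont a b f ->
  (`|f b - f a|%:E <= \int[mu]_(t in `]a, b[) (`|derive1 f t|)%:E)%E.
Proof.
move=> ab acf; have [g [ig gE]] := abs_cont_density ab acf.
have mg : measurable_fun `]a, b[ g.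
  by apply: measurable_funTS; apply/measurable_EFinP; exact: measurable_int ig.
have mf : measurable_fun `]a, b[ (derive1 f).
  apply: measurable_derive1; first exact: interval_open.
  by move=> y /=; rewrite in_itv/= => /andP[ay yb]; exact: abs_cont_continuous acf _ _.
have igab : mu.-integrable `]a, b] (EFin \o g) by exact: integrableS ig.
rewrite (gE b (ltW ab) (lexx b)).
have := EFin_normr_Rintegral _ igab => /(_ (measurable_itv _)) ->.
apply: (le_trans (le_abse_integral _ _ _)) => //; first exact: measurable_int igab.
rewrite -(@integral_itv_bndo_bndc _ (BRight a) b); last first.
  by apply: measurableT_comp => //; apply/measurable_EFinP; exact: mg.
rewrite (@ae_eq_integral _ _ _ mu `]a, b[ (fun t => (`|derive1 f t|)%:E))//.
- by do 2 apply: measurableT_comp => //; apply/measurable_EFinP.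
- by apply/measurable_EFinP; exact: measurableT_comp.
- apply: (@filterS _ _ (ae_filter_ringOfSetsType mu)) (abs_cont_integral_derive ab ig gE).
  move=> x H /=; rewrite in_itv/= => /andP[ax xb].
  by have [_ ->] := H ax xb.
Qed.

Lemma zeroto_open R : open (zeroto R).
Proof.
rewrite /zeroto; case: R => [b| |].
- have -> : [set r : K | 0 < r /\ (r%:E < b%:E)%E] = `]0, b[%classic.
    by apply/seteqP; split => x /=; rewrite in_itv/= lte_fin => /andP.
  exact: interval_open.
- have -> : [set r : K | 0 < r /\ (r%:E < +oo)%E] = `]0, +oo[%classic.
    by apply/seteqP; split => x /=; rewrite in_itv/= andbT ?ltry// => -[].
  exact: interval_open.
- have -> : [set r : K | 0 < r /\ (r%:E < -oo)%E] = set0.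
    by apply/seteqP; split => x //= -[].
  exact: open0.
Qed.

Lemma measurable_zeroto R : measurable (zeroto R).
Proof. by apply: open_measurable; exact: zeroto_open. Qed.

Lemma zeroto_itv R a b x : zeroto R a -> zeroto R b -> a <= x -> x <= b -> zeroto R x.
Proof.
move=> [a0 _] [_ bR] ax xb; split; first exact: lt_le_trans ax.
by apply: le_lt_trans bR; rewrite lee_fin.
Qed.

Lemma zeroto_le R x y : zeroto R y -> 0 < x -> x <= y -> zeroto R x.
Proof. by move=> [_ yR] x0 xy; split => //; apply: le_lt_trans yR; rewrite lee_fin. Qed.

Lemma zeroto_gt R x : zeroto R x -> exists2 y, x < y & zeroto R y.
Proof.
move=> Dx; have /nbhs_ballP[e /= e0 H] : nbhs x (zeroto R).
  by apply: open_nbhs_nbhs; split => //; exact: zeroto_open.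
exists (x + e / 2); first by lra.
by apply: H; rewrite /ball /= opprD addNKr normrN gtr0_norm; lra.
Qed.

Lemma zeroto_lt R x : zeroto R x -> exists2 y, y < x & zeroto R y.
Proof.
move=> Dx; have x0 := Dx.1; exists (x / 2); first by lra.
by apply: (zeroto_le Dx); lra.
Qed.

Lemma ACloc_continuous R f x : ACloc R f -> zeroto R x -> {for x, continuous f}.
Proof.
move=> acf Dx; have [y xy Dy] := zeroto_gt Dx; have [z zx Dz] := zeroto_lt Dx.
exact: abs_cont_continuous (acf z y Dz Dy) zx xy.
Qed.

Lemma ACloc_measurable R f : ACloc R f -> measurable_fun (zeroto R) f.
Proof.
move=> acf; apply: open_continuous_measurable_fun; first exact: zeroto_open.
by move=> x /set_mem; exact: ACloc_continuous.
Qed.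

Lemma ACloc_measurable_derive1 R f : ACloc R f -> measurable_fun (zeroto R) (derive1 f).
Proof.
move=> acf; apply: measurable_derive1; first exact: zeroto_open.
by move=> x; exact: ACloc_continuous.
Qed.

(** Countably many intervals with rational end points, enumerated through [unpickle], exhaust (0,
    R), so their exceptional null sets add up to a null set. *)
Lemma ACloc_derivable R f : ACloc R f ->
  {ae mu, forall x, zeroto R x -> derivable f x 1}.
Proof.
move=> acf.
pose P (n : nat) x := forall p q : rat, unpickle n = Some (p, q) ->
  zeroto R (ratr p) -> zeroto R (ratr q) -> ratr p < x -> x < ratr q -> derivable f x 1.
have : {ae mu, forall x, forall n, P n x}.
  apply: ae_foralln => n; rewrite /P; case: (unpickle n) => [[p q]|]; last first.
    by apply: aeW.
  have [[Dp Dq]|nD] := pselect (zeroto R (ratr p) /\ zeroto R (ratr q)); last first.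
    by apply: aeW => x p' q' [<- <-] Dp Dq; exfalso; apply: nD.
  have := abs_cont_derivable (acf _ _ Dp Dq).
  apply: (@filterS _ _ (ae_filter_ringOfSetsType mu)) => x H p' q' [<- <-] _ _.
  exact: H.
apply: (@filterS _ _ (ae_filter_ringOfSetsType mu)) => x H Dx.
have [y xy Dy] := zeroto_gt Dx; have [z zx Dz] := zeroto_lt Dx.
have [p] := rat_in_itvoo zx; rewrite in_itv/= => /andP[zp px].
have [q] := rat_in_itvoo xy; rewrite in_itv/= => /andP[xq qy].
apply: (H (pickle (p, q)) p q (pickleK _)) => //.
  by apply: (zeroto_itv Dz Dx); exact: ltW.
by apply: (zeroto_itv Dx Dy); exact: ltW.
Qed.

Lemma ACloc_incr_le R f a b : ACloc R f -> zeroto R a -> zeroto R b -> a < b ->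
  (`|f b - f a|%:E <= \int[mu]_(t in `]a, b[) (`|derive1 f t|)%:E)%E.
Proof. by move=> acf Da Db ab; apply: abs_cont_incr_le => //; exact: acf. Qed.

Lemma ACloc_eq R f g : (forall x, zeroto R x -> f x = g x) -> ACloc R f -> ACloc R g.
Proof.
move=> fg acf a b Da Db; apply: abs_cont_eq (acf a b Da Db) => x ax xb.
by apply: fg; exact: zeroto_itv ax xb.
Qed.

Lemma ACloc_C1 R f : (forall x, zeroto R x -> derivable f x 1) ->
  (forall x, zeroto R x -> {for x, continuous (derive1 f)}) -> ACloc R f.
Proof.
move=> df cdf a b Da Db; apply: abs_cont_C1 => x ax xb.
  by apply: df; exact: zeroto_itv ax xb.
by apply: cdf; exact: zeroto_itv ax xb.
Qed.

Lemma ACloc_cst R c : ACloc R (fun=> c).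
Proof.
move=> a b _ _; apply: (@abs_cont_lipschitz _ _ _ 0) => x y _ _ _.
by rewrite subrr normr0 mul0r.
Qed.

Lemma AClocD R f g : ACloc R f -> ACloc R g -> ACloc R (fun x => f x + g x).
Proof. by move=> acf acg a b Da Db; apply: abs_contD; [exact: acf|exact: acg]. Qed.

Lemma AClocM R f g : ACloc R f -> ACloc R g -> ACloc R (fun x => f x * g x).
Proof.
move=> acf acg a b Da Db; have [ab|ba] := leP a b.
  by apply: abs_contM => //; [exact: acf|exact: acg].
move=> e e0; exists 1 => // n s t st _ _; case: n s t st => [|n] s t st.
  by rewrite big_ord0.
have [h1 [h2 h3]] := st ord0.
by have := lt_le_trans ba (le_trans h1 (le_trans h2 h3)); rewrite ltxx.
Qed.

Lemma ACloc_sum R n (F : nat -> K -> K) : (forall j, (j < n)%N -> ACloc R (F j)) ->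
  ACloc R (fun x => \sum_(j < n) F j x).
Proof.
elim: n => [_|n IH H].
  by apply: ACloc_eq (@ACloc_cst R 0) => x _; rewrite big_ord0.
apply: (@ACloc_eq _ (fun x => \sum_(j < n) F j x + F n x)).
  by move=> x _; rewrite big_ord_recr.
apply: AClocD; last exact: H.
by apply: IH => j jn; apply: H; rewrite ltnS ltnW.
Qed.

End AbsolutelyContinuous.

(** * Hoelder's inequality with power weights and Hardy's inequality *)

Section Hardy.
Context {K : realType}.
Implicit Types (a b c x y e d r s t p : K) (f g w : K -> K) (R : \bar K) (A : set K).
Local Notation mu := (@lebesgue_measure K).

(** Hoelder's inequality for g = (g w^(-1/q)) w^(1/q) with 1/p + 1/q = 1; note that p/q = p - 1. *)
Lemma weighted_hoelder A g w p c : measurable A -> measurable_fun A g ->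
  measurable_fun A w -> (forall x, A x -> 0 <= g x) -> (forall x, A x -> 0 < w x) ->
  1 < p -> (\int[mu]_(x in A) (w x)%:E <= c%:E)%E ->
  ((\int[mu]_(x in A) (g x)%:E) `^ p <=
    (c `^ (p - 1))%:E * \int[mu]_(x in A) (g x `^ p * w x `^ (1 - p))%:E)%E.
Proof.
move=> mA mg mw g0 w0 p1 wc.
have p0 : 0 < p by lra.
have pm0 : 0 < p - 1 by lra.
pose q := p / (p - 1); have q0 : 0 < q by rewrite divr_gt0.
have pq : p^-1 + q^-1 = 1 by rewrite /q invf_div; field; lra.
pose f1 := (fun x => g x * w x `^ (- q^-1)) \_ A.
pose f2 := (fun x => w x `^ (q^-1)) \_ A.
have mf1 : measurable_fun [set: K] f1.
  apply/(measurable_restrict _ _ _).1 => //; rewrite setTI.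
  apply: measurable_funM => //.
  by apply: (measurableT_comp (measurable_powR _)).
have mf2 : measurable_fun [set: K] f2.
  apply/(measurable_restrict _ _ _).1 => //; rewrite setTI.
  by apply: (measurableT_comp (measurable_powR _)).
have := @hoelder _ _ _ mu f1 f2 p q mf1 mf2 p0 q0 pq.
have -> : ('N[mu]_1[EFin \o (f1 \* f2)%R] = \int[mu]_(x in A) (g x)%:E)%E.
  rewrite Lnorm1 [RHS]integral_mkcond; apply: eq_integral => x _ /=.
  rewrite /f1 /f2 !patchE; case: ifPn => [/set_mem Ax|_]; last by rewrite mul0r normr0.
  rewrite -mulrA -powRD; last first.
    by apply/implyP => _; rewrite gt_eqF ?w0.
  by rewrite addNr powRr0 mulr1 ger0_norm ?g0.
move=> H; have {H} := @gt0_ler_poweR _ p (ltW p0) _ _ _ _ H.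
rewrite !in_itv/= !leey !andbT integral_ge0 => [/(_ isT)|x Ax]; last by rewrite lee_fin g0.
rewrite mule_ge0 ?Lnorm_ge0// => /(_ isT) /le_trans; apply.
rewrite poweRM ?Lnorm_ge0// powR_Lnorm ?gt_eqF// muleC.
have -> : (\int[mu]_x (`|(EFin \o f1) x| `^ p) =
   \int[mu]_(x in A) (g x `^ p * w x `^ (1 - p))%:E)%E.
  rewrite [RHS]integral_mkcond; apply: eq_integral => x _ /=.
  rewrite /f1 !patchE; case: ifPn => [/set_mem Ax|_]; last first.
    by rewrite normr0 powR0 ?gt_eqF.
  rewrite ger0_norm ?mulr_ge0 ?g0 ?powR_ge0//.
  rewrite powRM ?g0 ?powR_ge0// -powRrM; congr (_ * _ `^ _)%:E.
  by rewrite /q invf_div; field; lra.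
apply: lee_wpmul2r.
  by apply: integral_ge0 => x _; rewrite lee_fin mulr_ge0 ?powR_ge0.
have -> : ('N[mu]_q%:E[EFin \o f2] `^ p = (\int[mu]_(x in A) (w x)%:E) `^ (p - 1))%E.
  have -> : p = q * (p - 1) by rewrite /q divfK ?gt_eqF.
  rewrite poweRrM powR_Lnorm ?gt_eqF// (_ : q * (p - 1) - 1 = p - 1); last first.
    by rewrite /q divfK ?gt_eqF.
  congr (_ `^ _)%E.
  rewrite [RHS]integral_mkcond; apply: eq_integral => x _ /=.
  rewrite /f2 !patchE; case: ifPn => [/set_mem Ax|_]; last first.
    by rewrite normr0 powR0 ?gt_eqF.
  rewrite ger0_norm ?powR_ge0// -powRrM mulVf ?gt_eqF// powRr1//.
  exact/ltW/w0.
have W0 : (0 <= \int[mu]_(x in A) (w x)%:E)%E.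
  by apply: integral_ge0 => x Ax; rewrite lee_fin ltW// w0.
rewrite -poweR_EFin; apply: gt0_ler_poweR => //; first exact: ltW.
- by rewrite in_itv/= W0 leey.
- by rewrite in_itv/= (le_trans W0 wc) leey.
Qed.

Lemma integral_powR a b e : 0 < a -> a < b -> e != 0 ->
  (\int[mu]_(x in `[a, b]) (x `^ (- 1 - e))%:E = ((a `^ (- e) - b `^ (- e)) / e)%:E)%E.
Proof.
move=> a0 ab e0.
have der x : 0 < x -> is_derive x 1 (fun x => - e^-1 * x `^ (- e)) (x `^ (- 1 - e)).
  move=> x0; have H := is_derive1_powR (- e) x0.
  have -> : x `^ (- 1 - e) = - e^-1 *: (- e * x `^ (- e - 1)).
    by rewrite /GRing.scale/= mulrA mulrNN mulVf// mul1r addrC.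
  exact: is_deriveZ.
have derpow x c : 0 < x -> {for x, continuous (fun x => x `^ c)}.
  move=> x0; apply: differentiable_continuous; apply/derivable1_diffP.
  exact: (is_derive1_powR c x0).(ex_derive).
rewrite (@continuous_FTC2 _ (fun x => x `^ (- 1 - e)) (fun x => - e^-1 * x `^ (- e)))//.
- by rewrite -EFinB; congr EFin; field.
- apply: continuous_in_subspaceT => x; rewrite inE/= in_itv/= => /andP[ax _].
  by apply: derpow; exact: lt_le_trans ax.
- split.
  + move=> x; rewrite in_itv/= => /andP[ax _].
    exact: (der x (lt_trans a0 ax)).(ex_derive).
  + apply: cvg_at_right_filter; apply: cvgM; first exact: cvg_cst.
    exact: derpow.
  + apply: cvg_at_left_filter; apply: cvgM; first exact: cvg_cst.
    by apply: derpow; exact: lt_trans ab.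
- move=> x; rewrite in_itv/= => /andP[ax _].
  by rewrite derive1E; exact: (der x (lt_trans a0 ax)).(derive_val).
Qed.

(* The side of x on which s^(-1-e) is integrable. *)
Definition away e x : set K := [set s | if 0 < e then x < s else 0 < s < x].

Lemma measurable_away e x : measurable (away e x).
Proof.
have [e0|/negbTE e0] := boolP (0 < e); rewrite /away e0.
- have -> : [set s | x < s] = `]x, +oo[%classic.
    by apply/seteqP; split => s /=; rewrite in_itv/= andbT.
  exact: measurable_itv.
- have -> : [set s | 0 < s < x] = `]0, x[%classic.
    by apply/seteqP; split => s /=; rewrite in_itv.
  exact: measurable_itv.
Qed.

(** On compact intervals ending at x the primitive is explicit, and the contribution of the other
    end has a sign that allows dropping it. Monotone convergence does the rest. *)
Lemma integral_away_powR e x : 0 < x -> e != 0 ->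
  (\int[mu]_(s in away e x) (s `^ (- 1 - e))%:E <= (x `^ (- e) / `|e|)%:E)%E.
Proof.
move=> x0 e0.
suff [F [ndF mF aF FE]] : exists F : (set K)^nat,
  [/\ {homo F : n m / (n <= m)%N >-> (n <= m)%O}, forall n, measurable (F n),
    away e x `<=` \bigcup_n F n &
    forall n, (\int[mu]_(s in F n) (s `^ (- 1 - e))%:E <= (x `^ (- e) / `|e|)%:E)%E].
  have mpow B : measurable_fun B (fun s => (s `^ (- 1 - e))%:E).
    by apply/measurable_EFinP; apply: measurable_funTS; exact: measurable_powR.
  apply: (@le_trans _ _ (\int[mu]_(s in \bigcup_n F n) (s `^ (- 1 - e))%:E)%E).
    have mUF : measurable (\bigcup_n F n) by exact: bigcupT_measurable.
    apply: (@ge0_subset_integral _ _ _ mu _ _ (measurable_away e x) mUF _ (mpow _)).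
      by move=> s _; rewrite lee_fin powR_ge0.
    exact: aF.
  have cF : (\int[mu]_(s in F n) (s `^ (- 1 - e))%:E @[n --> \oo] -->
      \int[mu]_(s in \bigcup_n F n) (s `^ (- 1 - e))%:E)%E.
    apply: ge0_nondecreasing_set_cvg_integral.
    - exact: ndF.
    - exact: mF.
    - by move=> n; exact: mpow.
    - by move=> n s _; rewrite lee_fin powR_ge0.
  rewrite -(cvg_lim _ cF)//; apply: lime_le; first by apply/cvg_ex; eexists; exact: cF.
  by apply: nearW.
have [e_gt0|] := ltP 0 e.
- exists (fun n => `[x, x + n.+1%:R]%classic); split.
  + move=> n m nm; apply/subsetPset => s /=; rewrite !in_itv/= => /andP[-> /=].
    by move/le_trans; apply; rewrite lerD2l ler_nat.
  + by move=> n; exact: measurable_itv.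
  + rewrite /away e_gt0 => s /= xs; exists (Num.bound (s - x)) => //=.
    rewrite in_itv/= (ltW xs)/= -lerBlDl; have := archi_boundP (_ : 0 <= s - x).
    rewrite subr_ge0 (ltW xs) => /(_ isT) /ltW /le_trans; apply.
    by rewrite ler_nat.
  + move=> n; rewrite integral_powR ?ltrDl ?ltr0n// lee_fin gtr0_norm//.
    by rewrite ler_pM2r ?invr_gt0// gerBl powR_ge0.
- rewrite le_eqVlt (negbTE e0)/= => e_lt0.
  (* With [n.+2] the left end stays strictly below [x], already for n = 0. *)
  exists (fun n => `[x / n.+2%:R, x]%classic); split.
  + move=> n m nm; apply/subsetPset => s /=; rewrite !in_itv/= => /andP[+ ->].
    rewrite andbT; apply: le_trans; rewrite ler_pM2l// lef_pV2 ?posrE ?ltr0n//.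
    by rewrite ler_nat !ltnS.
  + by move=> n; exact: measurable_itv.
  + rewrite /away ltNge (ltW e_lt0)/= => s /andP[s0 sx].
    exists (Num.bound (x / s)) => //=.
    rewrite in_itv/= (ltW sx) andbT ler_pdivrMr ?ltr0n// mulrC -ler_pdivrMr//.
    have := archi_boundP (_ : 0 <= x / s); rewrite divr_ge0 ?(ltW x0) ?(ltW s0)//.
    move=> /(_ isT) /ltW /le_trans.
    by apply; rewrite ler_nat; apply: leqW; apply: leqW.
  + move=> n; have xn0 : 0 < x / n.+2%:R by rewrite divr_gt0 ?ltr0n.
    rewrite integral_powR//; last by rewrite ltr_pdivrMr ?ltr0n// ltr_pMr// ltr1n.
    rewrite lee_fin ltr0_norm// -[leLHS]mulrNN -invrN opprB.
    by rewrite ler_pM2r ?invr_gt0 ?oppr_gt0// gerBl powR_ge0.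
Qed.

Lemma measurable_away2 e : measurable [set z : K * K | away e z.1 z.2].
Proof.
have msub : measurable_fun [set: K * K] (fun z : K * K => z.2 - z.1).
  by apply: measurable_funB; [exact: measurable_snd|exact: measurable_fst].
have [e0|/negbTE e0] := boolP (0 < e); rewrite /away e0.
  have := msub measurableT `]0, +oo[%classic (measurable_itv _).
  rewrite setTI; congr measurable; apply/seteqP; split => z /=.
    by rewrite in_itv/= andbT subr_gt0.
  by rewrite in_itv/= andbT subr_gt0.
have m1 := msub measurableT `]-oo, 0[%classic (measurable_itv _).
have m2 := @measurable_snd _ _ K K measurableT `]0, +oo[%classic (measurable_itv _).
rewrite !setTI in m1 m2; have := measurableI _ _ m1 m2.
congr measurable; apply/seteqP; split => z /=; rewrite !in_itv/= andbT subr_lt0.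
  by move=> [-> ->].
by move=> /andP[-> ->].
Qed.

Lemma awayC e x y : 0 < x -> 0 < y -> e != 0 -> away e x y = away (- e) y x.
Proof.
move=> x0 y0 e0; rewrite /away /= oppr_gt0 ltNge le_eqVlt (negbTE e0)/=.
by case: (e < 0) => /=; rewrite ?x0 ?y0.
Qed.

(* Hoelder's inequality with the weight s^(-1-k'), where k = (gam + 1) / 2 and
   k' = k / (p - 1), followed by Tonelli's theorem. *)
Lemma hardy R p gam : 1 < p -> gam + 1 != 0 -> exists2 C, 0 < C &
  forall f g, measurable_fun (zeroto R) f -> measurable_fun (zeroto R) g ->
  (forall s, zeroto R s -> 0 <= g s) ->
  (forall r, zeroto R r ->
    (`|f r|%:E <= \int[mu]_(s in zeroto R `&` away (gam + 1) r) (g s)%:E)%E) ->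
  (\int[mu]_(r in zeroto R) (`|f r| `^ p * r `^ gam)%:E <=
    C%:E * \int[mu]_(s in zeroto R) (g s `^ p * s `^ (gam + p))%:E)%E.
Proof.
move=> p1 gam1; pose k := (gam + 1) / 2; pose k' := k / (p - 1).
have pm0 : 0 < p - 1 by lra.
have p0 : 0 < p by lra.
have k0 : k != 0 by rewrite /k mulf_neq0 ?invr_neq0.
have k'0 : k' != 0 by rewrite /k' mulf_neq0// invr_eq0 gt_eqF.
have kE : k = k' * (p - 1) by rewrite /k' divfK// gt_eqF.
have gE : gam = 2 * k - 1 by rewrite /k; field.
have awE : away (gam + 1) = away k by rewrite /away /k pmulr_lgt0 ?invr_gt0.
have awE' : away k' = away k by rewrite /away /k' pmulr_lgt0 ?invr_gt0.
set D := zeroto R; have mD : measurable D := measurable_zeroto R.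
pose C1 := `|k'| `^ (1 - p).
have C10 : 0 < C1 by rewrite powR_gt0 ?normr_gt0.
exists (C1 / `|k|); first by rewrite divr_gt0 ?normr_gt0.
move=> f g mf mg g0 fg.
have Dpos x : D x -> 0 < x by case.
(* After Hoelder the kernel is a product u(r) v(s) on the set [S]: the power of r is gam - k'(p - 1)
   = k - 1, and that of s is (1 + k')(p - 1) = p - 1 + k. *)
pose u := (fun r => r `^ (k - 1)) \_ D.
pose v := (fun s => g s `^ p * s `^ (p - 1 + k)) \_ D.
have u0 r : 0 <= u r by rewrite /u patchE; case: ifP => // _; exact: powR_ge0.
have v0 r : 0 <= v r.
  by rewrite /v patchE; case: ifP => // _; rewrite mulr_ge0 ?powR_ge0.
have mu_ : measurable_fun [set: K] u.
  apply/(measurable_restrict _ _ _).1 => //; rewrite setTI.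
  by apply: measurable_funTS; exact: measurable_powR.
have mgp : measurable_fun D (fun s => g s `^ p).
  exact: (measurableT_comp (measurable_powR _)).
have mv_ : measurable_fun [set: K] v.
  apply/(measurable_restrict _ _ _).1 => //; rewrite setTI.
  apply: measurable_funM => //.
  by apply: measurable_funTS; exact: measurable_powR.
pose S := [set z : K * K | away k z.1 z.2].
pose h (z : K * K) : \bar K := (u z.1 * v z.2 * \1_S z)%:E.
have h0 z : (0 <= h z)%E by rewrite lee_fin !mulr_ge0.
have mh : measurable_fun [set: K * K] h.
  apply/measurable_EFinP; apply: measurable_funM.
    apply: measurable_funM.
      by apply: (measurableT_comp mu_); exact: measurable_fst.
    by apply: (measurableT_comp mv_); exact: measurable_snd.
  by apply: measurable_indic; exact: measurable_away2.
have hE r s : D r -> h (r, s) =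
    ((r `^ (k - 1))%:E * ((fun s => (g s `^ p * s `^ (p - 1 + k))%:E) \_ (D `&` away k r)) s)%E.
  move=> Dr; rewrite /h /= /u /v !patchE mem_set//= indicE in_setI.
  have [Ds|nDs] := boolP (s \in D); last by rewrite mulr0 mul0r mule0.
  have -> : ((r, s) \in S) = (s \in away k r) by apply/idP/idP => /set_mem ?; exact/mem_set.
  by case: (s \in away k r); rewrite ?mulr1 ?mulr0 ?mule0 -?EFinM.
have step1 r : D r -> ((`|f r| `^ p * r `^ gam)%:E <= C1%:E * \int[mu]_s h (r, s))%E.
  move=> Dr; have r0 := Dpos r Dr.
  have mA : measurable (D `&` away k r) by apply: measurableI => //; exact: measurable_away.
  have mgA : measurable_fun (D `&` away k r) g by apply: measurable_funS mg => // ? [].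
  have wH : (\int[mu]_(s in D `&` away k r) (s `^ (- 1 - k'))%:E <= (r `^ (- k') / `|k'|)%:E)%E.
    apply: le_trans (integral_away_powR r0 k'0); rewrite awE'.
    apply: ge0_subset_integral => //; first exact: measurable_away.
    - by apply/measurable_EFinP; apply: measurable_funTS; exact: measurable_powR.
    - by move=> s _; rewrite lee_fin powR_ge0.
  have mw : measurable_fun (D `&` away k r) (fun s => s `^ (- 1 - k')).
    by apply: measurable_funTS; exact: measurable_powR.
  have := weighted_hoelder mA mgA mw (fun s As => g0 s As.1) _ p1 wH.
  have pw s : (D `&` away k r) s -> 0 < s `^ (- 1 - k').
    by move=> [Ds _]; rewrite powR_gt0 // Dpos.
  move=> /(_ pw) H.
  have -> : (\int[mu]_s h (r, s) = (r `^ (k - 1))%:E *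
      \int[mu]_(s in D `&` away k r) (g s `^ p * (s `^ (- 1 - k')) `^ (1 - p))%:E)%E.
    under eq_integral do rewrite hE//.
    rewrite ge0_integralZl_EFin ?powR_ge0//.
    - rewrite -(@integral_mkcond _ _ _ mu (D `&` away k r)).
      apply: (congr1 (fun z => (r `^ (k - 1))%:E * z)%E).
      apply: eq_integral => s /set_mem [Ds _].
      rewrite -powRrM; congr (_ * _ `^ _)%:E; rewrite kE; ring.
    - by move=> s _; apply: erestrict_ge0 => {}s _; rewrite lee_fin mulr_ge0 ?powR_ge0.
    - apply/(measurable_restrict _ _ _).1 => //; rewrite setTI.
      apply/measurable_EFinP; apply: measurable_funM.
        by apply: measurable_funS mgp => // ? [].
      by apply: measurable_funTS; exact: measurable_powR.
  rewrite muleA -EFinM [leLHS]EFinM.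
  apply: (@le_trans _ _ (((\int[mu]_(s in D `&` away k r) (g s)%:E) `^ p) * (r `^ gam)%:E)%E).
    apply: lee_wpmul2r; first by rewrite lee_fin powR_ge0.
    rewrite -poweR_EFin; apply: gt0_ler_poweR; rewrite ?in_itv/= ?leey ?lee_fin ?normr_ge0 ?(ltW p0)//.
      by rewrite integral_ge0// => s [Ds _]; rewrite lee_fin g0.
    by rewrite -awE; exact: fg.
  rewrite muleC; apply: (le_trans (lee_wpmul2l _ H)); first by rewrite lee_fin powR_ge0.
  rewrite muleA -EFinM le_eqVlt; apply/orP; left; apply/eqP; congr (_%:E * _)%E.
  rewrite powRM ?powR_ge0// ?invr_ge0// mulrA -powRrM -powRD; last first.
    by apply/implyP => _; rewrite gt_eqF.
  rewrite mulrC; congr (_ * _); last by congr (_ `^ _); rewrite gE kE; ring.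
  by rewrite /C1 -powR_inv1 ?normr_ge0// -powRrM; congr (_ `^ _); lra.
have mH : measurable_fun [set: K] (fun r => \int[mu]_s h (r, s))%E.
  exact: measurable_fun_fubini_tonelli_F.
have H0 r : (0 <= \int[mu]_s h (r, s))%E by apply: integral_ge0 => s _; exact: h0.
apply: (@le_trans _ _ (\int[mu]_(r in D) (C1%:E * \int[mu]_s h (r, s)))%E).
  apply: ge0_le_integral => //.
  - by move=> r _; rewrite lee_fin mulr_ge0 ?powR_ge0.
  - apply/measurable_EFinP; apply: measurable_funM.
      by apply: (measurableT_comp (measurable_powR _)); exact: measurableT_comp.
    by apply: measurable_funTS; exact: measurable_powR.
  - by apply: measurable_funeM; apply: measurable_funTS.
rewrite ge0_integralZl_EFin ?(ltW C10)//; last exact: measurable_funTS.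
rewrite EFinM -muleA; apply: lee_wpmul2l; first by rewrite lee_fin ltW.
apply: (@le_trans _ _ (\int[mu]_r \int[mu]_s h (r, s))%E).
  exact: ge0_subset_integral.
rewrite (@fubini_tonelli _ _ _ _ _ mu mu h mh h0).
rewrite [in leRHS]integral_mkcond -ge0_integralZl_EFin ?invr_ge0//; last 2 first.
- by move=> s _; apply: erestrict_ge0 => {}s _; rewrite lee_fin mulr_ge0 ?powR_ge0.
- apply/(measurable_restrict _ _ _).1 => //; rewrite setTI.
  apply/measurable_EFinP; apply: measurable_funM => //.
  by apply: measurable_funTS; exact: measurable_powR.
apply: ge0_le_integral => //.
- by move=> s _; apply: integral_ge0 => r _; exact: h0.
- exact: measurable_fun_fubini_tonelli_G.
- apply: measurable_funeM.
  apply/(measurable_restrict _ _ _).1 => //; rewrite setTI.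
  apply/measurable_EFinP; apply: measurable_funM => //.
  by apply: measurable_funTS; exact: measurable_powR.
move=> s _; rewrite patchE; case: ifPn => [/set_mem Ds|nDs]; last first.
  rewrite mule0 integral0_eq// => r _; rewrite /h /= /v patchE (negbTE nDs).
  by rewrite mulr0 mul0r.
have s0 := Dpos s Ds.
have k0' : - k != 0 by rewrite oppr_eq0.
(* Seen from s, the condition on r defines the opposite side [away (- k) s], where r^(k-1) has
   integral at most s^k / |k|. The power of s becomes p - 1 + 2k = gam + p. *)
apply: (@le_trans _ _ ((v s)%:E * \int[mu]_(r in away (- k) s) (r `^ (- 1 - - k))%:E)%E).
  rewrite -ge0_integralZl_EFin //; last 3 first.
  - exact: measurable_away.
  - by move=> r _; rewrite lee_fin powR_ge0.
  - by apply/measurable_EFinP; apply: measurable_funTS; exact: measurable_powR.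
  rewrite [leRHS]integral_mkcond; apply: ge0_le_integral => //.
  - by apply: (measurableT_comp mh); exact: measurable_pair2.
  - apply/(measurable_restrict _ _ _).1 => //; first exact: measurable_away.
    rewrite setTI; apply/measurable_EFinP; apply: measurable_funM => //.
    by apply: measurable_funTS; exact: measurable_powR.
  move=> r _; rewrite /h /= /u patchE.
  have [/set_mem Dr|nDr] := boolP (r \in D); last first.
    by rewrite !mul0r; apply: erestrict_ge0 => t _; rewrite lee_fin mulr_ge0 ?powR_ge0.
  rewrite patchE indicE.
  have -> : ((r, s) \in S) = (r \in away (- k) s).
    have aE := awayC (Dpos r Dr) s0 k0.
    by apply/idP/idP => /set_mem H; apply/mem_set; move: H; rewrite /S /= aE.
  case: (r \in away (- k) s); last by rewrite mulr0.
  by rewrite mulr1 mulrC -EFinM opprK (addrC (-1) k).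
apply: (le_trans (lee_wpmul2l _ (integral_away_powR s0 k0'))); first by rewrite lee_fin.
rewrite -EFinM lee_fin normrN opprK /v patchE mem_set// mulrA mulrC.
rewrite ler_pM2l ?invr_gt0 ?normr_gt0// -mulrA -powRD; last first.
  by apply/implyP => _; rewrite gt_eqF.
by rewrite le_eqVlt; apply/orP; left; apply/eqP; congr (_ * _ `^ _); rewrite /k; field.
Qed.

End Hardy.

(** * Weighted p-energies, and bounds from tail and head integrals *)

Section Energy.
Context {K : realType}.
Implicit Types (a b c x y e d r s t p : K) (f g w : K -> K) (R : \bar K).
Local Notation mu := (@lebesgue_measure K).

Definition energy R p b f : \bar K :=
  \int[mu]_(r in zeroto R) (`|f r| `^ p * r `^ b)%:E.

Lemma wnormE R p b f : wnorm R p b f = (energy R p b f `^ p^-1)%E.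
Proof. by []. Qed.

Lemma energy_ge0 R p b f : (0 <= energy R p b f)%E.
Proof. by apply: integral_ge0 => r _; rewrite lee_fin mulr_ge0 ?powR_ge0. Qed.

Lemma measurable_energy R p b f : measurable_fun (zeroto R) f ->
  measurable_fun (zeroto R) (fun r => (`|f r| `^ p * r `^ b)%:E).
Proof.
move=> mf; apply/measurable_EFinP; apply: measurable_funM.
  by apply: (measurableT_comp (measurable_powR _)); exact: measurableT_comp.
by apply: measurable_funTS; exact: measurable_powR.
Qed.

Lemma eq_energy R p b f g : (forall r, zeroto R r -> f r = g r) ->
  energy R p b f = energy R p b g.
Proof. by move=> fg; apply: eq_integral => r /set_mem Dr; rewrite fg. Qed.

Lemma ae_eq_energy R p b f g : measurable_fun (zeroto R) f ->
  measurable_fun (zeroto R) g ->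
  {ae mu, forall r, zeroto R r -> f r = g r} -> energy R p b f = energy R p b g.
Proof.
move=> mf mg fg; apply: ae_eq_integral.
- exact: measurable_zeroto.
- exact: measurable_energy.
- exact: measurable_energy.
- by apply: (@filterS _ _ (ae_filter_ringOfSetsType mu)) fg => r H Dr; rewrite H.
Qed.

Lemma energyM_powR R p b e f : p != 0 ->
  energy R p b (fun r => r `^ e * f r) = energy R p (b + e * p) f.
Proof.
move=> p0; apply: eq_integral => r /set_mem [r0 _].
rewrite normrM powRM// ger0_norm ?powR_ge0// -powRrM powRD; last first.
  by apply/implyP => _; rewrite gt_eqF.
by congr EFin; ring.
Qed.

Lemma energyZ R p b c f : 0 < p -> measurable_fun (zeroto R) f ->
  energy R p b (fun r => c * f r) = ((`|c| `^ p)%:E * energy R p b f)%E.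
Proof.
move=> p0 mf; rewrite /energy -ge0_integralZl_EFin ?powR_ge0//.
- apply: eq_integral => r _; rewrite normrM powRM// -EFinM; congr EFin.
  by rewrite mulrA.
- exact: measurable_zeroto.
- by move=> r _; rewrite lee_fin mulr_ge0 ?powR_ge0.
- exact: measurable_energy.
Qed.

Lemma powR_normD x y p : 0 <= p -> `|x + y| `^ p <= 2 `^ p * (`|x| `^ p + `|y| `^ p).
Proof.
move=> p0; have [xy|/ltW yx] := leP `|x| `|y|.
- apply: (@le_trans _ _ ((2 * `|y|) `^ p)).
    apply: ge0_ler_powR; rewrite ?nnegrE ?mulr_ge0//.
    by apply: (le_trans (ler_normD _ _)); lra.
  by rewrite powRM// ler_wpM2l ?powR_ge0// lerDr powR_ge0.
- apply: (@le_trans _ _ ((2 * `|x|) `^ p)).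
    apply: ge0_ler_powR; rewrite ?nnegrE ?mulr_ge0//.
    by apply: (le_trans (ler_normD _ _)); lra.
  by rewrite powRM// ler_wpM2l ?powR_ge0// lerDl powR_ge0.
Qed.

Lemma energyD R p b f g : 0 <= p -> measurable_fun (zeroto R) f ->
  measurable_fun (zeroto R) g ->
  (energy R p b (fun r => f r + g r)%R <=
    (2 `^ p)%:E * (energy R p b f + energy R p b g))%E.
Proof.
move=> p0 mf mg; have mD := measurable_zeroto R.
rewrite /energy -ge0_integralD//; last 4 first.
- by move=> r _; rewrite lee_fin mulr_ge0 ?powR_ge0.
- exact: measurable_energy.
- by move=> r _; rewrite lee_fin mulr_ge0 ?powR_ge0.
- exact: measurable_energy.
rewrite -ge0_integralZl_EFin ?powR_ge0//; last 2 first.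
- by move=> r _; rewrite -EFinD lee_fin addr_ge0 ?mulr_ge0 ?powR_ge0.
- by apply: emeasurable_funD; exact: measurable_energy.
apply: ge0_le_integral => //.
- by move=> r _; rewrite lee_fin mulr_ge0 ?powR_ge0.
- by apply: measurable_energy; exact: measurable_funD.
- apply: measurable_funeM; apply: emeasurable_funD; exact: measurable_energy.
- move=> r _; rewrite -EFinD -EFinM lee_fin -mulrDl mulrA ler_wpM2r ?powR_ge0//.
  exact: powR_normD.
Qed.

Lemma energy_sum R p b n (c : nat -> K) : 0 < p -> (forall j, 0 < c j) ->
  exists2 C, 0 < C & forall (F : nat -> K -> K) (S : \bar K), (0 <= S)%E ->
    (forall j, (j < n)%N -> measurable_fun (zeroto R) (F j)) ->
    (forall j, (j < n)%N -> (energy R p b (F j) <= (c j)%:E * S)%E) ->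
    (energy R p b (fun r => \sum_(j < n) F j r)%R <= C%:E * S)%E.
Proof.
move=> p0 c0; elim: n => [|n [C C0 IH]].
  exists 1 => // F S S0 _ _; rewrite (@eq_energy _ _ _ _ (fun r => 0 * 0)).
    rewrite energyZ// normr0 powR0 ?gt_eqF// mul0e mul1e//.
  by move=> r _; rewrite big_ord0 mulr0.
exists (2 `^ p * (C + c n)).
  by rewrite mulr_gt0 ?powR_gt0// addr_gt0.
move=> F S S0 mF HF.
rewrite (@eq_energy _ _ _ _ (fun r => \sum_(j < n) F j r + F n r)); last first.
  by move=> r _; rewrite big_ord_recr.
apply: (le_trans (energyD _ (ltW p0) _ _)).
- apply: measurable_sum => j; apply: mF; exact: ltnW (ltn_ord j).
- exact: mF.
rewrite EFinM -muleA; apply: lee_wpmul2l; first by rewrite lee_fin powR_ge0.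
rewrite (EFinD C (c n)) ge0_muleDl ?lee_fin ?(ltW C0) ?(ltW (c0 n))//.
apply: leeD.
  by apply: IH => // j jn; [apply: mF|apply: HF]; exact: ltnW.
exact: HF.
Qed.

Lemma toward_proper R : (0 < R)%E -> ProperFilter (toward R).
Proof.
by case: R => [b _|_|//]; [exact: at_left_proper_filter|exact: proper_pinfty_nbhs].
Qed.

Lemma toward_near R r : zeroto R r -> \forall b \near toward R, r < b /\ zeroto R b.
Proof.
move=> [r0 rR]; case: R rR => [b| |]//= rb.
- near=> x; have rx : r < x by near: x; apply: nbhs_left_gt; rewrite -lte_fin.
  split => //; split; first exact: lt_trans rx.
  by rewrite lte_fin; near: x; exact: nbhs_left_lt.
- near=> x; have rx : r < x by near: x; apply: nbhs_pinfty_gt; exact: num_real.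
  split => //; split; first exact: lt_trans rx.
  exact: ltry.
Unshelve. all: by end_near. Qed.

Lemma measurable_zeroto_away R e r : measurable (zeroto R `&` away e r).
Proof. by apply: measurableI; [exact: measurable_zeroto|exact: measurable_away]. Qed.

Lemma zeroto_pos R r : zeroto R r -> (0 < R)%E.
Proof. by move=> [r0]; apply: lt_trans; rewrite lte_fin. Qed.

Lemma ACloc_tail R e f r : 0 < e -> ACloc R f ->
  f s @[s --> toward R] --> (0 : K) -> zeroto R r ->
  (`|f r|%:E <= \int[mu]_(s in zeroto R `&` away e r) (`|derive1 f s|)%:E)%E.
Proof.
move=> e0 acf f0 Dr; have FF := toward_proper (zeroto_pos Dr).
apply/lee_addgt0Pr => eps eps0.
have [b [[rb Db] fb]] : exists b, (r < b /\ zeroto R b) /\ `|f b| < eps.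
  have /cvgrPdist_lt /(_ _ eps0) H := f0.
  have [b [h1 h2]] := filter_ex (filterI (toward_near Dr) H).
  by exists b; split => //; move: h2; rewrite sub0r normrN.
apply: (@le_trans _ _ (`|f b - f r|%:E + eps%:E)%E).
  rewrite -EFinD lee_fin; have := ler_distD (f b) (f r) 0.
  by rewrite !subr0 distrC; lra.
apply: leeD2r; apply: (le_trans (ACloc_incr_le acf Dr Db rb)).
apply: ge0_subset_integral.
- exact: measurable_itv.
- exact: measurable_zeroto_away.
- apply/measurable_EFinP; apply: measurableT_comp => //.
  by apply: measurable_funS (ACloc_measurable_derive1 acf); [exact: measurable_zeroto|].
- by move=> s _; rewrite lee_fin.
- move=> s /=; rewrite in_itv/= /away e0 => /andP[rs sb]; split => //.
  by apply: (zeroto_itv Dr Db); exact: ltW.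
Qed.

(** The counterpart of [ACloc_tail] at 0. Small values at some points arbitrarily near 0 take the
    place of a limit, since each [eps] calls for one point [a] only. *)
Lemma ACloc_head R e f r : e < 0 -> ACloc R f ->
  (forall eps d, 0 < eps -> 0 < d -> exists a, [/\ 0 < a, a < d & `|f a| < eps]) ->
  zeroto R r ->
  (`|f r|%:E <= \int[mu]_(s in zeroto R `&` away e r) (`|derive1 f s|)%:E)%E.
Proof.
move=> e0 acf f0 Dr; have r0 := Dr.1.
apply/lee_addgt0Pr => eps eps0.
have [a [a0 ar fa]] := f0 eps r eps0 r0.
have Da : zeroto R a by apply: zeroto_le Dr a0 _; exact: ltW.
apply: (@le_trans _ _ (`|f r - f a|%:E + eps%:E)%E).
  rewrite -EFinD lee_fin; have := ler_distD (f a) (f r) 0.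
  by rewrite !subr0; lra.
apply: leeD2r; apply: (le_trans (ACloc_incr_le acf Da Dr ar)).
apply: ge0_subset_integral.
- exact: measurable_itv.
- exact: measurable_zeroto_away.
- apply/measurable_EFinP; apply: measurableT_comp => //.
  by apply: measurable_funS (ACloc_measurable_derive1 acf); [exact: measurable_zeroto|].
- by move=> s _; rewrite lee_fin.
- move=> s /=; rewrite in_itv/= => /andP[rs sb]; split.
    by apply: (zeroto_itv Da Dr); exact: ltW.
  by rewrite /away /= (ltNge 0) (ltW e0)/= sb (lt_trans a0 rs).
Qed.

(** The sign of gam + 1 decides from which end f is recovered by integrating its derivative, and so
    at which end f has to vanish. *)
Lemma ACloc_hardy R p gam : 1 < p -> gam + 1 != 0 -> exists2 C, 0 < C & forall f,
  ACloc R f -> (0 < gam + 1 -> f s @[s --> toward R] --> (0 : K)) ->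
  (gam + 1 < 0 -> forall eps d, 0 < eps -> 0 < d ->
    exists a, [/\ 0 < a, a < d & `|f a| < eps]) ->
  (energy R p gam f <= C%:E * energy R p (gam + p) (derive1 f))%E.
Proof.
move=> p1 g1; have [C C0 H] := hardy R p1 g1; exists C => // f acf fR f0.
have mf' := ACloc_measurable_derive1 acf.
have := H f (fun s => `|derive1 f s|) (ACloc_measurable acf) _ (fun s _ => normr_ge0 _).
apply; first exact: measurableT_comp.
move=> r Dr; have [|g0] := ltP 0 (gam + 1).
  by move=> /[dup] g0 /fR fR0; exact: ACloc_tail.
have g0' : gam + 1 < 0 by rewrite lt_neqAle g1.
by apply: ACloc_head => //; exact: f0.
Qed.

Lemma tail_hoelder R p b : 1 < p -> 0 < b - p + 1 -> exists2 C, 0 < C & forall g r,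
  measurable_fun (zeroto R) g -> zeroto R r ->
  ((\int[mu]_(s in zeroto R `&` away 1 r) (`|g s|)%:E) `^ p <=
    (C * r `^ (- (b - p + 1)))%:E * energy R p b g)%E.
Proof.
move=> p1 b0; have pm0 : 0 < p - 1 by lra.
(* Chosen so that the Hoelder weight s^(-1-e), raised to the power 1 - p, is s^b. *)
pose e := (b - p + 1) / (p - 1); have e0 : 0 < e by rewrite divr_gt0.
have eE : e * (p - 1) = b - p + 1 by rewrite /e divfK// gt_eqF.
have expE : (- 1 - e) * (1 - p) = b.
  have -> : (- 1 - e) * (1 - p) = p - 1 + e * (p - 1) by ring.
  by rewrite eE; ring.
exists (e `^ (1 - p)); first by rewrite powR_gt0.
move=> g r mg Dr; have r0 := Dr.1.
have mA := measurable_zeroto_away R 1 r.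
have mgA : measurable_fun (zeroto R `&` away 1 r) (fun s => `|g s|).
  apply: measurableT_comp => //.
  by apply: measurable_funS mg => //; [exact: measurable_zeroto].
have mw A : measurable_fun A (fun s : K => s `^ (- 1 - e)).
  by apply: measurable_funTS; exact: measurable_powR.
have aw : away 1 r = away e r by rewrite /away ltr01 e0.
have wH : (\int[mu]_(s in zeroto R `&` away 1 r) (s `^ (- 1 - e))%:E <= (r `^ (- e) / `|e|)%:E)%E.
  apply: le_trans (integral_away_powR r0 (lt0r_neq0 e0)); rewrite -aw.
  apply: ge0_subset_integral => //; first exact: measurable_away.
  - by apply/measurable_EFinP; exact: mw.
  - by move=> s _; rewrite lee_fin powR_ge0.
have pw s : (zeroto R `&` away 1 r) s -> 0 < s `^ (- 1 - e).
  by move=> [[s0 _] _]; rewrite powR_gt0.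
apply: (le_trans (weighted_hoelder mA mgA (mw _) (fun s _ => normr_ge0 _) pw p1 wH)).
have -> : (r `^ (- e) / `|e|) `^ (p - 1) = e `^ (1 - p) * r `^ (- (b - p + 1)).
  rewrite gtr0_norm// powRM ?powR_ge0 ?invr_ge0 ?(ltW e0)// -powRrM mulNr eE mulrC.
  by rewrite -powR_inv1 ?(ltW e0)// -powRrM; congr (_ `^ _ * _); ring.
apply: lee_wpmul2l; first by rewrite lee_fin mulr_ge0 ?powR_ge0.
apply: (@le_trans _ _ (\int[mu]_(s in zeroto R `&` away 1 r) (`|g s| `^ p * s `^ b)%:E)%E).
  rewrite le_eqVlt; apply/orP; left; apply/eqP; apply: eq_integral => s _.
  by rewrite -powRrM expE.
apply: ge0_subset_integral => //; first exact: measurable_zeroto.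
- exact: measurable_energy.
- by move=> s _; rewrite lee_fin mulr_ge0 ?powR_ge0.
Qed.

End Energy.

(** * Lower-order derivatives, and expansion of the generalized gradients *)

Section Nabla.
Context {K : realType}.
Implicit Types (a b c x y e d r s t p alpha theta : K) (f g u v w : K -> K) (R : \bar K).
Implicit Types (j k m n : nat).
Local Notation mu := (@lebesgue_measure K).

Lemma derive1nS' n u : derive1n n.+1 u = derive1 (derive1n n u).
Proof. by []. Qed.

Lemma AC_right_derivable R m u j r : AC_right R m u -> (j < m.-1)%N -> zeroto R r ->
  derivable (derive1n j u) r 1.
Proof. by move=> [[H _] _] jm Dr; exact: H. Qed.

(** The derivative of order m - 1 is absolutely continuous by assumption; those of lower order are
    continuously differentiable. *)
Lemma AC_right_ACloc R m u j : AC_right R m u -> (j < m)%N -> ACloc R (derive1n j u).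
Proof.
move=> [[H acu] _] jm; have [->//|jm1] := eqVneq j m.-1.
have ltj : (j < m.-1)%N by rewrite ltn_neqAle jm1 -ltnS (ltn_predK jm).
apply: ACloc_C1 => r Dr; first exact: H.
rewrite -derive1nS'; have [->|j1m] := eqVneq j.+1 m.-1.
  exact: ACloc_continuous acu Dr.
apply: differentiable_continuous; apply/derivable1_diffP; apply: H => //.
by rewrite ltn_neqAle j1m.
Qed.

Lemma AC_right_cvg R m u j : AC_right R m u -> (j < m)%N ->
  derive1n j u r @[r --> toward R] --> (0 : K).
Proof. by move=> [_ H] jm; exact: H. Qed.

Lemma AC_right_ae_derivable R m u : AC_right R m u -> (0 < m)%N ->
  {ae mu, forall r, zeroto R r -> forall j, (j < m)%N -> derivable (derive1n j u) r 1}.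
Proof.
move=> ACu m0; have m1 : (m.-1 < m)%N by rewrite prednK.
have := ACloc_derivable (AC_right_ACloc ACu m1).
apply: (@filterS _ _ (ae_filter_ringOfSetsType mu)) => r H Dr j jm.
have [->|jm1] := eqVneq j m.-1; first exact: H.
by apply: AC_right_derivable ACu _ Dr; rewrite ltn_neqAle jm1 -ltnS prednK.
Qed.

Lemma AC_right_measurable R m u j : AC_right R m u -> (j <= m)%N -> (0 < m)%N ->
  measurable_fun (zeroto R) (derive1n j u).
Proof.
move=> ACu jm m0; have [->|jm'] := eqVneq j m.
  rewrite -(prednK m0) derive1nS'; apply: ACloc_measurable_derive1.
  by apply: (AC_right_ACloc ACu); rewrite prednK.
by apply: ACloc_measurable; apply: (AC_right_ACloc ACu); rewrite ltn_neqAle jm'.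
Qed.

(** One Hardy inequality per order, from m downwards. Each weight alpha - i p with i <= m exceeds
    -1, so every derivative is recovered by integrating from R, where it vanishes. *)
Lemma AC_right_energy R p alpha m j : 1 < p -> 0 < alpha - m%:R * p + 1 -> (j <= m)%N ->
  exists2 C, 0 < C & forall u, AC_right R m u ->
  (energy R p (alpha - (m - j)%:R * p) (derive1n j u) <=
    C%:E * energy R p alpha (derive1n m u))%E.
Proof.
move=> p1 am jm.
have main i : (i <= m)%N -> exists2 C, 0 < C & forall u, AC_right R m u ->
    (energy R p (alpha - i%:R * p) (derive1n (m - i) u) <=
      C%:E * energy R p alpha (derive1n m u))%E.
  elim: i => [_|i IH im].
    by exists 1 => // u _; rewrite mul0r subr0 subn0 mul1e.
  have [C C0 HC] := IH (ltnW im).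
  have gam0 : 0 < alpha - i.+1%:R * p + 1.
    apply: lt_le_trans am _; rewrite lerD2r lerD2l lerN2 ler_wpM2r ?ler_nat//; lra.
  have [C' C'0 HC'] := ACloc_hardy R p1 (lt0r_neq0 gam0).
  exists (C' * C); first exact: mulr_gt0.
  move=> u ACu; have mi : (m - i.+1 < m)%N by rewrite ltn_subrL (leq_trans _ im).
  apply: (le_trans (HC' _ (AC_right_ACloc ACu mi) _ _)).
  - by move=> _; exact: AC_right_cvg ACu mi.
  - by move=> h; have := lt_trans h gam0; rewrite ltxx.
  rewrite -(derive1nS' (m - i.+1)) (subnSK im) EFinM -muleA; apply: lee_wpmul2l.
    by rewrite lee_fin ltW.
  rewrite (_ : _ + p = alpha - i%:R * p); first exact: HC.
  by rewrite -[i.+1]addn1 natrD; ring.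
have [C C0] := main (m - j)%N (leq_subr _ _); rewrite subKn// => HC.
by exists C.
Qed.

(** Hoelder on the tail, applied to the derivative of order j + 1, whose energy with weight alpha -
    (m - j - 1) p is bounded already. *)
Lemma AC_right_pointwise R p alpha m j : 1 < p -> 0 < alpha - m%:R * p + 1 -> (j < m)%N ->
  exists2 C, 0 < C & forall u r, AC_right R m u -> zeroto R r ->
  ((`|derive1n j u r| `^ p)%:E <=
    (C * r `^ (- (alpha - (m - j)%:R * p + 1)))%:E * energy R p alpha (derive1n m u))%E.
Proof.
move=> p1 am jm; have [C C0 HC] := AC_right_energy R p1 am jm.
have mjE : (m - j)%:R = (m - j.+1)%:R + 1 :> K by rewrite -(subnSK jm) -natr1.
have bE : (alpha - (m - j.+1)%:R * p) - p + 1 = alpha - (m - j)%:R * p + 1.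
  by rewrite mjE; ring.
have b0 : 0 < (alpha - (m - j.+1)%:R * p) - p + 1.
  rewrite bE; apply: lt_le_trans am _; rewrite lerD2r lerD2l lerN2.
  by rewrite ler_wpM2r ?ler_nat ?leq_subr// (le_trans ler01)// ltW.
have [C' C'0 HC'] := tail_hoelder R p1 b0.
exists (C' * C); first exact: mulr_gt0.
move=> u r ACu Dr; have mU := AC_right_measurable ACu jm (leq_ltn_trans (leq0n _) jm).
have := ACloc_tail ltr01 (AC_right_ACloc ACu jm) (AC_right_cvg ACu jm) Dr.
move=> H; have := HC' _ r mU Dr.
rewrite bE => H'.
 have := gt0_ler_poweR (ltW (lt_trans ltr01 p1)) _ _ H.
rewrite !in_itv/= !leey !andbT lee_fin normr_ge0 => /(_ isT).
rewrite integral_ge0 => [/(_ isT)|s _]; last by rewrite lee_fin.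
move=> /le_trans; apply; apply: (le_trans H').
rewrite (mulrAC C' C) (EFinM _ C) -muleA; apply: lee_wpmul2l; first by rewrite lee_fin mulr_ge0 ?powR_ge0 ?(ltW C'0).
exact: HC.
Qed.

(** The exponent e in v_(k+1) = r^(-e) (r^e v_k)': a gradient of odd order is a derivative awaiting
    the second half of a Laplacian. *)
Definition twist alpha k : K := if odd k then alpha else 0.

(** Since [powR] gives s^0 = 1 for every s, the even case too is an identity of functions on the
    whole line. *)
Lemma nablaS alpha k u : nabla alpha k.+1 u =
  fun r => r `^ (- twist alpha k) * derive1 (fun s => s `^ twist alpha k * nabla alpha k u s) r.
Proof.
rewrite /nabla /twist /=; case ok : (odd k) => /=.
  by rewrite uphalf_half ok add1n iterS.
apply/funext => r; rewrite oppr0 powRr0 mul1r; congr (derive1 _ r).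
by rewrite uphalf_half ok add0n; apply/funext => s; rewrite powRr0 mul1r.
Qed.

Lemma nabla_derive1 R alpha k u r : zeroto R r ->
  derive1 (fun s => s `^ twist alpha k * nabla alpha k u s) r =
  r `^ twist alpha k * nabla alpha k.+1 u r.
Proof.
move=> [r0 _]; rewrite nablaS mulrA -powRD ?subrr ?powRr0 ?mul1r//.
by apply/implyP => _; rewrite gt_eqF.
Qed.

Lemma is_derive_powRM c f r : 0 < r -> derivable f r 1 ->
  is_derive r 1 (fun s => s `^ c * f s) (c * r `^ (c - 1) * f r + r `^ c * derive1 f r).
Proof.
move=> r0 df; have H1 := is_derive1_powR c r0.
have H2 : is_derive r 1 f (derive1 f r) by rewrite derive1E; exact: DeriveDef.
have := is_deriveM H1 H2.
rewrite /GRing.scale/= => H; apply: (is_derive_eq H).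
by rewrite addrC mulrC.
Qed.

Lemma is_derive_bigsum n (F : nat -> K -> K) (dF : nat -> K) r :
  (forall j, (j < n)%N -> is_derive r 1 (F j) (dF j)) ->
  is_derive r 1 (fun s => \sum_(j < n) F j s) (\sum_(j < n) dF j).
Proof.
move=> H; have -> : (fun s => \sum_(j < n) F j s) = \sum_(j < n) F j.
  by apply/funext => s; rewrite fct_sumE.
by apply: is_derive_sum => j; exact: H.
Qed.

(** The derivative of order k - 1 need be derivable at [r] only, the lower ones on all of (0, R),
    because the expansion one order below is differentiated and must hold near [r]. This is what
    allows an almost everywhere statement at the top order. *)
Lemma nabla_expansion alpha k : exists c : nat -> K, forall R u r, zeroto R r ->
  (forall j s, (j.+1 < k)%N -> zeroto R s -> derivable (derive1n j u) s 1) ->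
  (forall j, (j < k)%N -> derivable (derive1n j u) r 1) ->
  nabla alpha k u r = \sum_(j < k.+1) c j * (r `^ (j%:R - k%:R) * derive1n j u r).
Proof.
elim: k => [|k [c IH]].
  exists (fun=> 1) => R u r _ _ _; rewrite big_ord1 /nabla /= subrr powRr0.
  by rewrite !mul1r.
pose e := twist alpha k.
(* By the product rule each term feeds two coefficients: c_j (j - k + e) at index j, from the power
   of r, and c_j at index j + 1, from the derivative of u^(j). *)
exists (fun j => (if (j <= k)%N then c j * (j%:R - k%:R + e) else 0) +
  (if j is i.+1 then c i else 0)) => R u r Dr dD dr.
have r0 := Dr.1.
rewrite nablaS -/e.
pose F j s := c j * (s `^ (j%:R - k%:R + e) * derive1n j u s).
have nF : {near r, (fun s => s `^ e * nabla alpha k u s) =1 (fun s => \sum_(j < k.+1) F j s)}.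
  have : nbhs r (zeroto R) by apply: open_nbhs_nbhs; split => //; exact: zeroto_open.
  apply: filterS => s Ds; rewrite (IH R)//; last 2 first.
  - by move=> j t jk Dt; apply: dD => //; exact: ltnW.
  - by move=> j jk; exact: dD.
  rewrite mulr_sumr; apply: eq_bigr => j _; rewrite /F [s `^ (_ - _ + e)]powRD; last first.
    by apply/implyP => _; rewrite gt_eqF// Ds.1.
  set A := s `^ (_ - _); set B := s `^ e; set U := derive1n j u s; ring.
rewrite (derive1_near_eq nF) derive1E.
have dF j : (j < k.+1)%N -> is_derive r 1 (F j)
    (c j * ((j%:R - k%:R + e) * r `^ (j%:R - k%:R + e - 1) * derive1n j u r +
       r `^ (j%:R - k%:R + e) * derive1n j.+1 u r)).
  by move=> jk; apply: is_deriveZ; apply: is_derive_powRM => //; exact: dr.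
rewrite (is_derive_bigsum dF).(derive_val).
under [in RHS]eq_bigr do rewrite mulrDl.
rewrite big_split/=.
rewrite [X in _ = X + _]big_ord_recr/= ltnn mul0r addr0 [X in _ = _ + X]big_ord_recl/= mul0r add0r.
rewrite mulr_sumr -big_split/=; apply: eq_bigr => j _.
have -> : (j <= k)%N by rewrite -ltnS.
rewrite /bump/= add0n add1n -(natr1 k) -(natr1 j).
have pD x : r `^ (- e) * r `^ (x + e) = r `^ x.
  by rewrite -powRD ?(addrC x) ?addKr//; apply/implyP => _; rewrite gt_eqF.
rewrite (_ : j%:R + 1 - (k%:R + 1) = j%:R - k%:R); last by ring.
rewrite -(pD (j%:R - k%:R)) -(pD (j%:R - (k%:R + 1))).
rewrite (_ : j%:R - (k%:R + 1) + e = j%:R - k%:R + e - 1); last by ring.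
set A := r `^ (- e); set B := r `^ _; set B' := r `^ _.
set U := derive1n j u r; set U' := derive1 _ r; ring.
Qed.

(** At k = m the derivability of u^(m-1) is known almost everywhere only, whence the two clauses. *)
Lemma AC_right_nabla alpha k : exists c : nat -> K, forall R m u, AC_right R m u ->
  ((k < m)%N -> forall r, zeroto R r -> nabla alpha k u r =
     \sum_(j < k.+1) c j * (r `^ (j%:R - k%:R) * derive1n j u r)) /\
  (k = m -> (0 < m)%N -> {ae mu, forall r, zeroto R r -> nabla alpha k u r =
     \sum_(j < k.+1) c j * (r `^ (j%:R - k%:R) * derive1n j u r)}).
Proof.
have [c H] := nabla_expansion alpha k; exists c => R m u ACu; split.
  move=> km r Dr; apply: (H R) => //.
    move=> j s jk Ds; apply: AC_right_derivable ACu _ Ds.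
    by rewrite -ltnS (ltn_predK km) (leq_trans _ km)// ltnS ltnW.
  move=> j jk; apply: AC_right_derivable ACu _ Dr.
  by rewrite -ltnS (ltn_predK km) (leq_trans _ km).
move=> km m0; apply: (@filterS _ _ (ae_filter_ringOfSetsType mu)) (AC_right_ae_derivable ACu m0).
move=> r Hr Dr; apply: (H R) => //.
  move=> j s jk Ds; apply: AC_right_derivable ACu _ Ds.
  by rewrite -ltnS prednK// -km.
by move=> j jk; apply: Hr => //; rewrite -km.
Qed.

Lemma ACloc_powR R c : ACloc R (fun s => s `^ c).
Proof.
have dpow x b : 0 < x -> is_derive x 1 (fun s => s `^ b) (b * x `^ (b - 1)).
  by move=> x0; exact: is_derive1_powR.
apply: ACloc_C1 => x [x0 _]; first exact: (dpow x c x0).(ex_derive).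
have nE : {near x, (fun s => c * s `^ (c - 1)) =1 derive1 (fun s => s `^ c)}.
  near=> y; have y0 : 0 < y by near: y; exact: lt_nbhsr.
  by rewrite derive1E (dpow y c y0).(derive_val).
have E1 : derive1 (fun s => s `^ c) x = c * x `^ (c - 1).
  by rewrite derive1E (dpow x c x0).(derive_val).
rewrite /prop_for /continuous_at E1; apply: cvg_trans (near_eq_cvg nE) _.
apply: cvgM; first exact: cvg_cst.
have : {for x, continuous (fun s => s `^ (c - 1))}; last by [].
apply: differentiable_continuous; apply/derivable1_diffP.
exact: (dpow x _ x0).(ex_derive).
Unshelve. all: by end_near. Qed.

Lemma ACloc_nabla R alpha m k u e : AC_right R m u -> (k < m)%N ->
  ACloc R (fun s => s `^ e * nabla alpha k u s).
Proof.
move=> ACu km; have [c /(_ R m u ACu) [/(_ km) H _]] := AC_right_nabla alpha k.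
apply: AClocM; first exact: ACloc_powR.
apply: (@ACloc_eq _ _ (fun r => \sum_(j < k.+1) c j * (r `^ (j%:R - k%:R) * derive1n j u r))).
  by move=> r Dr; rewrite H.
apply: (@ACloc_sum _ _ _ (fun j r => c j * (r `^ (j%:R - k%:R) * derive1n j u r))) => j jk.
apply: AClocM; first exact: ACloc_cst.
apply: AClocM; first exact: ACloc_powR.
by apply: AC_right_ACloc ACu _; exact: leq_trans jk km.
Qed.

Lemma measurable_nabla R alpha m k u : AC_right R m u -> (k <= m)%N -> (0 < m)%N ->
  measurable_fun (zeroto R) (nabla alpha k u).
Proof.
move=> ACu; case: k => [|k] km m0; first exact: AC_right_measurable (leq0n m) m0.
rewrite nablaS; apply: measurable_funM.
  by apply: measurable_funTS; exact: measurable_powR.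
by apply: ACloc_measurable_derive1; exact: ACloc_nabla ACu km.
Qed.

(** In the expansion every exponent j - k is nonpositive, so the powers of r are bounded for r
    beyond a fixed [r0], while each u^(j) tends to 0. *)
Lemma nabla_cvg R alpha m k u : AC_right R m u -> (k < m)%N -> (0 < R)%E ->
  nabla alpha k u r @[r --> toward R] --> (0 : K).
Proof.
move=> ACu km R0; have [c /(_ R m u ACu) [/(_ km) H _]] := AC_right_nabla alpha k.
have FF := toward_proper R0.
have [r0 Dr0] : exists r0, zeroto R r0.
  case: R R0 {H ACu FF} => [b| |]//= b0.
    by exists (b / 2); rewrite lte_fin in b0; split; [lra|rewrite lte_fin; lra].
  by exists 1; split => //; exact: ltry.
apply: (@cvg_trans _ ((fun r => \sum_(j < k.+1) c j * (r `^ (j%:R - k%:R) * derive1n j u r)) r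
    @[r --> toward R])).
  by apply: near_eq_cvg; apply: filterS (toward_near Dr0) => r [_ Dr]; rewrite H.
have S0 : \sum_(j < k.+1) (0 : K) = 0 by rewrite big1.
suff : (fun r => \sum_(j < k.+1) c j * (r `^ (j%:R - k%:R) * derive1n j u r)) r
    @[r --> toward R] --> \sum_(j < k.+1) (0 : K) by rewrite S0.
apply: cvg_big => //; first exact: add_continuous.
move=> j _; have ju : derive1n j u r @[r --> toward R] --> (0 : K).
  by apply: AC_right_cvg ACu _; exact: leq_trans (ltn_ord j) km.
pose M := `|c j| * r0 `^ (j%:R - k%:R) + 1.
have M0 : 0 < M by rewrite ltr_wpDl ?mulr_ge0 ?powR_ge0.
apply/cvgr0Pnorm_lt => eps eps0.
have /cvgr0Pnorm_lt /(_ _ (divr_gt0 eps0 M0)) ju' := ju.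
near=> r.
have [r0r Dr] : r0 < r /\ zeroto R r by near: r; exact: toward_near.
have Hu : `|derive1n j u r| < eps / M by near: r.
have pw : r `^ (j%:R - k%:R) <= r0 `^ (j%:R - k%:R).
  rewrite -(opprB k%:R) !powRN lef_pV2 ?posrE ?powR_gt0 ?Dr.1 ?Dr0.1//.
  apply: ge0_ler_powR; rewrite ?nnegrE ?(ltW Dr.1) ?(ltW Dr0.1) ?(ltW r0r)//.
  by rewrite subr_ge0 ler_nat -ltnS.
rewrite !normrM (ger0_norm (powR_ge0 _ _)).
apply: (@le_lt_trans _ _ (M * `|derive1n j u r|)).
  rewrite mulrA ler_wpM2r// /M (le_trans (ler_wpM2l _ pw))// lerDl//.
by rewrite mulrC -ltr_pdivlMr.
Unshelve. all: by end_near. Qed.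

End Nabla.

(** * The weighted inequality on [D0] *)

Section Inequality.
Context {K : realType}.
Implicit Types (a b c x y e d r s t p q alpha theta : K) (f g u v w : K -> K) (R : \bar K).
Implicit Types (j k m n : nat).
Local Notation mu := (@lebesgue_measure K).

Lemma wnorm_lty R p b f : 0 < p -> (wnorm R p b f < +oo)%E = (energy R p b f < +oo)%E.
Proof.
move=> p0; rewrite wnormE; case: (energy R p b f) (energy_ge0 R p b f) => [x _| _|//].
  by rewrite poweR_EFin !ltry.
by rewrite poweRyr// invr_eq0 gt_eqF.
Qed.

Lemma sum_bound R n (F : nat -> K -> K) (phi : K -> K) :
  (forall j, (j < n)%N -> exists2 M, 0 <= M & forall r, zeroto R r -> `|F j r| <= M * phi r) ->
  exists2 M, 0 <= M & forall r, zeroto R r -> `|\sum_(j < n) F j r| <= M * phi r.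
Proof.
elim: n => [_|n IH H].
  by exists 0 => // r _; rewrite big_ord0 normr0 mul0r.
have [j jn|M M0 HM] := IH; first by apply: H; rewrite ltnS ltnW.
have [N N0 HN] := H n (ltnSn n).
exists (M + N); first exact: addr_ge0.
move=> r Dr; rewrite big_ord_recr/= mulrDl; apply: (le_trans (ler_normD _ _)).
by apply: lerD; [exact: HM|exact: HN].
Qed.

(* Supplies the vanishing at 0 that Hardy's inequality needs for negative gam + 1. *)
Lemma nabla_small R p alpha m k u : 1 < p -> 0 < alpha - m%:R * p + 1 -> (0 < R)%E ->
  -1 < alpha -> D0 R alpha m p u -> (k < m)%N ->
  forall eps d, 0 < eps -> 0 < d ->
    exists a, [/\ 0 < a, a < d & `|a `^ alpha * nabla alpha k u a| < eps].
Proof.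
move=> p1 am R0 al [ACu [mU]] + km; have p0 : 0 < p by lra.
rewrite wnorm_lty// => Sfin.
have Sfn : energy R p alpha (derive1n m u) \is a fin_num.
  by rewrite ge0_fin_numE// energy_ge0.
set S := energy R p alpha (derive1n m u) in Sfin Sfn.
have S0 : 0 <= fine S by rewrite fine_ge0// energy_ge0.
(* The power of r left when the pointwise bound on u^(j) is inserted into r^alpha r^(j-k) u^(j); it
   is the same for all j, and positive. *)
pose kap := (alpha + 1) * (1 - p^-1) + (m%:R - k%:R) - 1.
have kap0 : 0 < kap.
  have h1 : 0 < (alpha + 1) * (1 - p^-1).
    by rewrite mulr_gt0// ?subr_gt0 ?invf_lt1//; lra.
  have h2 : 1 <= m%:R - k%:R :> K.
    by rewrite lerBrDr addrC natr1 ler_nat.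
  by rewrite /kap; lra.
have [c /(_ R m u ACu) [/(_ km) HE _]] := AC_right_nabla alpha k.
have [M M0 HM] : exists2 M, 0 <= M & forall r, zeroto R r ->
    `|r `^ alpha * nabla alpha k u r| <= M * r `^ kap.
  have [|M M0 HM] := @sum_bound R k.+1
    (fun j r => r `^ alpha * (c j * (r `^ (j%:R - k%:R) * derive1n j u r)))
    (fun r => r `^ kap); last first.
    exists M => // r Dr; rewrite HE// mulr_sumr; exact: HM.
  move=> j jk; have jm : (j < m)%N by exact: leq_trans jk km.
  have [C C0 HC] := AC_right_pointwise R p1 am jm.
  exists (`|c j| * (C * fine S) `^ p^-1).
    by rewrite mulr_ge0 ?powR_ge0.
  move=> r Dr; have r0 := Dr.1; have := HC u r ACu Dr.
  rewrite -/S -(fineK Sfn) -EFinM lee_fin => H.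
  have {H} Hu : `|derive1n j u r| <=
      (C * fine S) `^ p^-1 * r `^ (- (alpha - (m - j)%:R * p + 1) / p).
    have -> : `|derive1n j u r| = (`|derive1n j u r| `^ p) `^ p^-1.
      by rewrite -powRrM mulfV ?powRr1 ?lt0r_neq0.
    rewrite powRrM -powRM ?powR_ge0 ?mulr_ge0 ?(ltW C0)//.
    apply: ge0_ler_powR; rewrite ?nnegrE ?powR_ge0 ?invr_ge0 ?(ltW p0)//.
      by rewrite !mulr_ge0 ?powR_ge0 ?(ltW C0).
    by rewrite mulrAC.
  rewrite !normrM !(ger0_norm (powR_ge0 _ _)).
  apply: (@le_trans _ _ (r `^ alpha * (`|c j| * (r `^ (j%:R - k%:R) *
     ((C * fine S) `^ p^-1 * r `^ (- (alpha - (m - j)%:R * p + 1) / p)))))).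
    by rewrite !ler_wpM2l ?powR_ge0.
  set A := `|c j|; set B := (C * fine S) `^ p^-1.
  have -> : r `^ kap = r `^ alpha * (r `^ (j%:R - k%:R) *
      r `^ (- (alpha - (m - j)%:R * p + 1) / p)).
    rewrite -!powRD; last 2 first.
    - by apply/implyP => _; rewrite gt_eqF.
    - by apply/implyP => _; rewrite gt_eqF.
    congr (_ `^ _); rewrite /kap natrB ?(ltnW jm)//; field; exact: lt0r_neq0.
  rewrite le_eqVlt; apply/orP; left; apply/eqP.
  set X := r `^ alpha; set Y := r `^ _; set Z := r `^ _; ring.
move=> eps d eps0 d0.
have [r0 Dr0] : exists r0, zeroto R r0.
  case: R R0 {Sfin Sfn S S0 mU ACu HE HM} => [b| |]//= b0.
    by exists (b / 2); rewrite lte_fin in b0; split; [lra|rewrite lte_fin; lra].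
  by exists 1; split => //; exact: ltry.
(* Solves (M + 1) z^kap = eps. *)
pose z := (eps / (M + 1)) `^ (kap^-1).
have z0 : 0 < z by rewrite /z powR_gt0// divr_gt0// ltr_wpDl.
pose a := Num.min (Num.min r0 d) z / 2.
have mn0 : 0 < Num.min (Num.min r0 d) z by rewrite !lt_min Dr0.1 d0 z0.
have a0 : 0 < a by rewrite divr_gt0.
have alt : a < Num.min (Num.min r0 d) z by rewrite /a; lra.
move: alt; rewrite !lt_min => /andP[/andP[ar ad] az].
have Da : zeroto R a by apply: zeroto_le Dr0 a0 _; exact: ltW.
exists a; split => //; apply: (le_lt_trans (HM a Da)).
have : a `^ kap < z `^ kap.
  by apply: gt0_ltr_powR; rewrite ?nnegrE ?(ltW a0) ?(ltW z0).
rewrite /z -powRrM mulVf ?gt_eqF// powRr1; last by rewrite divr_ge0 ?(ltW eps0)// addr_ge0.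
rewrite ltr_pdivlMr ?ltr_wpDl// => h; apply: le_lt_trans h.
by rewrite mulrDr mulr1 mulrC lerDl powR_ge0.
Qed.

(* Hardy's inequality is never critical here: gam + 1 is alpha - (i+1) p + 1 > 0
   for e = 0 and (alpha + 1)(1 - p) - i p < 0 for e = alpha. *)
Lemma nabla_energy R p alpha m i : 1 < p -> -1 < alpha -> 0 < alpha - m%:R * p + 1 ->
  (0 < R)%E -> (i <= m)%N -> exists2 C, 0 < C & forall u, D0 R alpha m p u ->
    (energy R p (alpha - i%:R * p) (nabla alpha (m - i) u) <=
      C%:E * energy R p alpha (nabla alpha m u))%E.
Proof.
move=> p1 al am R0; have p0 : 0 < p by lra.
elim: i => [_|i IH im].
  by exists 1 => // u _; rewrite mul0r subr0 subn0 mul1e.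
have [C C0 HC] := IH (ltnW im).
set k := (m - i.+1)%N; have km : (k < m)%N by rewrite ltn_subrL (leq_trans _ im).
pose e := twist alpha k; pose gam := alpha - i.+1%:R * p - e * p.
have ip : alpha - m%:R * p + 1 <= alpha - i.+1%:R * p + 1.
  by rewrite lerD2r lerD2l lerN2 ler_wpM2r ?ler_nat// ltW.
have gamE : (e = 0 /\ 0 < gam + 1) \/ (e = alpha /\ gam + 1 < 0).
  rewrite /gam /e /twist; case: ifP => _; [right|left]; split => //; last first.
    by rewrite mul0r subr0; apply: lt_le_trans ip.
  have ip0 : 0 < i.+1%:R * p by rewrite mulr_gt0 ?ltr0n.
  have : 0 < (alpha + 1) * (p - 1) by rewrite mulr_gt0//; lra.
  have -> : (alpha + 1) * (p - 1) = alpha * p + p - alpha - 1 by ring.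
  have : p <= i.+1%:R * p by rewrite ler_peMl ?ler1n// ltW.
  lra.
have gam1 : gam + 1 != 0 by case: gamE => -[_ h]; [rewrite gt_eqF|rewrite lt_eqF].
have [C' C'0 HC'] := ACloc_hardy R p1 gam1.
exists (C' * C); first exact: mulr_gt0.
move=> u Du; have ACu := Du.1.
have gE : gam + e * p = alpha - i.+1%:R * p by rewrite /gam subrK.
rewrite -gE -(energyM_powR _ _ _ _ (lt0r_neq0 p0)).
apply: (le_trans (HC' (fun s => s `^ e * nabla alpha k u s) (ACloc_nabla alpha e ACu km) _ _)).
- move=> g0; case: gamE => -[eE h]; last by have := lt_trans h g0; rewrite ltxx.
  rewrite eE; under eq_cvg do rewrite powRr0 mul1r.
  exact: nabla_cvg ACu km R0.
- move=> g0; case: gamE => -[eE h]; first by have := lt_trans h g0; rewrite ltxx.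
  by rewrite eE; exact: (nabla_small p1 am R0 al Du km).
rewrite (@eq_energy _ _ _ _ _ (fun r => r `^ e * nabla alpha k.+1 u r)); last first.
  by move=> r Dr; exact: nabla_derive1 Dr.
rewrite (energyM_powR _ _ _ _ (lt0r_neq0 p0)) /k (subnSK im) EFinM -muleA.
apply: lee_wpmul2l; first by rewrite lee_fin ltW.
rewrite (_ : _ + _ = alpha - i%:R * p); first exact: HC.
by rewrite /gam -natr1; ring.
Qed.

(** The gradient of order 1 is u' itself, so [nabla_energy] with i = m - 1 bounds the energy of u',
    and Hoelder on the tail applies. *)
Lemma nabla_pointwise R p alpha m : 1 < p -> -1 < alpha -> 0 < alpha - m%:R * p + 1 ->
  (0 < R)%E -> (0 < m)%N -> exists2 C, 0 < C & forall u r, D0 R alpha m p u -> zeroto R r ->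
    ((`|u r| `^ p)%:E <= (C * r `^ (- (alpha - m%:R * p + 1)))%:E *
      energy R p alpha (nabla alpha m u))%E.
Proof.
move=> p1 al am R0 m0; have p0 : 0 < p by lra.
have m1 : (m.-1 <= m)%N by rewrite leq_pred.
have [C C0 HC] := nabla_energy p1 al am R0 m1.
have bE : alpha - m.-1%:R * p - p + 1 = alpha - m%:R * p + 1.
  by rewrite -[in RHS](prednK m0) -natr1; ring.
have b0 : 0 < alpha - m.-1%:R * p - p + 1 by rewrite bE.
have [C' C'0 HC'] := tail_hoelder R p1 b0; rewrite bE in HC'.
exists (C' * C); first exact: mulr_gt0.
move=> u r Du Dr; have ACu := Du.1.
have := HC u Du; rewrite (_ : (m - m.-1)%N = 1%N); last first.
  by rewrite -[X in (X - _)%N](prednK m0) subSn// subnn.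
rewrite /nabla /= -/(nabla alpha m u) => {}HC.
have := ACloc_tail ltr01 (AC_right_ACloc ACu m0) (AC_right_cvg ACu m0) Dr => /= H.
have mU : measurable_fun (zeroto R) (derive1 u) := AC_right_measurable ACu m0 m0.
have H' := HC' _ r mU Dr.
have := gt0_ler_poweR (ltW p0) _ _ H.
rewrite !in_itv/= !leey !andbT lee_fin normr_ge0 => /(_ isT).
rewrite integral_ge0 => [/(_ isT)|s _]; last by rewrite lee_fin.
move=> /le_trans; apply; apply: (le_trans H').
rewrite (mulrAC C' C) (EFinM _ C) -muleA; apply: lee_wpmul2l => //.
by rewrite lee_fin mulr_ge0 ?powR_ge0 ?(ltW C'0).
Qed.

(** In the expansion the factor r^(j-m) turns the weight alpha into alpha - (m - j) p, the one in
    which Hardy bounds u^(j). The lemma makes the right side of the final inequality finite and the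
    gradient continuous on [D0]. *)
Lemma nabla_energy_le R p alpha m : 1 < p -> 0 < alpha - m%:R * p + 1 -> (0 < m)%N ->
  exists2 C, 0 < C & forall u, AC_right R m u ->
    (energy R p alpha (nabla alpha m u) <= C%:E * energy R p alpha (derive1n m u))%E.
Proof.
move=> p1 am m0; have p0 : 0 < p by lra.
have [c HE] := AC_right_nabla alpha m.
have /choice[B HB] : forall j, exists B, 0 < B /\ ((j <= m)%N -> forall u, AC_right R m u ->
    (energy R p (alpha - (m - j)%:R * p) (derive1n j u) <=
      B%:E * energy R p alpha (derive1n m u))%E).
  move=> j; have [jm|] := leqP j m; last by exists 1.
  by have [C C0 HC] := AC_right_energy R p1 am jm; exists C.
(* The summand 1 keeps the constant positive when [c j] vanishes. *)
pose c' j := `|c j| `^ p * B j + 1.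
have c'0 j : 0 < c' j.
  by rewrite /c' ltr_wpDl// mulr_ge0 ?powR_ge0 ?(ltW (HB j).1).
have [C C0 HC] := energy_sum R alpha m.+1 p0 c'0.
exists C => // u ACu; have [_ /(_ erefl m0) ae] := HE R m u ACu.
pose F j r := c j * (r `^ (j%:R - m%:R) * derive1n j u r).
have mG j : (j <= m)%N -> measurable_fun (zeroto R) (fun r => r `^ (j%:R - m%:R) * derive1n j u r).
  move=> jm; apply: measurable_funM; last exact: AC_right_measurable ACu jm m0.
  by apply: measurable_funTS; exact: measurable_powR.
have mF j : (j < m.+1)%N -> measurable_fun (zeroto R) (F j).
  by move=> jm; apply: measurable_funM => //; exact: mG.
rewrite (@ae_eq_energy _ _ _ _ _ (fun r => \sum_(j < m.+1) F j r)); first last.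
- exact: ae.
- by apply: measurable_sum => j; exact: mF.
- exact: measurable_nabla ACu (leqnn _) m0.
apply: HC => //; first exact: energy_ge0.
move=> j jm; rewrite /F (energyZ _ _ p0 (mG j jm)) (energyM_powR _ _ _ _ (lt0r_neq0 p0)).
have -> : alpha + (j%:R - m%:R) * p = alpha - (m - j)%:R * p by rewrite natrB//; ring.
apply: (@le_trans _ _ ((`|c j| `^ p)%:E * ((B j)%:E * energy R p alpha (derive1n m u)))%E).
  by apply: lee_wpmul2l; [rewrite lee_fin powR_ge0|exact: (HB j).2].
rewrite muleA -EFinM; apply: lee_wpmul2r; first exact: energy_ge0.
by rewrite lee_fin /c' lerDl.
Qed.

Lemma pstar_inequality R p alpha theta m : 1 < p -> -1 < alpha -> -1 < theta ->
  (0 < R)%E -> (0 < m)%N -> alpha - m%:R * p <= theta -> 0 < alpha - m%:R * p + 1 ->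
  exists2 C, 0 < C & forall u, D0 R alpha m p u ->
    (wnorm R ((theta + 1) * p / (alpha - m%:R * p + 1)) theta u <=
      C%:E * wnorm R p alpha (nabla alpha m u))%E.
Proof.
move=> p1 al th R0 m0 ta am; have p0 : 0 < p by lra.
set b := alpha - m%:R * p + 1 in am *; set q := (theta + 1) * p / b.
have q0 : 0 < q by rewrite divr_gt0// mulr_gt0//; lra.
have pq : p <= q by rewrite /q mulrAC ler_peMl ?(ltW p0)// ler_pdivlMr// mul1r /b; lra.
have [C C0 HC] := nabla_pointwise p1 al am R0 m0.
have [B B0 HB] := nabla_energy p1 al am R0 (leqnn m).
have [N N0 HN] := nabla_energy_le R p1 am m0.
(* [B] comes from Hardy, and the power of [C] from the pointwise bound raised to (q - p) / p,
   nonnegative since theta >= alpha - m p. *)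
pose A := B * C `^ ((q - p) / p).
have A0 : 0 < A by rewrite mulr_gt0// powR_gt0.
exists (A `^ q^-1); first by rewrite powR_gt0.
move=> u Du; have ACu := Du.1.
set S := energy R p alpha (nabla alpha m u).
have Sfn : S \is a fin_num.
  rewrite ge0_fin_numE ?energy_ge0//; apply: (le_lt_trans (HN u ACu)).
  have := Du.2.2; rewrite wnorm_lty// => h.
  by rewrite lte_mul_pinfty ?lee_fin ?(ltW N0).
have S0 : 0 <= fine S by rewrite fine_ge0// energy_ge0.
have mu_ : measurable_fun (zeroto R) u := AC_right_measurable ACu (leq0n m) m0.
have main : (energy R q theta u <= (A * fine S `^ (q / p))%:E)%E.
  apply: (@le_trans _ _ (((C * fine S) `^ ((q - p) / p))%:E * energy R p (alpha - m%:R * p) u)%E).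
    rewrite /energy -ge0_integralZl_EFin ?powR_ge0//; last 3 first.
    - exact: measurable_zeroto.
    - by move=> r _; rewrite lee_fin mulr_ge0 ?powR_ge0.
    - exact: measurable_energy.
    apply: ge0_le_integral.
    - exact: measurable_zeroto.
    - by move=> r _; rewrite lee_fin mulr_ge0 ?powR_ge0.
    - exact: measurable_energy.
    - by apply: measurable_funeM; exact: measurable_energy.
    move=> r Dr; have r0 := Dr.1; have := HC u r Du Dr.
    rewrite -/S -(fineK Sfn) -!EFinM !lee_fin => H.
    have -> : `|u r| `^ q = `|u r| `^ (q - p) * `|u r| `^ p.
      have [->|qp] := eqVneq q p; first by rewrite subrr powRr0 mul1r.
      rewrite -powRD ?subrK//; apply/implyP => h.
      by move: h; rewrite gt_eqF.
    (* The relation b (q - p) / p = theta - (alpha - m p) is what determines the critical exponent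
       q. *)
    have -> : r `^ theta = r `^ (b * ((q - p) / p)) * r `^ (alpha - m%:R * p).
      rewrite -powRD; last by apply/implyP => _; rewrite gt_eqF.
      congr (_ `^ _); rewrite /q /b; field.
      by rewrite -/b !gt_eqF.
    rewrite mulrACA ler_wpM2r ?mulr_ge0 ?powR_ge0//.
    have -> : `|u r| `^ (q - p) = (`|u r| `^ p) `^ ((q - p) / p).
      by rewrite -powRrM mulrC divfK// gt_eqF.
    rewrite (powRrM r b) -powRM ?powR_ge0//.
    have qp0 : 0 <= (q - p) / p by rewrite divr_ge0 ?subr_ge0// ltW.
    apply: ge0_ler_powR => //; rewrite ?nnegrE ?mulr_ge0 ?powR_ge0 ?(ltW C0)//.
    apply: (le_trans (ler_wpM2r (powR_ge0 _ _) H)); rewrite -/b.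
    rewrite (_ : C * _ * _ * _ = C * fine S * (r `^ (- b) * r `^ b)); last by ring.
    rewrite -powRD ?addNr ?powRr0 ?mulr1//.
    by apply/implyP => _; rewrite gt_eqF.
  have HBu : (energy R p (alpha - m%:R * p) u <= B%:E * S)%E.
    by have := HB u Du; rewrite subnn.
  apply: (le_trans (lee_wpmul2l _ HBu)); first by rewrite lee_fin powR_ge0.
  rewrite -(fineK Sfn) -!EFinM lee_fin powRM ?(ltW C0)// /A.
  rewrite [leLHS](_ : _ = B * C `^ ((q - p) / p) * (fine S `^ ((q - p) / p) * fine S)); last by ring.
  rewrite ler_wpM2l ?(ltW A0)//.
  (* One factor of the energy comes from Hardy and (q - p) / p from the pointwise bound; the final
     root of order q leaves the exponent 1/p. *)
  have -> : q / p = (q - p) / p + 1 by field; rewrite gt_eqF.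
  rewrite powRD; first by rewrite powRr1.
  have : 0 <= (q - p) / p by rewrite divr_ge0 ?subr_ge0// ltW.
  by move=> h; rewrite gt_eqF// ltr_wpDl.
rewrite !wnormE -/S -(fineK Sfn) poweR_EFin -EFinM.
apply: (@le_trans _ _ ((A * fine S `^ (q / p))%:E `^ q^-1)%E).
  apply: gt0_ler_poweR; rewrite ?in_itv/= ?leey ?energy_ge0 ?invr_ge0 ?(ltW q0)//.
  by rewrite lee_fin mulr_ge0 ?powR_ge0 ?(ltW A0).
rewrite poweR_EFin lee_fin powRM ?powR_ge0 ?(ltW A0)// -powRrM.
by rewrite mulrAC mulfV ?gt_eqF// mul1r.
Qed.

End Inequality.

(** * Linearity of [D0], and Riesz-Fischer for the weighted energies *)

Section LinearCompleteness.
Context {K : realType}.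
Implicit Types (a b c x y e d r s t p q alpha theta : K) (f g u v w : K -> K) (R : \bar K).
Implicit Types (j k m n : nat).
Local Notation mu := (@lebesgue_measure K).

Lemma is_derive_lin a f g r : derivable f r 1 -> derivable g r 1 ->
  is_derive r 1 (fun s => a * f s + g s) (a * derive1 f r + derive1 g r).
Proof.
move=> /derivableP Hf /derivableP Hg; rewrite !derive1E.
exact: (is_deriveD (is_deriveZ a Hf) Hg).
Qed.

Lemma zeroto_near R r : zeroto R r -> \forall s \near r, zeroto R s.
Proof. by move=> Dr; apply: open_nbhs_nbhs; split => //; exact: zeroto_open. Qed.

Lemma derive1n_lin R a u v k r : zeroto R r ->
  (forall j s, (j.+1 < k)%N -> zeroto R s ->
    derivable (derive1n j u) s 1 /\ derivable (derive1n j v) s 1) ->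
  (forall j, (j < k)%N -> derivable (derive1n j u) r 1 /\ derivable (derive1n j v) r 1) ->
  derive1n k (fun s => a * u s + v s) r = a * derive1n k u r + derive1n k v r.
Proof.
elim: k r => [//|k IH] r Dr H Hr.
rewrite !derive1nS'.
have nE : {near r, derive1n k (fun s => a * u s + v s) =1
    (fun s => a * derive1n k u s + derive1n k v s)}.
  apply: filterS (zeroto_near Dr) => s Ds; apply: IH => // [j t jk Dt|j jk].
    by apply: H => //; exact: ltnW.
  exact: H.
rewrite (derive1_near_eq nE) derive1E.
have [du dv] := Hr k (ltnSn k).
exact: (is_derive_lin a du dv).(derive_val).
Qed.

Lemma AC_right_lin R m a u v : (0 < R)%E -> (0 < m)%N -> AC_right R m u -> AC_right R m v ->
  AC_right R m (fun s => a * u s + v s) /\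
  (forall j r, (j < m)%N -> zeroto R r ->
    derive1n j (fun s => a * u s + v s) r = a * derive1n j u r + derive1n j v r).
Proof.
move=> R0 m0 ACu ACv; set w := fun s => _.
have dD j s : (j < m.-1)%N -> zeroto R s ->
    derivable (derive1n j u) s 1 /\ derivable (derive1n j v) s 1.
  by move=> jm Ds; split; [exact: AC_right_derivable ACu jm Ds|exact: AC_right_derivable ACv jm Ds].
have E j r : (j < m)%N -> zeroto R r ->
    derive1n j w r = a * derive1n j u r + derive1n j v r.
  move=> jm Dr; apply: (derive1n_lin a Dr) => [i s ij Ds|i ij]; apply: dD => //.
    by rewrite -ltnS prednK// (leq_trans _ jm)// ltnS ltnW.
  by rewrite -ltnS prednK// (leq_trans _ jm).
have m1 : (m.-1 < m)%N by rewrite prednK.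
split => //; split.
  split.
    move=> j r jm Dr; have [du dv] := dD j r jm Dr.
    have jm' : (j < m)%N by exact: ltn_trans m1.
    have nE : {near r, (fun s => a * derive1n j u s + derive1n j v s) =1 derive1n j w}.
      by apply: filterS (zeroto_near Dr) => s Ds; rewrite E.
    exact: near_eq_derivable nE (is_derive_lin a du dv).(ex_derive).
  apply: (@ACloc_eq _ _ (fun s => a * derive1n m.-1 u s + derive1n m.-1 v s)).
    by move=> r Dr; rewrite E.
  apply: AClocD; last exact: AC_right_ACloc ACv m1.
  by apply: AClocM; [exact: ACloc_cst|exact: AC_right_ACloc ACu m1].
move=> j jm; have FF := toward_proper R0.
have [r0 Dr0] : exists r0, zeroto R r0.
  case: R R0 {ACu ACv dD E FF} => [b| |]//= b0.
    by exists (b / 2); rewrite lte_fin in b0; split; [lra|rewrite lte_fin; lra].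
  by exists 1; split => //; exact: ltry.
apply: (@cvg_trans _ ((fun r => a * derive1n j u r + derive1n j v r) r @[r --> toward R])).
  by apply: near_eq_cvg; apply: filterS (toward_near Dr0) => r [_ Dr]; rewrite E.
suff : (a * derive1n j u r + derive1n j v r) @[r --> toward R] --> a * 0 + 0.
  by rewrite mulr0 addr0.
apply: cvgD; last exact: AC_right_cvg ACv jm.
by apply: cvgM; [exact: cvg_cst|exact: AC_right_cvg ACu jm].
Qed.

Lemma AC_right_lin_ae R m a u v : (0 < m)%N -> AC_right R m u -> AC_right R m v ->
  {ae mu, forall r, zeroto R r -> forall j, (j <= m)%N ->
    derive1n j (fun s => a * u s + v s) r = a * derive1n j u r + derive1n j v r}.
Proof.
move=> m0 ACu ACv; have aeu := AC_right_ae_derivable ACu m0.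
have aev := AC_right_ae_derivable ACv m0.
apply: (@filterS2 _ _ (ae_filter_ringOfSetsType mu) _ _ _ _ aeu aev) => r Hu Hv Dr j jm.
apply: (derive1n_lin a Dr) => [i s ij Ds|i ij]; last first.
  by split; [apply: Hu|apply: Hv] => //; exact: leq_trans jm.
have im : (i < m.-1)%N by rewrite -ltnS prednK// (leq_trans ij).
by split; [exact: AC_right_derivable ACu im Ds|exact: AC_right_derivable ACv im Ds].
Qed.

(** Through the expansion, linearity of the gradient reduces to that of the derivatives up to order
    m, away from one null set. *)
Lemma nabla_lin_ae R m alpha a u v : (0 < R)%E -> (0 < m)%N ->
  AC_right R m u -> AC_right R m v ->
  {ae mu, forall r, zeroto R r -> nabla alpha m (fun s => a * u s + v s) r =
    a * nabla alpha m u r + nabla alpha m v r}.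
Proof.
move=> R0 m0 ACu ACv; have [c H] := AC_right_nabla alpha m.
have [ACw _] := AC_right_lin a R0 m0 ACu ACv.
have [_ /(_ erefl m0) Hu] := H R m u ACu.
have [_ /(_ erefl m0) Hv] := H R m v ACv.
have [_ /(_ erefl m0) Hw] := H R m _ ACw.
have aeD := AC_right_lin_ae a m0 ACu ACv.
have FF := ae_filter_ringOfSetsType mu.
apply: (@filterS2 _ _ FF _ _ _ _ (filterI Hu Hv) (filterI Hw aeD)).
move=> r [{}Hu {}Hv] [{}Hw {}aeD] Dr.
rewrite Hu// Hv// Hw// mulr_sumr -big_split/=; apply: eq_bigr => j _.
rewrite aeD ?(ltnS j m).1//; last by rewrite -ltnS.
by set A := r `^ _; set U := derive1n j u r; set V := derive1n j v r; ring.
Qed.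

Lemma D0_energy_lty R alpha m p u : 0 < p -> D0 R alpha m p u ->
  (energy R p alpha (derive1n m u) < +oo)%E.
Proof. by move=> p0 [_ [_]]; rewrite wnorm_lty. Qed.

Lemma energy_lty_D0 R alpha m p u : 0 < p -> (0 < m)%N -> AC_right R m u ->
  (energy R p alpha (derive1n m u) < +oo)%E -> D0 R alpha m p u.
Proof.
move=> p0 m0 ACu Su; split; first exact: ACu.
by split; [exact: AC_right_measurable ACu (leqnn m) m0|rewrite wnorm_lty].
Qed.

Lemma D0_lin R alpha m p a u v : (0 < R)%E -> (0 < m)%N -> 0 < p ->
  D0 R alpha m p u -> D0 R alpha m p v -> D0 R alpha m p (fun s => a * u s + v s).
Proof.
move=> R0 m0 p0 Du Dv; have [ACu ACv] := (Du.1, Dv.1).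
have [mU mV] := (Du.2.1, Dv.2.1).
have [Su Sv] := (D0_energy_lty p0 Du, D0_energy_lty p0 Dv).
have [ACw _] := AC_right_lin a R0 m0 ACu ACv.
have mW := AC_right_measurable ACw (leqnn m) m0.
apply: (energy_lty_D0 p0 m0 ACw).
have mau : measurable_fun (zeroto R) (fun r => a * derive1n m u r).
  by apply: measurable_funM; [exact: measurable_cst|exact: mU].
have ae : {ae mu, forall r, zeroto R r -> derive1n m (fun s => a * u s + v s) r =
    a * derive1n m u r + derive1n m v r}.
  apply: (@filterS _ _ (ae_filter_ringOfSetsType mu)) (AC_right_lin_ae a m0 ACu ACv).
  by move=> r H Dr; exact: H.
rewrite (ae_eq_energy p alpha mW (measurable_funD mau mV) ae).
apply: (le_lt_trans (energyD _ (ltW p0) mau mV)).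
rewrite (energyZ _ _ p0 mU); apply: lte_mul_pinfty; first by rewrite lee_fin powR_ge0.
  by [].
apply: lte_add_pinfty; last exact: Sv.
by apply: lte_mul_pinfty; [rewrite lee_fin powR_ge0|by []|exact: Su].
Qed.

Lemma cvg_fast_sequence (h : nat -> K) M : (forall n, `|h n.+1 - h n| <= M * (2^-1) ^+ n) ->
  cvgn h.
Proof.
move=> H; have : cvgn (series (fun n => h n.+1 - h n)).
  apply: normed_cvg; apply: (@series_le_cvg _ _ (geometric M 2^-1)).
  - by move=> n; exact: normr_ge0.
  - by move=> n; exact: le_trans (H n).
  - by move=> n; exact: H.
  - by apply: is_cvg_geometric_series; rewrite ger0_norm ?invr_ge0// invf_lt1// ltr1n.
move=> /cvg_ex[l Hl]; apply/cvg_ex; exists (l + h 0%N).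
apply: (@cvg_trans _ ((fun n => series (fun n => h n.+1 - h n) n + h 0%N) n @[n --> \oo])).
  apply: near_eq_cvg; apply: nearW => n.
  by rewrite /series/= telescope_sumr// subrK.
by apply: cvgD; [exact: Hl|exact: cvg_cst].
Qed.

(** The series of the terms 2^((n+1)p) |h_(n+1) - h_n|^p r^b has a finite integral, hence a finite
    sum almost everywhere. Each term is below the sum, so at such r the increments decay
    geometrically; no triangle inequality for the norm is involved. *)
Lemma energy_fast_ae_cvg R p b (h : nat -> K -> K) : 0 < p ->
  (forall n, measurable_fun (zeroto R) (h n)) ->
  (forall n, (((2 ^ n.+1)%:R `^ p)%:E * energy R p b (fun r => h n.+1 r - h n r)%R <=
    (1 / (2 ^ n.+1)%:R)%:E)%E) ->
  {ae mu, forall r, zeroto R r -> cvgn (fun n => h n r)}.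
Proof.
move=> p0 mh hE; have mD := measurable_zeroto R.
pose t n r := ((2 ^ n.+1)%:R `^ p * (`|h n.+1 r - h n r| `^ p * r `^ b)) : K.
have mdiff n : measurable_fun (zeroto R) (fun r => h n.+1 r - h n r).
  exact: measurable_funB.
have mt n : measurable_fun (zeroto R) (fun r => (t n r)%:E).
  by under eq_fun do rewrite /t EFinM; apply: measurable_funeM; exact: measurable_energy.
have t0 n r : 0 <= t n r by rewrite /t !mulr_ge0 ?powR_ge0.
have tE n : (\int[mu]_(r in zeroto R) (t n r)%:E)%E =
    (((2 ^ n.+1)%:R `^ p)%:E * energy R p b (fun r => h n.+1 r - h n r)%R)%E.
  rewrite /energy -ge0_integralZl_EFin ?powR_ge0//.
  - by move=> r _; rewrite lee_fin mulr_ge0 ?powR_ge0.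
  - exact: measurable_energy.
have intT : (\int[mu]_(r in zeroto R) \sum_(0 <= n <oo) (t n r)%:E < +oo)%E.
  rewrite integral_nneseries//; last by move=> n r _; rewrite lee_fin.
  apply: (@le_lt_trans _ _ (\sum_(0 <= n <oo) (1 / (2 ^ n.+1)%:R)%:E)%E).
    apply: lee_nneseries => [n _ _|n _]; last by rewrite tE.
    by apply: integral_ge0 => r _; rewrite lee_fin.
  by apply: (le_lt_trans (epsilon_trick0 xpredT ler01)); rewrite ltry.
have mS : measurable_fun (zeroto R) (fun r => \sum_(0 <= n <oo) (t n r)%:E)%E.
  by apply: ge0_emeasurable_sum => // n r _ _; rewrite lee_fin.
have S0 r : (0 <= \sum_(0 <= n <oo) (t n r)%:E)%E.
  by apply: nneseries_ge0 => n _ _; rewrite lee_fin.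
have iS : mu.-integrable (zeroto R) (fun r => \sum_(0 <= n <oo) (t n r)%:E)%E.
  apply/integrableP; split => //.
  by under eq_integral do rewrite gee0_abs//.
have aeS : {ae mu, forall r, zeroto R r -> (\sum_(0 <= n <oo) (t n r)%:E)%E \is a fin_num}.
  by apply: integrable_ae.
move: aeS; apply: (@filterS _ _ (ae_filter_ringOfSetsType mu)) => r H Dr; have {}H := H Dr.
have r0 := Dr.1; set S := (\sum_(0 <= n <oo) _)%E in H.
have tS n : t n r <= fine S.
  rewrite -lee_fin (fineK H).
  apply: (@le_trans _ _ (\sum_(0 <= i < n.+1) (t i r)%:E)%E).
    rewrite big_nat_recr//= leeDr//; apply: sume_ge0 => i _.
    by rewrite lee_fin.
  by apply: nneseries_lim_ge => i _ _; rewrite lee_fin.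
have Sf0 : 0 <= fine S by rewrite fine_ge0// S0.
apply: (@cvg_fast_sequence _ ((fine S * r `^ (- b)) `^ p^-1 * 2^-1)) => n.
have := tS n; rewrite /t => {}tS.
have : ((2 ^ n.+1)%:R * `|h n.+1 r - h n r|) `^ p <= fine S * r `^ (- b).
  rewrite powRM// powRN ler_pdivlMr ?powR_gt0//.
  by rewrite -mulrA.
move=> h1; have : (2 ^ n.+1)%:R * `|h n.+1 r - h n r| <= (fine S * r `^ (- b)) `^ p^-1.
  rewrite -[leLHS]powRr1 ?mulr_ge0// -[X in _ `^ X](mulfV (lt0r_neq0 p0)) powRrM.
  apply: ge0_ler_powR; rewrite ?nnegrE ?powR_ge0 ?invr_ge0 ?(ltW p0)//.
  by rewrite mulr_ge0 ?powR_ge0.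
rewrite mulrC -ler_pdivlMr; last by rewrite ltr0n expn_gt0.
by rewrite natrX exprS invfM mulrA exprVn.
Qed.

Lemma cvg_normr_powR (x_ : nat -> K) l p : 0 < p -> x_ n @[n --> \oo] --> l ->
  `|x_ n| `^ p @[n --> \oo] --> `|l| `^ p.
Proof.
(* x^p need not be differentiable at 0, so the limit 0 is treated by hand. *)
move=> p0; have [->|l0] := eqVneq l 0 => xl.
  rewrite normr0 powR0 ?gt_eqF//; apply/cvgr0Pnorm_lt => e e0.
  have /cvgr0Pnorm_lt /(_ _ (powR_gt0 p^-1 e0)) := xl.
  apply: filterS => n h; rewrite ger0_norm ?powR_ge0//.
  have : `|x_ n| `^ p < (e `^ p^-1) `^ p.
    by apply: gt0_ltr_powR; rewrite ?nnegrE ?powR_ge0.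
  by rewrite -powRrM mulVf ?gt_eqF// powRr1// ltW.
have dp : {for `|l|, continuous (fun x => x `^ p)}.
  apply: differentiable_continuous; apply/derivable1_diffP.
  have : 0 < `|l| by rewrite normr_gt0.
  by move=> /(is_derive1_powR p) []. 
apply: (@cvg_comp _ _ _ (fun n => `|x_ n|) (fun x => x `^ p) _ _ _ _ dp).
exact: cvg_norm.
Qed.

(** An upper limit defines [g] everywhere and keeps it measurable, also where the sequence diverges.
    Fatou's lemma passes the Cauchy bounds to the limit. *)
Lemma energy_limit R p b (h : nat -> K -> K) : 0 < p ->
  (forall n, measurable_fun (zeroto R) (h n)) ->
  {ae mu, forall r, zeroto R r -> cvgn (fun n => h n r)} ->
  exists g, measurable_fun (zeroto R) g /\ forall n N e,
    (forall k, (N <= k)%N -> (energy R p b (fun r => h n r - h k r)%R <= e%:E)%E) ->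
    (energy R p b (fun r => h n r - g r)%R <= e%:E)%E.
Proof.
move=> p0 mh aec; have mD := measurable_zeroto R.
pose g r := fine (limn_esup (fun n => (h n r)%:E)).
have mg : measurable_fun (zeroto R) g.
  apply: (measurableT_comp (@fine_measurable K setT measurableT)).
  by apply: measurable_fun_limn_esup => n; apply/measurable_EFinP.
have aeg : {ae mu, forall r, zeroto R r -> h n r @[n --> \oo] --> g r}.
  apply: (@filterS _ _ (ae_filter_ringOfSetsType mu)) aec => r H Dr.
  have /cvg_ex[l Hl] := H Dr.
  have HlE : (h n r)%:E @[n --> \oo] --> (l%:E : \bar K) by apply/fine_cvgP; split => //; apply: nearW.
  by rewrite /g (cvg_limn_einf_sup HlE).2.
exists g; split => // n N e He.
pose F k r : \bar K := (`|h n r - h (k + N)%N r| `^ p * r `^ b)%:E.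
have mF k : measurable_fun (zeroto R) (F k).
  by apply: measurable_energy; exact: measurable_funB.
have F0 k r : (0 <= F k r)%E by rewrite lee_fin mulr_ge0 ?powR_ge0.
have -> : energy R p b (fun r => h n r - g r)%R =
    (\int[mu]_(r in zeroto R) limn_einf (F ^~ r))%E.
  apply: ae_eq_integral => //.
  - by apply: measurable_energy; exact: measurable_funB.
  - rewrite /limn_einf; apply: measurableT_comp => //.
    apply: (@measurable_fun_limn_esup _ _ _ _ (fun k r => - F k r)%E) => k.
    exact: measurableT_comp.
  - apply: (@filterS _ _ (ae_filter_ringOfSetsType mu)) aeg => r H Dr; have {}H := H Dr.
    apply/esym; apply: (cvg_limn_einf_sup _).1; apply/fine_cvgP; split; first exact: nearW.
    rewrite /F /=; apply: cvgM; last exact: cvg_cst.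
    have c1 : (h n r - h (k + N)%N r) @[k --> \oo] --> h n r - g r.
      apply: cvgB; first exact: cvg_cst.
      by rewrite (cvg_shiftn N (fun k => h k r)).
    exact: cvg_normr_powR.
have Fat : (\int[mu]_(r in zeroto R) limn_einf (F ^~ r) <=
    limn_einf (fun k => \int[mu]_(r in zeroto R) F k r))%E by apply: fatou.
apply: (le_trans Fat).
rewrite limn_einf_lim; apply: lime_le; first exact: is_cvg_einfs.
apply: nearW => k; apply: (@le_trans _ _ (\int[mu]_(r in zeroto R) F k r)%E).
  by apply: ereal_inf_lbound; exists k => //=.
by apply: He; rewrite leq_addl.
Qed.

End LinearCompleteness.

(** * Primitives vanishing at R *)

Section Solving.
Context {K : realType}.
Implicit Types (a b c x y e d r s t p q alpha theta : K) (f g u v w : K -> K) (R : \bar K).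
Implicit Types (j k m n : nat).
Local Notation mu := (@lebesgue_measure K).

Lemma integrable_normr_fin_num (A : set K) g : measurable A ->
  mu.-integrable A (EFin \o g) -> (\int[mu]_(s in A) (`|g s|)%:E)%E \is a fin_num.
Proof.
move=> mA /integrableP[_ ig]; rewrite ge0_fin_numE; first exact: ig.
by apply: integral_ge0 => s _; rewrite lee_fin.
Qed.

(** Converse of [abs_cont_density]: the sum of the increments is at most the integral of |g| over
    the union of the intervals, which is small when that union has small measure. *)
Lemma integral_abs_cont a b f g : mu.-integrable setT (EFin \o g) ->
  (forall x, a <= x -> x <= b -> f x - f a = \int[mu]_(t in `]a, x]) g t) ->
  abs_cont a b f.
Proof.
move=> ig fE e e0; have [d [d0 H]] := integral_normr_continuous ig e0.
exists d => // n s t st tr lt.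
pose I (i : 'I_n) : set K := `]s i, t i[%classic.
pose U : set K := \big[setU/set0]_(i <- enum 'I_n) I i.
have mI i : measurable (I i) by exact: measurable_itv.
have mU : measurable U by apply: bigsetU_measurable => i _.
have muU : (mu U < d%:E)%E.
  have UE : U = \big[setU/set0]_(i < n) I i by rewrite /U big_enum.
  rewrite UE measure_semi_additive_ord//; last by rewrite -UE.
  apply: le_lt_trans (_ : ((\sum_(i < n) (t i - s i))%:E < d%:E)%E); last by rewrite lte_fin.
  rewrite -sumEFin; apply: lee_sum => i _.
  suff : (mu (I i) <= (t i - s i)%:E)%E by [].
  rewrite /I lebesgue_measure_itv/= lte_fin; case: ifPn => // _.
  by rewrite lee_fin subr_ge0; have [_ []] := st i.
have mg A : measurable_fun A (fun x => `|g x|).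
  apply: measurable_funTS; apply: measurableT_comp => //.
  by apply/measurable_EFinP; exact: measurable_int ig.
have igA A : measurable A -> mu.-integrable A (EFin \o g).
  by move=> mA; apply: integrableS ig.
have {}H := H U mU muU.
apply: le_lt_trans H; rewrite -lee_fin /Rintegral fineK; last first.
  exact: integrable_normr_fin_num (igA U mU).
rewrite (@integral_bigsetU_EFin _ _ _ mu _ I (fun x => `|g x|) (enum 'I_n))//; first last.
- by apply/measurable_EFinP; exact: mg.
- by apply: sub_trivIset tr.
- exact: enum_uniq.
rewrite big_enum/= -sumEFin; apply: lee_sum => i _.
have [h1 [h2 h3]] := st i.
have -> : f (t i) - f (s i) = \int[mu]_(x in `]s i, t i]) g x.
  have -> : f (t i) - f (s i) = (f (t i) - f a) - (f (s i) - f a) by ring.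
  rewrite (fE _ (le_trans h1 h2) h3) (fE _ h1 (le_trans h2 h3)).
  have -> : `]a, t i]%classic = `]a, s i]%classic `|` `]s i, t i]%classic.
    apply/seteqP; split => x /=; rewrite !in_itv/=.
      move=> /andP[ax xt]; have [xs|sx] := leP x (s i); first by left; rewrite ax.
      by right.
    by move=> [/andP[ax xs]|/andP[sx xt]]; apply/andP; split => //;
      [exact: le_trans h2|exact: le_lt_trans sx].
  rewrite Rintegral_setU//.
  - by ring.
  - by apply: igA; apply: measurableU; exact: measurable_itv.
  - apply/disj_setPS => x []/=; rewrite !in_itv/= => /andP[_ xs] /andP[sx _].
    by have := lt_le_trans sx xs; rewrite ltxx.
have ist : mu.-integrable `]s i, t i] (EFin \o g) by apply: igA; exact: measurable_itv.
have := EFin_normr_Rintegral _ ist => /(_ (measurable_itv _)) ->.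
apply: (le_trans (le_abse_integral _ _ _)); first exact: measurable_itv.
  exact: measurable_int ist.
rewrite -(@integral_itv_bndo_bndc _ (BRight (s i)) (t i))//.
by apply/measurable_EFinP; exact: mg.
Qed.

Definition tail R r : set K := zeroto R `&` away 1 r.

Lemma measurable_tail R r : measurable (tail R r).
Proof. exact: measurable_zeroto_away. Qed.

Lemma tailE R r s : tail R r s <-> zeroto R s /\ r < s.
Proof. by rewrite /tail /away /setI /= ltr01. Qed.

Lemma tail_integrable R p alpha g r : 1 < p -> 0 < alpha - p + 1 ->
  measurable_fun (zeroto R) g -> (energy R p alpha g < +oo)%E -> zeroto R r ->
  mu.-integrable (tail R r) (EFin \o g).
Proof.
move=> p1 a0 mg Eg Dr; have [C C0 HC] := tail_hoelder R p1 a0.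
apply/integrableP; split.
  by apply/measurable_EFinP; apply: measurable_funS mg; [exact: measurable_zeroto|move=> s []].
have := HC g r mg Dr; rewrite -/(tail R r) => H.
rewrite ltey; apply/eqP => h; move: H; rewrite h poweRyr; last by rewrite gt_eqF//; lra.
rewrite leye_eq => /eqP H.
have : ((C * r `^ (- (alpha - p + 1)))%:E * energy R p alpha g < +oo)%E.
  by apply: lte_mul_pinfty => //; rewrite lee_fin mulr_ge0 ?powR_ge0 ?(ltW C0).
by rewrite H ltxx.
Qed.

(** [g] need not be integrable near 0; cut off to [tail R a] it is integrable on the whole line, as
    the differentiation lemmas ask. *)
Lemma tail_primitive R g : (forall r, zeroto R r -> mu.-integrable (tail R r) (EFin \o g)) ->
  let w r := - \int[mu]_(s in tail R r) g s in
  forall a x, zeroto R a -> zeroto R x -> a <= x ->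
    w x - w a = \int[mu]_(t in `]a, x]) (g \_ (tail R a)) t.
Proof.
move=> ig w a x Da Dx ax; rewrite /w.
have sub : `]a, x]%classic `<=` tail R a.
  move=> s /=; rewrite in_itv/= => /andP[a_s sx]; apply/tailE; split => //.
  by apply: (zeroto_itv Da Dx) => //; exact: ltW.
have -> : \int[mu]_(t in `]a, x]) (g \_ (tail R a)) t = \int[mu]_(t in `]a, x]) g t.
  by apply: eq_Rintegral => s /set_mem xs; rewrite patchE mem_set//; exact: sub.
have tE : tail R a = `]a, x]%classic `|` tail R x.
  apply/seteqP; split => s.
    move=> /tailE[Ds a_s]; have [sx|xs] := leP s x.
      by left; rewrite /= in_itv/= a_s.
    by right; apply/tailE.
  move=> [/sub//|/tailE[Ds xs]]; apply/tailE; split => //; exact: le_lt_trans xs.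
have igU : mu.-integrable (`]a, x]%classic `|` tail R x) (EFin \o g).
  by rewrite -tE; exact: ig.
have dis : [disjoint `]a, x]%classic & tail R x].
  apply/disj_setPS => s [] /=; rewrite in_itv/= => /andP[_ sx] /tailE[_ xs].
  by have := lt_le_trans xs sx; rewrite ltxx.
rewrite [in X in _ - X]tE (Rintegral_setU _ _ igU dis).
- by ring.
- exact: measurable_itv.
- exact: measurable_tail.
Qed.

(** For finite R the tail has small measure and the integral is absolutely continuous; for infinite
    R the bound of [tail_hoelder] decays like r^(-(alpha - p + 1)). *)
Lemma tail_primitive_cvg R p alpha g : 1 < p -> 0 < alpha - p + 1 -> (0 < R)%E ->
  measurable_fun (zeroto R) g -> (energy R p alpha g < +oo)%E ->
  \int[mu]_(s in tail R r) `|g s| @[r --> toward R] --> (0 : K).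
Proof.
move=> p1 a0 R0 mg Eg; have p0 : 0 < p by lra.
have ig r : zeroto R r -> mu.-integrable (tail R r) (EFin \o g).
  exact: tail_integrable p1 a0 mg Eg.
have FF := toward_proper R0; apply/cvgr0Pnorm_lt => e e0.
case: R R0 FF mg Eg ig => [b| |]//= b0 FF mg Eg ig.
  have Dh : zeroto b%:E (b / 2).
    by rewrite lte_fin in b0; split; [lra|rewrite lte_fin; lra].
  have ih : mu.-integrable setT (EFin \o (g \_ (tail b%:E (b / 2)))).
    have := ig _ Dh; rewrite integrable_mkcond; last exact: measurable_tail.
    by rewrite restrict_EFin.
  have [d [d0 Hd]] := integral_normr_continuous ih e0.
  near=> r.
  have rb : r < b by near: r; exact: nbhs_left_lt.
  have hr : b / 2 < r by near: r; apply: nbhs_left_gt; have := Dh.2; rewrite lte_fin.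
  have dr : b - d < r by near: r; apply: nbhs_left_gt; lra.
  have tr : tail b%:E r = `]r, b[%classic.
    apply/seteqP; split => s; rewrite tailE /= in_itv/=.
      by move=> [[_ sb] rs]; rewrite rs; rewrite lte_fin in sb.
    move=> /andP[rs sb]; split => //; split; last by rewrite lte_fin.
    by apply: lt_trans rs; apply: lt_trans hr; have := Dh.1.
  rewrite ger0_norm; last by apply: Rintegral_ge0 => s _.
  have -> : \int[mu]_(s in tail b%:E r) `|g s| =
      \int[mu]_(s in tail b%:E r) `|(g \_ (tail b%:E (b / 2))) s|.
    apply: eq_Rintegral => s /set_mem /tailE[Ds rs]; rewrite patchE mem_set//.
    by apply/tailE; split => //; exact: lt_trans rs.
  apply: Hd; first exact: measurable_tail.
  suff : (mu (tail b%:E r) < d%:E)%E by [].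
  rewrite tr lebesgue_measure_itv/= lte_fin rb -EFinB lte_fin; lra.
have [C C0 HC] := tail_hoelder +oo%E p1 a0.
have Efn : energy +oo p alpha g \is a fin_num by rewrite ge0_fin_numE// energy_ge0.
pose k := alpha - p + 1.
pose M := C * fine (energy +oo p alpha g).
have M0 : 0 <= M by rewrite mulr_ge0 ?(ltW C0)// fine_ge0// energy_ge0.
near=> r.
have r1 : 0 < r by near: r; apply: nbhs_pinfty_gt; exact: num_real.
have rM : ((M + 1) / e `^ p) `^ k^-1 < r by near: r; apply: nbhs_pinfty_gt; exact: num_real.
have Dr : zeroto +oo r by split => //; exact: ltry.
rewrite ger0_norm; last by apply: Rintegral_ge0 => s _.
have ifn : (\int[mu]_(s in tail +oo r) (`|g s|)%:E)%E \is a fin_num.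
  by apply: integrable_normr_fin_num; [exact: measurable_tail|exact: ig].
have := HC g r mg Dr; rewrite -/(tail +oo r) -(fineK ifn) -(fineK Efn) poweR_EFin -EFinM.
rewrite lee_fin -/k => H; rewrite /Rintegral.
have I0 : 0 <= fine (\int[mu]_(s in tail +oo r) (`|g s|)%:E).
  by rewrite fine_ge0// integral_ge0.
set J := fine _ in H I0 *.
rewrite ltNge; apply/negP => eJ.
have : e `^ p <= J `^ p by apply: ge0_ler_powR; rewrite ?nnegrE ?(ltW p0) ?(ltW e0).
move=> /le_trans /(_ H); rewrite mulrAC -/M powRN ler_pdivlMr ?powR_gt0//.
have : (M + 1) / e `^ p < r `^ k.
  have -> : (M + 1) / e `^ p = (((M + 1) / e `^ p) `^ k^-1) `^ k.
    rewrite -powRrM mulVf ?gt_eqF// powRr1// divr_ge0 ?powR_ge0// addr_ge0//.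
  by apply: gt0_ltr_powR; rewrite ?nnegrE ?powR_ge0 ?(ltW r1).
rewrite ltr_pdivrMr ?powR_gt0// mulrC; lra.
Unshelve. all: by end_near. Qed.

(** The last two clauses permit iteration: where [g] is continuous the derivative is classical, and
    finite energy with weight alpha - p is what the next integration requires. *)
Lemma tail_primitive_solve R p alpha g : 1 < p -> 0 < alpha - p + 1 -> (0 < R)%E ->
  measurable_fun (zeroto R) g -> (energy R p alpha g < +oo)%E ->
  exists w, [/\ ACloc R w, w r @[r --> toward R] --> (0 : K),
    {ae mu, forall r, zeroto R r -> derive1 w r = g r},
    (forall r, zeroto R r -> {for r, continuous g} -> derivable w r 1 /\ derive1 w r = g r) &
    (energy R p (alpha - p) w < +oo)%E].
Proof.
move=> p1 a0 R0 mg Eg; have p0 : 0 < p by lra.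
have ig r : zeroto R r -> mu.-integrable (tail R r) (EFin \o g).
  exact: tail_integrable p1 a0 mg Eg.
pose w r := - \int[mu]_(s in tail R r) g s.
have wE := tail_primitive ig; rewrite -/w /= in wE.
have iga a : zeroto R a -> mu.-integrable setT (EFin \o (g \_ (tail R a))).
  move=> Da; have := ig _ Da; rewrite integrable_mkcond; last exact: measurable_tail.
  by rewrite restrict_EFin.
have wab a b : zeroto R a -> zeroto R b ->
    forall x, a <= x -> x <= b -> w x - w a = \int[mu]_(t in `]a, x]) (g \_ (tail R a)) t.
  by move=> Da Db x ax xb; apply: wE => //; exact: zeroto_itv ax xb.
have acw : ACloc R w.
  by move=> a b Da Db; apply: integral_abs_cont (iga a Da) (wab a b Da Db).
have wle r : zeroto R r -> (`|w r|%:E <= \int[mu]_(s in tail R r) (`|g s|)%:E)%E.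
  move=> Dr; rewrite /w normrN EFin_normr_Rintegral ?ig//; last exact: measurable_tail.
  apply: le_abse_integral; first exact: measurable_tail.
  exact: measurable_int (ig r Dr).
have FF := toward_proper R0.
exists w; split; first exact: acw.
- apply/cvgr0Pnorm_lt => e e0.
  have /cvgr0Pnorm_lt /(_ _ e0) := tail_primitive_cvg p1 a0 R0 mg Eg.
  have [r0 Dr0] : exists r0, zeroto R r0.
    case: R R0 {FF mg Eg ig wE iga wab acw wle} @w => [b| |]//= b0.
      by exists (b / 2); rewrite lte_fin in b0; split; [lra|rewrite lte_fin; lra].
    by exists 1; split => //; exact: ltry.
  move=> H; near=> r.
  have [_ Dr] : r0 < r /\ zeroto R r by near: r; exact: toward_near.
  apply: (@le_lt_trans _ _ `|\int[mu]_(s in tail R r) `|g s| |); last by near: r.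
  rewrite (ger0_norm (Rintegral_ge0 _ _))// -lee_fin /Rintegral fineK; first exact: wle.
  by apply: integrable_normr_fin_num; [exact: measurable_tail|exact: ig].
- pose P (n : nat) x := forall p q : rat, unpickle n = Some (p, q) ->
    zeroto R (ratr p) -> zeroto R (ratr q) -> ratr p < x -> x < ratr q -> derive1 w x = g x.
  have : {ae mu, forall x, forall n, P n x}.
    apply: ae_foralln => n; rewrite /P; case: (unpickle n) => [[a b]|]; last first.
      by apply: aeW.
    have [[Da Db]|nD] := pselect (zeroto R (ratr a) /\ zeroto R (ratr b)); last first.
      by apply: aeW => x p' q' [<- <-] Dp Dq; exfalso; apply: nD.
    have [ab|ba] := ltP (ratr a : K) (ratr b); last first.
      by apply: aeW => x p' q' [<- <-] _ _ h1 h2; have := lt_trans h1 h2; rewrite ltNge ba.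
    have := abs_cont_integral_derive ab (iga _ Da) (wab _ _ Da Db).
    apply: (@filterS _ _ (ae_filter_ringOfSetsType mu)) => x H p' q' [<- <-] _ _ h1 h2.
    have [_ ->] := H h1 h2; rewrite patchE mem_set//; apply/tailE; split => //.
    by apply: (zeroto_itv Da Db); exact: ltW.
  apply: (@filterS _ _ (ae_filter_ringOfSetsType mu)) => x H Dx.
  have [y xy Dy] := zeroto_gt Dx; have [z zx Dz] := zeroto_lt Dx.
  have [a] := rat_in_itvoo zx; rewrite in_itv/= => /andP[za ax].
  have [b] := rat_in_itvoo xy; rewrite in_itv/= => /andP[xb yb].
  apply: (H (pickle (a, b)) a b (pickleK _)) => //.
    by apply: (zeroto_itv Dz Dx); exact: ltW.
  by apply: (zeroto_itv Dx Dy); exact: ltW.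
- move=> r Dr cg; have [b rb Db] := zeroto_gt Dr; have [a ar Da] := zeroto_lt Dr.
  pose ga := g \_ (tail R a).
  have nga : {near r, g =1 ga}.
    near=> s; rewrite /ga patchE mem_set//; apply/tailE.
    have a_s : a < s by near: s; exact: lt_nbhsr.
    have sb : s < b by near: s; exact: lt_nbhsl.
    by split => //; apply: (zeroto_itv Da Db); exact: ltW.
  have gar : g r = ga r by exact: nbhs_singleton nga.
  have cga : {for r, continuous ga}.
    rewrite /prop_for /continuous_at -gar; apply: cvg_trans cg.
    by apply: near_eq_cvg; apply: filterS nga => s ->.
  have igab : mu.-integrable [set` Interval (BRight a) (BRight b)] (EFin \o ga).
    by apply: integrableS (iga a Da).
  have arB : (BRight a < BRight r)%O by rewrite bnd_simp.
  have [dF eF] := continuous_FTC1 rb igab arB cga.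
  have nE : {near r, (fun x => \int[mu]_(t in [set` Interval (BRight a) (BRight x)]) ga t) =1 (fun x => w x - w a)}.
    near=> x; rewrite (wab a b)//; apply: ltW; near: x; [exact: lt_nbhsr|exact: lt_nbhsl].
  have dB := near_eq_derivable nE dF; rewrite (derive1_near_eq nE) in eF.
  set F := (fun x => w x - w a) in dB eF.
  have wF : w = F + cst (w a) by apply/funext => y /=; rewrite fctE /F subrK.
  have dc : derivable (cst (w a) : K -> K) r 1 by exact: derivable_cst.
  rewrite gar wF; split; first exact: derivableD.
  by rewrite derive1E deriveD// derive_cst addr0 -derive1E.
- have g1 : alpha - p + 1 != 0 by rewrite gt_eqF.
  (* [hardy] asks only that [w] be dominated by a tail integral, so [wle] suffices. *)
  have [C C0 HC] := hardy R p1 g1.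
  have mag : measurable_fun (zeroto R) (fun s => `|g s|) by exact: measurableT_comp.
  have := HC w (fun s => `|g s|) (ACloc_measurable acw) mag (fun s _ => normr_ge0 _).
  have awE r : away (alpha - p + 1) r = away 1 r by rewrite /away a0 ltr01.
  move=> H; apply: le_lt_trans (H _) _; first by move=> r Dr; rewrite awE; exact: wle.
  by rewrite subrK; apply: lte_mul_pinfty => //; rewrite lee_fin ltW.
Unshelve. all: by end_near. Qed.

End Solving.

(** * Completeness of [D0] and surjectivity of [iota] *)

Section CompletenessOfD0.
Context {K : realType}.
Implicit Types (a b c x y e d r s t p q alpha theta : K) (f g u v w : K -> K) (R : \bar K).
Implicit Types (j k m n : nat).
Local Notation mu := (@lebesgue_measure K).

Lemma zeroto_nonempty R : (0 < R)%E -> exists r : K, zeroto R r.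
Proof.
case: R => [b| |]//= b0; last by exists 1; split => //; exact: ltry.
by exists (b / 2); rewrite lte_fin in b0; split; [lra|rewrite lte_fin; lra].
Qed.

Lemma toward_eq_cvg R f g l : (0 < R)%E -> (forall r, zeroto R r -> f r = g r) ->
  f r @[r --> toward R] --> (l : K) -> g r @[r --> toward R] --> l.
Proof.
move=> R0 fg; have FF := toward_proper R0; have [r0 Dr0] := zeroto_nonempty R0.
apply: cvg_trans; apply: near_eq_cvg.
by apply: filterS (toward_near Dr0) => r [_ Dr]; rewrite fg.
Qed.

Lemma zeroto_near_eq R f g r : zeroto R r -> (forall s, zeroto R s -> f s = g s) ->
  {near r, f =1 g}.
Proof. by move=> Dr fg; apply: filterS (zeroto_near Dr) => s; exact: fg. Qed.

(** Every integration starts from a continuous function, so all derivatives exist everywhere. Each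
    one lowers the weight by p, and b - k p + 1 > 0 leaves enough for k of them. *)
Lemma iterated_primitive R p b w k : 1 < p -> (0 < R)%E -> 0 < b - k%:R * p + 1 ->
  (forall r, zeroto R r -> {for r, continuous w}) -> (energy R p b w < +oo)%E ->
  exists u, [/\ forall j r, (j < k)%N -> zeroto R r -> derivable (derive1n j u) r 1,
    forall r, zeroto R r -> derive1n k u r = w r &
    forall j, (j < k)%N -> derive1n j u r @[r --> toward R] --> (0 : K)].
Proof.
move=> p1 R0; elim: k b w => [|k IH] b w bk cw Ew; first by exists w.
have p0 : 0 < p by lra.
have bE : b - k.+1%:R * p + 1 = (b - p) - k%:R * p + 1 by rewrite -natr1; ring.
have bp : 0 < b - p + 1.
  have : 0 <= k%:R * p by rewrite mulr_ge0 ?ler0n ?(ltW p0).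
  by rewrite bE in bk; lra.
have mw : measurable_fun (zeroto R) w.
  apply: open_continuous_measurable_fun; first exact: zeroto_open.
  by move=> x /set_mem; exact: cw.
have [w1 [acw1 w1R _ dw1 Ew1]] := tail_primitive_solve p1 bp R0 mw Ew.
rewrite bE in bk.
have [u [du uw1 uR]] := IH (b - p) w1 bk (fun r => ACloc_continuous acw1) Ew1.
exists u; split.
- move=> j r; rewrite ltnS leq_eqVlt => /orP[/eqP ->|jk] Dr; last exact: du.
  have nE := zeroto_near_eq Dr (fun s Ds => esym (uw1 s Ds)).
  exact: near_eq_derivable nE (dw1 r Dr (cw r Dr)).1.
- move=> r Dr; rewrite derive1nS' (derive1_near_eq (zeroto_near_eq Dr uw1)).
  exact: (dw1 r Dr (cw r Dr)).2.
- move=> j; rewrite ltnS leq_eqVlt => /orP[/eqP ->|jk]; last exact: uR.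
  exact: toward_eq_cvg R0 (fun s Ds => esym (uw1 s Ds)) w1R.
Qed.

(** Only the first integration has a merely measurable integrand and yields an almost everywhere
    derivative; the other m - 1 start from its continuous result. *)
Lemma D0_solve R p alpha m g : 1 < p -> (0 < R)%E -> (0 < m)%N ->
  0 < alpha - m%:R * p + 1 -> measurable_fun (zeroto R) g ->
  (energy R p alpha g < +oo)%E ->
  exists2 u, D0 R alpha m p u & {ae mu, forall r, zeroto R r -> derive1n m u r = g r}.
Proof.
move=> p1 R0 m0 am mg Eg; have p0 : 0 < p by lra.
have aE : alpha - m%:R * p + 1 = (alpha - p) - m.-1%:R * p + 1.
  by rewrite -[in LHS](prednK m0) -natr1; ring.
have ap : 0 < alpha - p + 1.
  have : 0 <= m.-1%:R * p by rewrite mulr_ge0 ?ler0n ?(ltW p0).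
  by rewrite aE in am; lra.
have [w [acw wR aew _ Ew]] := tail_primitive_solve p1 ap R0 mg Eg.
rewrite aE in am.
have [u [du uw uR]] := iterated_primitive p1 R0 am (fun r => ACloc_continuous acw) Ew.
have ACu : AC_right R m u.
  split; first by split => //; exact: ACloc_eq (fun r Dr => esym (uw r Dr)) acw.
  move=> j jm; have [->|jm1] := eqVneq j m.-1.
    exact: toward_eq_cvg R0 (fun s Ds => esym (uw s Ds)) wR.
  by apply: uR; rewrite ltn_neqAle jm1 -ltnS prednK.
have aeu : {ae mu, forall r, zeroto R r -> derive1n m u r = g r}.
  apply: (@filterS _ _ (ae_filter_ringOfSetsType mu)) aew => r H Dr.
  rewrite -[in LHS](prednK m0) derive1nS' (derive1_near_eq (zeroto_near_eq Dr uw)).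
  exact: H.
exists u => //; apply: (energy_lty_D0 p0 m0 ACu).
by rewrite (ae_eq_energy p alpha (AC_right_measurable ACu (leqnn m) m0) mg aeu).
Qed.

Lemma wnorm_le R p a b c f g : 0 < p -> 0 <= c ->
  (energy R p a f <= c%:E * energy R p b g)%E ->
  (wnorm R p a f <= (c `^ p^-1)%:E * wnorm R p b g)%E.
Proof.
move=> p0 c0 H; rewrite !wnormE -poweR_EFin -poweRM ?lee_fin ?energy_ge0//.
apply: gt0_ler_poweR => //; first by rewrite invr_ge0 ltW.
- by rewrite in_itv/= leey energy_ge0.
- by rewrite in_itv/= leey mule_ge0 ?lee_fin ?energy_ge0.
Qed.

Lemma wnorm_energy R p a f y : 0 < p -> 0 <= y -> wnorm R p a f = y%:E ->
  energy R p a f = (y `^ p)%:E.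
Proof.
move=> p0 y0; rewrite wnormE; case: (energy R p a f) (energy_ge0 R p a f) => [z| |]//.
- rewrite lee_fin poweR_EFin => z0 [<-].
  by rewrite -powRrM mulVf ?gt_eqF// powRr1.
- by rewrite poweRyr// invr_eq0 gt_eqF.
Qed.

Section CompletionOfD0.
Context {X : completeNormedModType K} (R : \bar K) (p alpha : K) (m : nat) (iota : (K -> K) -> X).
Hypotheses (p1 : 1 < p) (R0 : (0 < R)%E) (m0 : (0 < m)%N)
  (am : 0 < alpha - m%:R * p + 1) (hX : is_completion R alpha m p iota).
Local Notation D0m := (D0 R alpha m p).

Let p0 : 0 < p. Proof. by apply: lt_trans p1. Qed.

(** Differences are written [-1 * u r + v r] to fit the linearity clause of [is_completion]. *)
Lemma D0_sub u v : D0m u -> D0m v -> D0m (fun r => -1 * u r + v r).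
Proof. by move=> Du Dv; exact: D0_lin. Qed.

Lemma iota_sub u v : D0m u -> D0m v -> iota (fun r => -1 * u r + v r) = iota v - iota u.
Proof. by move=> Du Dv; have [-> // _ _] := hX; rewrite scaleN1r addrC. Qed.

Lemma iota_dist u v : D0m u -> D0m v ->
  energy R p alpha (derive1n m (fun r => -1 * u r + v r)) = (`|iota v - iota u| `^ p)%:E.
Proof.
move=> Du Dv; apply: (wnorm_energy p0 (normr_ge0 _)).
by have [_ /(_ _ (D0_sub Du Dv)) <- _] := hX; rewrite (iota_sub Du Dv).
Qed.

Lemma iota_dist_derive u v : D0m u -> D0m v ->
  energy R p alpha (fun r => derive1n m v r - derive1n m u r) = (`|iota v - iota u| `^ p)%:E.
Proof.
move=> Du Dv; rewrite -(iota_dist Du Dv).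
apply: (ae_eq_energy p alpha (measurable_funB Dv.2.1 Du.2.1) (D0_sub Du Dv).2.1).
apply: (@filterS _ _ (ae_filter_ringOfSetsType mu)) (AC_right_lin_ae (-1) m0 Du.1 Dv.1).
by move=> r H Dr /=; rewrite (H Dr m (leqnn m)) mulN1r addrC.
Qed.

(** Evaluation at [r] is Lipschitz for the norm of [X]; this makes the function attached to an
    element of [X] unique. *)
Lemma pointwise_dist r : zeroto R r -> exists2 C, 0 <= C & forall u v, D0m u -> D0m v ->
  `|v r - u r| <= C * `|iota v - iota u|.
Proof.
move=> Dr; have [C C0 HC] := AC_right_pointwise R p1 am m0.
pose A := C * r `^ (- (alpha - (m - 0)%:R * p + 1)).
have A0 : 0 <= A by rewrite mulr_ge0 ?powR_ge0 ?(ltW C0).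
exists (A `^ p^-1); first exact: powR_ge0.
move=> u v Du Dv; have := HC _ r (D0_sub Du Dv).1 Dr.
rewrite (iota_dist Du Dv) -EFinM lee_fin -/A /= mulN1r addrC => H.
have -> : `|v r - u r| = (`|v r - u r| `^ p) `^ p^-1.
  by rewrite -powRrM mulfV ?gt_eqF// powRr1.
have -> : `|iota v - iota u| = (`|iota v - iota u| `^ p) `^ p^-1.
  by rewrite -powRrM mulfV ?gt_eqF// powRr1.
rewrite -powRM ?powR_ge0//; apply: ge0_ler_powR; rewrite ?nnegrE ?powR_ge0 ?invr_ge0 ?(ltW p0)//.
by rewrite mulr_ge0 ?powR_ge0.
Qed.

(* D0 is already complete: an approximating sequence that converges fast has
   almost everywhere convergent m-th derivatives, and the limit is itself the
   m-th derivative of an element of D0. *)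
Lemma iota_surjective (x : X) : exists2 u, D0m u & iota u = x.
Proof.
have [_ _ dX] := hX.
(* Solves (2^(n+1) 2 eps)^p = 2^(-(n+1)), the decay that [energy_fast_ae_cvg] asks for; the inner 2
   is the cost of comparing two approximants through [x]. *)
pose eps n : K := (1 / (2 ^ n.+1)%:R) `^ p^-1 / (2 ^ n.+2)%:R.
have P0 n : 0 < (2 ^ n)%:R :> K by rewrite ltr0n expn_gt0.
have eps0 n : 0 < eps n by rewrite divr_gt0 ?powR_gt0 ?divr_gt0.
have epsS n : eps n.+1 <= eps n.
  apply: ler_pM; rewrite ?powR_ge0 ?invr_ge0 ?(ltW (P0 _))//.
    apply: ge0_ler_powR; rewrite ?nnegrE ?invr_ge0 ?divr_ge0 ?(ltW p0) ?(ltW (P0 _))//.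
    by rewrite ler_pM2l// lef_pV2 ?posrE// ler_nat leq_exp2l.
  by rewrite lef_pV2 ?posrE// ler_nat leq_exp2l.
have eps_le n k : (n <= k)%N -> eps k <= eps n.
  by move=> /subnK <-; elim: (k - n)%N => [//|i IH]; rewrite addSn (le_trans (epsS _)).
have epsE n : ((2 ^ n.+1)%:R * (2 * eps n)) `^ p = 1 / (2 ^ n.+1)%:R.
  have -> : (2 ^ n.+1)%:R * (2 * eps n) = (1 / (2 ^ n.+1)%:R) `^ p^-1.
    rewrite /eps (expnS 2 n.+1) natrM; field.
    by rewrite gt_eqF.
  by rewrite -powRrM mulVf ?gt_eqF// powRr1// divr_ge0// ltW.
have /choice[U HU] : forall n, exists u, D0m u /\ `|x - iota u| < eps n.
  move=> n; have [] := dX (ball x (eps n)).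
  - by exists x; exact: ballxx.
  - exact: ball_open.
  - by move=> y [xb [u Du uy]]; exists u; split => //; move: xb; rewrite -uy -ball_normE.
have DU n : D0m (U n) := (HU n).1.
have xU n : `|x - iota (U n)| < eps n := (HU n).2.
have UU n k : (n <= k)%N -> `|iota (U n) - iota (U k)| <= 2 * eps n.
  move=> nk; have := ler_distD x (iota (U n)) (iota (U k)).
  have := xU n; have := xU k; have := eps_le n k nk; rewrite (distrC (iota (U n)) x).
  move=> h1 h2 h3 h4; apply: (le_trans h4); rewrite mulr2n mulrDl mul1r.
  by apply: lerD; [exact: ltW|exact: le_trans (ltW h2) h1].
have mU n : measurable_fun (zeroto R) (derive1n m (U n)) := (DU n).2.1.
have fast n : (((2 ^ n.+1)%:R `^ p)%:E *
    energy R p alpha (fun r => derive1n m (U n.+1) r - derive1n m (U n) r)%R <=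
    (1 / (2 ^ n.+1)%:R)%:E)%E.
  rewrite (iota_dist_derive (DU n) (DU n.+1)) -EFinM lee_fin -(powRM _ (ltW (P0 _)) (normr_ge0 _)) -epsE.
  apply: ge0_ler_powR; rewrite ?nnegrE ?mulr_ge0 ?(ltW p0) ?(ltW (P0 _)) ?(ltW (eps0 _))//.
  by rewrite ler_pM2l// distrC UU.
have aec := energy_fast_ae_cvg p0 mU fast.
have [g [mg gE]] := energy_limit alpha p0 mU aec.
have gU n : (energy R p alpha (fun r => derive1n m (U n) r - g r)%R <= ((2 * eps n) `^ p)%:E)%E.
  apply: (gE n n) => k nk; rewrite (iota_dist_derive (DU k) (DU n)) lee_fin.
  by apply: ge0_ler_powR; rewrite ?nnegrE ?mulr_ge0 ?(ltW p0) ?(ltW (eps0 _))// UU.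
have Eg : (energy R p alpha g < +oo)%E.
  have mUg : measurable_fun (zeroto R) (fun r => derive1n m (U 0%N) r - g r).
    exact: measurable_funB.
  have mUg' : measurable_fun (zeroto R) (fun r => -1 * (derive1n m (U 0%N) r - g r)).
    exact: measurable_funM.
  rewrite (@eq_energy _ _ _ _ _ (fun r => derive1n m (U 0%N) r + -1 * (derive1n m (U 0%N) r - g r))).
    apply: (le_lt_trans (energyD _ (ltW p0) (mU 0%N) mUg')).
    apply: lte_mul_pinfty; [by rewrite lee_fin powR_ge0|by []|].
    apply: lte_add_pinfty; first exact: D0_energy_lty p0 (DU 0%N).
    rewrite (energyZ _ _ p0 mUg); apply: lte_mul_pinfty; [by rewrite lee_fin powR_ge0|by []|].
    by apply: le_lt_trans (gU 0%N) _; rewrite ltry.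
  by move=> r _; ring.
have [u Du aeu] := D0_solve p1 R0 m0 am mg Eg.
exists u => //; apply/esym/eqP; rewrite -subr_eq0 -normr_le0.
have le3 n : `|x - iota u| <= 3 * eps n.
  have : `|iota (U n) - iota u| <= 2 * eps n.
    have := gU n; rewrite -(ae_eq_energy p alpha _ _ _ (f := fun r => derive1n m (U n) r - derive1n m u r)).
    - rewrite (iota_dist_derive Du (DU n)) lee_fin => h; rewrite leNgt; apply/negP => lt.
      have : (2 * eps n) `^ p < `|iota (U n) - iota u| `^ p.
        by apply: gt0_ltr_powR; rewrite ?nnegrE ?mulr_ge0 ?(ltW (eps0 _)).
      by rewrite ltNge h.
    - by apply: measurable_funB; [exact: mU|exact: Du.2.1].
    - exact: measurable_funB.
    - apply: (@filterS _ _ (ae_filter_ringOfSetsType mu)) aeu => r H Dr; by rewrite H.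
  move=> h; apply: (le_trans (ler_distD (iota (U n)) _ _)).
  by have := xU n; lra.
have [z zE] : exists z, z = `|x - iota u| by eexists.
rewrite -zE in le3 *; rewrite leNgt; apply/negP => z0.
have [n hn] : exists n, 3 * eps n < z.
  exists (Num.bound (3 / z)).
  set n := Num.bound _.
  have h1 : 3 / z < n%:R by apply: archi_boundP; rewrite divr_ge0 ?(ltW z0).
  have h2 : eps n <= 1 / (2 ^ n.+2)%:R.
    have : (1 / (2 ^ n.+1)%:R : K) `^ p^-1 <= 1 `^ p^-1.
      apply: ge0_ler_powR; rewrite ?nnegrE ?invr_ge0 ?divr_ge0 ?(ltW p0) ?(ltW (P0 _))//.
      by rewrite ler_pdivrMr// mul1r ler1n expn_gt0.
    by rewrite powR1 => h; rewrite ler_pM2r ?invr_gt0.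
  apply: (@le_lt_trans _ _ (3 * (1 / (2 ^ n.+2)%:R))); first by rewrite ler_pM2l.
  rewrite mulrA mulr1 ltr_pdivrMr// mulrC -ltr_pdivrMr//; apply: (lt_trans h1).
  rewrite ltr_nat; apply: (@ltn_trans (2 ^ n)); first exact: ltn_expl.
  by rewrite ltn_exp2l// ltnS ltnW.
by have := lt_le_trans hn (le3 n); rewrite ltxx.
Qed.

End CompletionOfD0.

(** A nonzero value persists on a ball, which has positive measure. *)
Lemma ae_zero_continuous R u : (forall r, zeroto R r -> {for r, continuous u}) ->
  {ae mu, forall r, zeroto R r -> u r = 0} -> forall r, zeroto R r -> u r = 0.
Proof.
move=> cu [N [mN N0 NE]] r Dr; apply: contrapT => /eqP ur0.
have : \forall s \near r, u s != 0 /\ zeroto R s.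
  near=> s; split; first by near: s; exact: (cvgr_neq0 _ (cu r Dr)).
  by near: s; exact: zeroto_near.
move=> /nbhs_ballP[e /= e0 eH].
have : (mu (ball r e) <= mu N)%E.
  apply: le_measure; rewrite ?inE//; first exact: measurable_ball.
  move=> s /eH[us Ds]; apply: NE => /= H; move: us; rewrite H// eqxx//.
rewrite N0 lebesgue_measure_ball ?(ltW e0)// lee_fin.
by rewrite leNgt pmulrn_lgt0// e0.
Unshelve. all: by end_near. Qed.

Lemma derive1n_zero R u k : (forall r, zeroto R r -> u r = 0) ->
  forall r, zeroto R r -> derive1n k u r = 0.
Proof.
move=> u0; elim: k => [//|k IH] r Dr; rewrite derive1nS'.
by rewrite (derive1_near_eq (zeroto_near_eq Dr (g := cst 0) IH)) derive1_cst.
Qed.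

End CompletenessOfD0.

(** * The realization, the gradient and the embedding obtained from preimages *)

Section Assembly.
Context {K : realType} {X : completeNormedModType K}.
Context (R : \bar K) (p alpha : K) (m : nat) (iota : (K -> K) -> X).
Implicit Types (u v : K -> K) (r theta : K).
Hypotheses (p1 : 1 < p) (R0 : (0 < R)%E) (m0 : (0 < m)%N)
  (am : 0 < alpha - m%:R * p + 1) (hX : is_completion R alpha m p iota).
Local Notation mu := (@lebesgue_measure K).
Local Notation D0m := (D0 R alpha m p).

Let p0 : 0 < p. Proof. by apply: lt_trans p1. Qed.

Lemma D0_continuous u r : D0m u -> zeroto R r -> {for r, continuous u}.
Proof. by move=> Du; apply: ACloc_continuous; exact: (AC_right_ACloc Du.1 m0). Qed.

Lemma D0_measurable_nabla u : D0m u -> measurable_fun (zeroto R) (nabla alpha m u).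
Proof. by move=> Du; exact: measurable_nabla Du.1 (leqnn m) m0. Qed.

Lemma nabla_bound : exists2 C, 0 < C & forall u, D0m u ->
  (wnorm R p alpha (nabla alpha m u) <= (C * `|iota u|)%:E)%E.
Proof.
have [C C0 HC] := nabla_energy_le R p1 am m0.
exists (C `^ p^-1); first exact: powR_gt0.
move=> u Du; have := wnorm_le p0 (ltW C0) (HC u Du.1).
by have [_ /(_ u Du) <- _] := hX; rewrite -EFinM.
Qed.

Lemma nabla_dist : exists2 C, 0 < C & forall u v, D0m u -> D0m v ->
  (wnorm R p alpha (fun r => nabla alpha m v r - nabla alpha m u r)%R <=
    (C * `|iota v - iota u|)%:E)%E.
Proof.
have [C C0 HC] := nabla_bound; exists C; [exact: C0|move=> u v Du Dv].
have Duv := D0_sub p1 R0 m0 Du Dv.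
have := HC _ Duv; rewrite (iota_sub hX Du Dv); apply: le_trans.
have mvu := measurable_funB (D0_measurable_nabla Dv) (D0_measurable_nabla Du).
rewrite !wnormE (ae_eq_energy p alpha mvu (D0_measurable_nabla Duv)); first exact: lexx.
apply: (@filterS _ _ (ae_filter_ringOfSetsType mu)) (nabla_lin_ae alpha (-1) R0 m0 Du.1 Dv.1).
by move=> r H Dr /=; rewrite (H Dr) mulN1r addrC.
Qed.

Lemma iota_inj_ae u : D0m u -> {ae mu, forall r, zeroto R r -> u r = 0} -> iota u = 0.
Proof.
move=> Du /(ae_zero_continuous (fun r Dr => D0_continuous Du Dr)) u0.
have d0 := derive1n_zero m u0.
have [_ /(_ u Du) H _] := hX; apply/normr0_eq0/EFin_inj; rewrite H wnormE.
rewrite (eq_energy p alpha (g := cst 0)); last by move=> r /d0 ->.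
rewrite /energy integral0_eq; last by move=> r _; rewrite /= normr0 powR0 ?gt_eqF// mul0r.
by rewrite poweR0r// invr_eq0 gt_eqF.
Qed.

Variable ux : X -> K -> K.
Hypotheses (Dux : forall x, D0m (ux x)) (iota_ux : forall x, iota (ux x) = x).

Lemma realization_preimage : realization R alpha m p iota ux.
Proof.
move=> x U DU Ux r Dr; have [C C0 HC] := pointwise_dist p1 R0 m0 am hX Dr.
apply/cvgrPdist_le => e e0; have eC : 0 < e / (C + 1).
  by apply: divr_gt0 => //; lra.
move/cvgrPdist_le : Ux => /(_ _ eC); apply: filterS => n.
have := HC (U n) (ux x) (DU n) (Dux x); rewrite iota_ux => h1 h2; apply: (le_trans h1).
have C10 : 0 < C + 1 by lra.
rewrite ler_pdivlMr// in h2; apply: le_trans h2.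
by rewrite mulrC ler_wpM2l//; lra.
Qed.

Lemma grad_extension_preimage :
  grad_extension R alpha m p iota (fun x => nabla alpha m (ux x)).
Proof.
split=> [x|x U DU Ux].
  have [C C0 HC] := nabla_bound; split; first exact: D0_measurable_nabla.
  exact: le_lt_trans (HC _ (Dux x)) (ltry _).
have [C C0 HC] := nabla_dist.
apply: (@squeeze_cvge _ _ _ _ (fun=> 0%E) _ (fun n => (C * `|iota (U n) - x|)%:E)).
- near=> n; rewrite wnormE poweR_ge0 /=.
  by have := HC (ux x) (U n) (Dux x) (DU n); rewrite iota_ux.
- exact: cvg_cst.
- apply: cvg_EFin; first by near=> n.
  rewrite -[X in _ --> X](mulr0 C); apply: cvgM; first exact: cvg_cst.
  by apply/norm_cvg0P; rewrite -(subrr x); apply: cvgB Ux _; exact: cvg_cst.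
Unshelve. all: by end_near. Qed.

Lemma continuous_embedding_preimage theta : -1 < alpha -> -1 < theta ->
  alpha - m%:R * p <= theta ->
  continuous_embedding R ((theta + 1) * p / (alpha - m%:R * p + 1)) theta ux.
Proof.
move=> al th ta.
have [C1 C10 HC1] := pstar_inequality p1 al th R0 m0 ta am.
have [C2 C20 HC2] := nabla_bound.
have bound x : (wnorm R ((theta + 1) * p / (alpha - m%:R * p + 1)) theta (ux x) <=
    (C1 * C2 * `|x|)%:E)%E.
  apply: (le_trans (HC1 _ (Dux x))).
  rewrite -mulrA EFinM; apply: lee_wpmul2l; first by rewrite lee_fin ltW.
  by have := HC2 _ (Dux x); rewrite iota_ux.
split.
- move=> a x y r Dr; have [C C0 HC] := pointwise_dist p1 R0 m0 am hX Dr.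
  have Dl := D0_lin a R0 m0 p0 (Dux x) (Dux y).
  (* The chosen preimages need not depend linearly on x, but both functions have the same image
     under [iota], so [pointwise_dist] identifies them on (0, R). *)
  have := HC _ _ Dl (Dux (a *: x + y)).
  have [lin _ _] := hX; rewrite (lin a _ _ (Dux x) (Dux y)) !iota_ux subrr normr0 mulr0 normr_le0 subr_eq0.
  by move=> /eqP.
- move=> x; split; last exact: le_lt_trans (bound x) (ltry _).
  exact: (AC_right_measurable (Dux x).1 (leq0n m) m0).
- by exists (C1 * C2); [exact: mulr_gt0|exact: bound].
- by move=> x /(iota_inj_ae (Dux x)); rewrite iota_ux.
Qed.

End Assembly.

Theorem theorem1p1 (K : realType) (p alpha theta : K) (R : \bar K) (m : nat)
    (hp : 2 <= p) (halpha : -1 < alpha) (htheta : -1 < theta)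
    (hR : (0 < R)%E) (hm : (1 <= m)%N)
    (hta : alpha - m%:R * p <= theta) (hpos : 0 < alpha - m%:R * p + 1)
    (X : completeNormedModType K) (iota : (K -> K) -> X)
    (hX : is_completion R alpha m p iota) :
  let pstar := (theta + 1) * p / (alpha - m%:R * p + 1) in
  exists fn grad : X -> K -> K,
    [/\ realization R alpha m p iota fn,
        grad_extension R alpha m p iota grad,
        exists2 C : K, 0 < C & forall x : X,
          (wnorm R pstar theta (fn x) <= C%:E * wnorm R p alpha (grad x))%E
      & continuous_embedding R pstar theta fn].
Proof.
move=> pstar; have p1 : 1 < p by lra.
have /choice[ux Hux] : forall x : X, exists u, D0 R alpha m p u /\ iota u = x.
  by move=> x; have [u Du ux] := iota_surjective p1 hR hm hpos hX x; exists u.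
have Dux x : D0 R alpha m p (ux x) := (Hux x).1.
have iux x : iota (ux x) = x := (Hux x).2.
(* With true preimages the gradient extension is the gradient itself, and the inequality carries
   over without a limit. *)
exists ux, (fun x => nabla alpha m (ux x)); split.
- exact: realization_preimage p1 hR hm hpos hX _ Dux iux.
- exact: grad_extension_preimage p1 hR hm hpos hX _ Dux iux.
- have [C C0 HC] := pstar_inequality p1 halpha htheta hR hm hta hpos.
  by exists C => // x; exact: HC.
- exact: continuous_embedding_preimage p1 hR hm hpos hX _ Dux iux _ halpha htheta hta.
Qed.
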